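(* Let $d\ge1$, let $f\colon(0,\infty)\to(0,\infty)$ be nondecreasing, and let $\sigma\colon\mathbb{R}\to\mathbb{R}$ be Lipschitz continuous such that there are constants $k_1,k_2>0$ with $k_1<\sigma(x)<k_2$ for all $x\in\mathbb{R}$. Let $Y$ be the mild solution to the stochastic heat equation with multiplicative Lévy noise $\sigma(Y)\dot\Lambda$ with Lévy measure $\lambda$ (see context), and let $Y_0(t)=Y(t,0)$. Assume that there exists $\varepsilon>0$ with $\int_{\mathbb{R}}|z|^{1+\varepsilon}\,\lambda(dz)<\infty$, and that $\int_{-1}^1|z\log|z||\,\lambda(dz)<\infty$. (1) (a) Suppose $\int_1^\infty 1/f(t)\,dt=\infty$. If $\lambda((0,\infty))>0$, then $\limsup_{t\to\infty}Y_0(t)/f(t)=\infty$ a.s.; if $\lambda((-\infty,0))>0$, then $\liminf_{t\to\infty}Y_0(t)/f(t)=-\infty$ a.s. (b) If $\int_1^\infty 1/f(t)\,dt<\infty$, then $\lim_{t\to\infty}Y_0(t)/f(t)=0$ a.s. (2) If $\lambda((0,\infty))=0$, then $\limsup_{t\to\infty}Y_0(t)/t<\infty$ a.s. If $\lambda((-\infty,0))=0$, then $\liminf_{t\to\infty}Y_0(t)/t>-\infty$ a.s.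
   Context: The heat kernel on $\mathbb{R}^d$ is $g(t,x)=(4\pi t)^{-d/2}e^{-|x|^2/(4t)}$ for $t>0$, and $g(t,x)=0$ for $t\le 0$. Let $\lambda$ be a Lévy measure on $\mathbb{R}$ (so $\lambda(\{0\})=0$), not identically zero, with $\int_{\mathbb{R}}|z|\,\lambda(dz)<\infty$. Let $\mu$ be a Poisson random measure on $(0,\infty)\times\mathbb{R}^d\times\mathbb{R}$ with intensity $dt\,dx\,\lambda(dz)$ and points $(\tau_i,\eta_i,\zeta_i)_{i\in\mathbb{N}}$. Let $m\in\mathbb{R}$ (the mean) and $m_0=m-\int_{\mathbb{R}}z\,\lambda(dz)$ (the drift). The Lévy space-time white noise without Gaussian part is $\Lambda(dt,dx)=m_0\,dt\,dx+\int_{\mathbb{R}}z\,\mu(dt,dx,dz)$. The equation is $\partial_tY=\Delta Y+\sigma(Y)\dot\Lambda$ on $(0,\infty)\times\mathbb{R}^d$, $Y(0,\cdot)=0$. Its mild solution (known to exist and to be unique under these assumptions) is the predictable process $Y$ satisfying $Y(t,x)=\int_0^t\int_{\mathbb{R}^d}g(t-s,x-y)\,\sigma(Y(s,y))\,\Lambda(ds,dy)$, i.e. $Y(t,x)=m_0\int_0^t\int_{\mathbb{R}^d}g(t-s,x-y)\sigma(Y(s,y))\,dy\,ds+\sum_{\tau_i\le t}g(t-\tau_i,x-\eta_i)\sigma(Y(\tau_i,\eta_i))\zeta_i$. *)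

(* Defs.v *)
From HB Require Import structures.
From mathcomp Require Import all_boot all_order all_algebra.
From mathcomp Require Import all_classical all_reals all_analysis measurable_realfun.
Set Implicit Arguments.
Unset Strict Implicit.
Unset Printing Implicit Defensive.
Import Order.TTheory GRing.Theory Num.Theory.
Import numFieldNormedType.Exports.
Local Open Scope classical_set_scope.
Local Open Scope ring_scope.

(* The library has no measurable structure on row vectors, so R^d is the type
   of d-tuples, with its product (Borel) sigma-algebra. *)
Notation Rd R d := (d.-tuple (measurableTypeR R)).

(* Time, space and mark (jump size). *)
Notation marked_spacetime R d :=
  (measurableTypeR R * Rd R d * measurableTypeR R)%type.

Definition Rd0 {R : realType} {d : nat} : Rd R d := [tuple 0 | _ < d].

Definition subRd {R : realType} {d : nat} (x y : Rd R d) : Rd R d :=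
  [tuple (tnth x i - tnth y i : R) | i < d].

Definition sqnormRd {R : realType} {d : nat} (x : Rd R d) : R :=
  \sum_(i < d) (tnth x i : R) ^+ 2.

(* A transparent alias of the product measure: on the product itself the
   sigma-finite structure is not inferred, because the subprobability one
   was declared first. *)
Section SigmaFiniteProduct.
Context d1 d2 (T1 : measurableType d1) (T2 : measurableType d2) (R : realType).
Variable m1 : {sigma_finite_measure set T1 -> \bar R}.
Variable m2 : {sigma_finite_measure set T2 -> \bar R}.

Definition sigma_finite_prod : set (T1 * T2) -> \bar R := (m1 \x m2)%E.

HB.instance Definition _ := Measure.on sigma_finite_prod.

Let sigma_finite_prod_sigma_finite : sigma_finite setT sigma_finite_prod.
Proof.
have /sigma_finiteP[F [TF ndF Foo]] := sigma_finiteT m1.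
have /sigma_finiteP[G [TG ndG Goo]] := sigma_finiteT m2.
exists (fun n => F n `*` G n).
 rewrite -setXTT TF TG predeqE => -[x y]; split.
    move=> [/= [n _ Fnx] [k _ Gky]]; exists (maxn n k) => //; split.
    - by move: x Fnx; exact/subsetPset/ndF/leq_maxl.
    - by move: y Gky; exact/subsetPset/ndG/leq_maxr.
  by move=> [n _ []/= ? ?]; split; exists n.
move=> k; have [? ?] := Foo k; have [? ?] := Goo k.
split; first exact: measurableX.
rewrite /sigma_finite_prod product_measure1E//.
by rewrite lte_mul_pinfty// ge0_fin_numE.
Qed.

HB.instance Definition _ := Measure_isSigmaFinite.Build _ _ _ sigma_finite_prod
  sigma_finite_prod_sigma_finite.

End SigmaFiniteProduct.

Section LebesgueRd.
Context {R : realType}.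

Definition consRd {d : nat} (p : measurableTypeR R * Rd R d) : Rd R d.+1 :=
  cons_tuple p.1 p.2.

Lemma measurable_consRd d : measurable_fun [set: _] (@consRd d).
Proof. by apply: measurable_cons. Qed.

Section step.
Context {d : nat} (m : {sigma_finite_measure set (Rd R d) -> \bar R}).

Definition lebesgue_stepRd : set (Rd R d.+1) -> \bar R :=
  pushforward (sigma_finite_prod lebesgue_measure m) (@consRd d).

Let step0 : lebesgue_stepRd set0 = 0%E.
Proof. by rewrite /lebesgue_stepRd /pushforward preimage_set0 measure0. Qed.

Let step_ge0 A : (0 <= lebesgue_stepRd A)%E.
Proof. exact: (measure_ge0 (sigma_finite_prod lebesgue_measure m)). Qed.

Let step_additive : semi_sigma_additive lebesgue_stepRd.
Proof.
have mc := @measurable_consRd d.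
move=> F mF tF mUF; rewrite /lebesgue_stepRd /pushforward preimage_bigcup.
apply: measure_semi_sigma_additive.
- by move=> n; rewrite -[X in measurable X]setTI; exact: mc.
- apply/trivIsetP => /= i j _ _ ij; rewrite -preimage_setI.
  by move/trivIsetP : tF => /(_ _ _ _ _ ij) ->//; rewrite preimage_set0.
- by rewrite -preimage_bigcup -[X in measurable X]setTI; exact: mc.
Qed.

HB.instance Definition _ := isMeasure.Build _ _ _ lebesgue_stepRd
  step0 step_ge0 step_additive.

Let step_sigma_finite : sigma_finite setT lebesgue_stepRd.
Proof.
have [F FT mF] := sigma_finiteT (sigma_finite_prod lebesgue_measure m).
pose h (x : Rd R d.+1) : measurableTypeR R * Rd R d := (thead x, behead_tuple x).
have mh : measurable_fun setT h.
  apply/measurable_fun_pairP; split; first exact: measurable_tnth.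
  apply/measurable_fun_tnthP => i.
  rewrite [X in measurable_fun _ X](_ : _ = (@tnth _ _)^~ (lift ord0 i)).
    exact: measurable_tnth.
  by apply/funext => x /=; rewrite tnth_behead; congr tnth; apply: val_inj;
    rewrite /= inordK// ltnS.
have hK : cancel (@consRd d) h.
  by move=> [a t]; congr pair; apply: val_inj.
exists (fun n => h @^-1` F n); first by rewrite -preimage_bigcup -FT preimage_setT.
move=> n; have [mFn Fn] := mF n; split.
  by rewrite -[X in measurable X]setTI; exact: mh.
rewrite /lebesgue_stepRd /pushforward.
rewrite [X in (_ X < _)%E](_ : _ = F n)//.
by apply/seteqP; split => p /=; rewrite hK.
Qed.

HB.instance Definition _ := Measure_isSigmaFinite.Build _ _ _ lebesgue_stepRd
  step_sigma_finite.
End step.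

Definition dirac_tuple0 : {sigma_finite_measure set (Rd R 0) -> \bar R} :=
  \d_(Rd0 : Rd R 0).

Fixpoint lebesgue_measureRd (d : nat) :
    {sigma_finite_measure set (Rd R d) -> \bar R} :=
  match d with
  | 0%N => dirac_tuple0
  | d'.+1 => lebesgue_stepRd (lebesgue_measureRd d')
  end.

End LebesgueRd.
Arguments lebesgue_measureRd : clear implicits.

Definition heat_kernel {R : realType} {d : nat} (t : R) (x : Rd R d) : R :=
  if 0 < t
  then (4 * pi * t) `^ (- (d%:R / 2)) * expR (- (sqnormRd x / (4 * t)))
  else 0.

Definition levy_measure {R : realType}
    (lambda : {measure set (measurableTypeR R) -> \bar R}) : Prop :=
  lambda [set 0] = 0%E /\
  (\int[lambda]_z (Num.min 1 ((z : R) ^+ 2))%:E < +oo)%E.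

Section PoissonRandomMeasure.
Context {R : realType} {disp dispT : measure_display}.
Context {Omega : measurableType disp} {T : measurableType dispT}.

Definition counting_measure_of_points (p : nat -> T) :
    {measure set T -> \bar R} := mseries (fun i => \d_(p i)) 0.

(* The natural-number argument of poisson_prob is a dummy. *)
Definition poisson_random_measure (P : probability Omega R)
    (nu : set T -> \bar R) (N : Omega -> {measure set T -> \bar R}) : Prop :=
  [/\ forall A, measurable A -> measurable_fun [set: Omega] (fun w => N w A),
      forall A, measurable A -> (nu A < +oo)%E -> forall k : nat,
        P [set w | N w A = k%:R%:E] =
        poisson_prob (fine (nu A)) 0%N [set k]
    & forall (n : nat) (A : 'I_n -> set T) (B : 'I_n -> set (\bar R)),
        (forall i, measurable (A i)) -> trivIset [set: 'I_n] A ->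
        (forall i, measurable (B i)) ->
        P [set w | forall i, B i (N w (A i))] =
        (\prod_(i < n) P [set w | B i (N w (A i))])%E].

End PoissonRandomMeasure.

Section StochasticHeatEquation.
Context {R : realType} {d : nat} {disp : measure_display}.
Context {Omega : measurableType disp}.

Definition lebesgue_spacetime :
    {sigma_finite_measure set (measurableTypeR R * Rd R d)%type -> \bar R} :=
  sigma_finite_prod lebesgue_measure (lebesgue_measureRd R d).

Lemma measurable_pos_time :
  measurable [set p : marked_spacetime R d | 0 < (p.1.1 : R)].
Proof.
rewrite (_ : [set _ | _] = (fst \o fst) @^-1` `]0, +oo[%classic); last first.
  by apply/seteqP; split => p /=; rewrite in_itv/= andbT.
have mf : measurable_fun setT (fst \o fst : R * Rd R d * R -> R).
  exact: measurableT_comp.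
by rewrite -[X in measurable X]setTI; apply: mf => //; exact: measurable_itv.
Qed.

Definition noise_intensity
    (lambda : {measure set (measurableTypeR R) -> \bar R}) :
    {measure set (marked_spacetime R d) -> \bar R} :=
  mrestr (lebesgue_spacetime \x^ lambda)%E measurable_pos_time.

Definition noise_measure (tau : nat -> Omega -> R) (eta : nat -> Omega -> Rd R d)
    (zeta : nat -> Omega -> R) (w : Omega) :
    {measure set (marked_spacetime R d) -> \bar R} :=
  counting_measure_of_points (fun i =>
    (tau i w : measurableTypeR R, eta i w, zeta i w : measurableTypeR R)).

Definition filtration (F : R -> set (set Omega)) : Prop :=
  [/\ forall t, 0 <= t -> sigma_algebra [set: Omega] (F t),
      forall t, 0 <= t -> F t `<=` measurable
    & forall s t, 0 <= s -> s <= t -> F s `<=` F t].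

Definition noise_events (N : Omega ->
      {measure set (marked_spacetime R d) -> \bar R}) (I : set R) : set (set Omega) :=
  [set E | exists A (B : set (\bar R)),
     [/\ measurable A, A `<=` [set p | I p.1.1], measurable B &
         E = [set w | B (N w A)]]].

(* The noise up to time t is F t-measurable and the noise after time t is
   independent of F t, so F may be the (augmented) filtration generated by the
   noise, or any larger filtration with respect to which it is Poisson. *)
Definition noise_compatible (P : probability Omega R)
    (F : R -> set (set Omega))
    (N : Omega -> {measure set (marked_spacetime R d) -> \bar R}) : Prop :=
  forall t : R, 0 <= t ->
    noise_events N [set s | s <= t] `<=` F t /\
    (forall E E', F t E -> <<s noise_events N [set s | t < s] >> E' ->
       P (E `&` E') = (P E * P E')%E).

Definition predictable_rectangles (F : R -> set (set Omega)) :
    set (set (Omega * R * Rd R d)) :=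
  [set D | exists A (B : set (Rd R d)), [/\ measurable B,
     F 0 A & D = A `*` [set 0] `*` B]] `|`
  [set D | exists s t A (B : set (Rd R d)), [/\ 0 <= s, measurable B,
     F s A & D = A `*` `]s, t] `*` B]].

Definition predictable (F : R -> set (set Omega))
    (Y : Omega -> R -> Rd R d -> R) : Prop :=
  let D := [set p : Omega * R * Rd R d | 0 <= p.1.2] in
  forall B : set (measurableTypeR R), measurable B ->
    <<s D, predictable_rectangles F >>
      (D `&` [set p | B (Y p.1.1 p.1.2 p.2)]).

Section mild.
Context (m0 : R) (sigma : R -> R).
Context (tau : nat -> Omega -> R) (eta : nat -> Omega -> Rd R d).
Context (zeta : nat -> Omega -> R) (Y : Omega -> R -> Rd R d -> R).

Definition drift_integrand w (t : R) (x : Rd R d)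
    (p : measurableTypeR R * Rd R d) : R :=
  heat_kernel (t - p.1) (subRd x p.2) * sigma (Y w p.1 p.2).

Definition jump_term w (t : R) (x : Rd R d) (i : nat) : R :=
  heat_kernel (t - tau i w) (subRd x (eta i w)) *
  sigma (Y w (tau i w) (eta i w)) * zeta i w.

(* The first two clauses say that the right-hand side of the third one is
   well defined; at t = 0 it vanishes, which is the initial condition. *)
Definition mild_identity w (t : R) (x : Rd R d) : Prop :=
  [/\ lebesgue_spacetime.-integrable
        (`]0, t[ `*` setT) (EFin \o drift_integrand w t x),
      summable [set i | tau i w <= t] (EFin \o jump_term w t x)
    & Y w t x =
      m0 * (\int[lebesgue_spacetime]_(p in
              (`]0, t[ `*` setT)) drift_integrand w t x p) +
      \big[+%R/0]_(0 <= i <oo | tau i w <= t) jump_term w t x i].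

Definition mild_solution (P : probability Omega R) (F : R -> set (set Omega)) :
    Prop :=
  predictable F Y /\
  forall (t : R) (x : Rd R d), 0 <= t -> {ae P, forall w, mild_identity w t x}.

(* A mild solution is unique only up to modification, whereas path properties
   in continuous time depend on the version: at the points (t, x), t >= 0, the
   version is the one given by the right-hand side of the mild equation,
   outside a null set that does not depend on t. *)
Definition mild_version_at (P : probability Omega R) (x : Rd R d) : Prop :=
  {ae P, forall w, forall t : R, 0 <= t -> mild_identity w t x}.

End mild.
End StochasticHeatEquation.

(* Main.v *)
(* The sum of the jumps of Y at (t, 0) is compared with the positive linear
   functional jump_sum of the Poisson points, obtained by replacing sigma with a
   constant and the marks with their absolute values; the drift contributes O(t).
   In (1b), points older than two time units are grouped into unit time slabs
   and dyadic cubes, where the second moment formula gives bounds that are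
   summable after division by f (Kronecker's lemma); recent points contribute
   at most e f(n), unless some point is close enough to the origin to exceed
   this order by itself, which by Borel-Cantelli happens finitely often.
   In (1a), one looks at points (s, x, z) with |x|^d at most of order 1 / f(s).
   Their expected number is infinite, and observed at time s + |x|^2 each of them
   alone contributes more than any multiple of f. The jumps of the opposite sign
   cannot compensate all of them: by the second moment formula for pairs of
   distinct points, their expected contribution at those times is O(t).
   In (2), all jumps have the same sign and only the drift remains. *)
Require Import Defs.
From HB Require Import structures.
From mathcomp Require Import all_boot all_order all_algebra.
From mathcomp Require Import all_classical all_reals all_analysis measurable_realfun.
From mathcomp Require Import ring lra.
Import Order.TTheory GRing.Theory Num.Theory.
Import numFieldNormedType.Exports.
Local Open Scope classical_set_scope.
Local Open Scope ring_scope.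
Set Implicit Arguments.
Unset Strict Implicit.
Unset Printing Implicit Defensive.

(** * Moments of Poisson random measures *)

Section discrete_expectation.
Local Open Scope ereal_scope.
Context {R : realType} {disp : measure_display} {Omega : measurableType disp}.
Context (P : probability Omega R).

(** Since [sigma (Y ..)] depends on the noise, [Y] is not a linear functional of the points; the
    bounds [k1 < sigma < k2] reduce every claim to pathwise inequalities between [Y] and such
    functionals, for which two moments suffice. Two obstacles shape the estimates. Limits run over
    continuous t, so bounds must be uniform over unit time intervals: the heat kernel is dominated
    by V / (V^2 + v^2), with V = s^(d/2) for the age s and v = |x|^d in the maximum norm. Comparable
    ages give comparable values, which serves for old points, and recent points admit a bound free
    of V. Moreover, marks need not have a second moment. They are cut at 2^m in cubes of volume of
    order 4^m, where the moment of order 1 + eps pays for the large ones; near the origin, points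
    with v <= |z| / F are treated apart. The logarithmic condition comes from integrating 1 / v over
    |z| / F < v <= 1. In (1a) the observation times are random and depend on the points; summing
    over pairs of points treats such a time as if it were independent of the other points. *)

Lemma integral_partition (F : nat -> set Omega) (E : set Omega)
    (h : Omega -> \bar R) :
  measurable E -> (forall k, measurable (F k)) -> trivIset setT F ->
  P (\bigcup_k F k) = 1 -> measurable_fun setT h -> (forall w, 0 <= h w) ->
  \int[P]_(w in E) h w = \sum_(k <oo) \int[P]_(w in E `&` F k) h w.
Proof.
move=> mE mF tF PF mh h0.
have mU : measurable (\bigcup_k F k) by exact: bigcupT_measurable.
rewrite (@ge0_negligible_integral _ _ _ P E (~` \bigcup_k F k))//.
- rewrite setDE setCK setI_bigcupr ge0_integral_bigcup//.
  + by move=> k; exact: measurableI.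
  + exact: measurable_funTS.
  + move/trivIsetP : tF => tF; apply/trivIsetP => i j _ _ ij.
    by rewrite setIACA tF// setI0.
- exact: measurableC.
- exact: measurable_funTS.
- by have := probability_setC P mU; rewrite PF subee.
Qed.

Lemma integral_nat_valued (X : Omega -> \bar R) (g : \bar R -> \bar R)
    (E : set Omega) :
  measurable_fun setT X -> measurable_fun setT g -> (forall x, 0 <= g x) ->
  measurable E -> P (\bigcup_k [set w | X w = k%:R%:E]) = 1 ->
  \int[P]_(w in E) g (X w) =
  \sum_(k <oo) g k%:R%:E * P (E `&` [set w | X w = k%:R%:E]).
Proof.
move=> mX mg g0 mE PX.
have mXk k : measurable [set w | X w = k%:R%:E].
  rewrite [X in measurable X](_ : _ = X @^-1` [set k%:R%:E])//.
  by rewrite -[X in measurable X]setTI; exact: mX.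
rewrite (integral_partition (F := fun k => [set w | X w = k%:R%:E]))//.
- apply: eq_eseriesr => k _.
  rewrite (eq_integral (fun=> g k%:R%:E)); last first.
    by move=> w; rewrite inE => -[_ /= ->].
  by rewrite integral_cst//; exact: measurableI.
- apply/trivIsetP => i j _ _ ij; apply/seteqP; split => // w /= [-> []] /eqP.
  by rewrite eqr_nat (negbTE ij).
- exact: measurableT_comp.
Qed.

End discrete_expectation.

Section poisson_moments.
Local Open Scope ereal_scope.
Context {R : realType}.
Implicit Type r : R.

(** Size-biasing recursion: both moments below follow from it by shifting the index. For r = 0 the
    law is a Dirac mass at 0, which is a separate case of [poisson_prob]. *)
Lemma poisson_probS r k : (0 <= r)%R ->
  k.+1%:R%:E * poisson_prob r 0%N [set k.+1] = r%:E * poisson_prob r 0%N [set k].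
Proof.
rewrite le_eqVlt => /predU1P[<-|r0]; rewrite /poisson_prob.
  by rewrite ltxx/= diracE memNset//= mul0e mule0.
rewrite r0 !esum_set1 ?lee_fin ?poisson_pmf_ge0// -!EFinM; congr EFin.
rewrite /poisson_pmf r0 factS natrM exprS invfM.
have k0 : (k.+1%:R : R) != 0%R by rewrite pnatr_eq0.
by rewrite !mulrA; congr (_ * _ * _)%R; rewrite mulrC !mulrA mulVf// mul1r.
Qed.

Lemma poisson_prob_sum1 r : \sum_(k <oo) poisson_prob r 0%N [set k] = 1.
Proof.
rewrite -(@probability_setT _ _ _ (poisson_prob r 0%N)).
rewrite (_ : [set: nat] = \bigcup_k [set k]); last first.
  by apply/seteqP; split => // k _; exists k.
rewrite measure_bigcup//=.
  by apply: eq_eseriesl => k; rewrite in_setT.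
by apply/trivIsetP => i j _ _ ij; apply/seteqP; split => // k [/= -> /eqP]; rewrite (negbTE ij).
Qed.

Lemma poisson_mean r : (0 <= r)%R ->
  \sum_(k <oo) k%:R%:E * poisson_prob r 0%N [set k] = r%:E.
Proof.
move=> r0; rewrite nneseries_recl//=; last first.
  by move=> k _; rewrite mule_ge0// ?lee_fin// measure_ge0.
rewrite mul0e add0e.
rewrite -(@nneseries_addn _ (fun k => k%:R%:E * poisson_prob r 0%N [set k]) 1).
  under eq_eseriesr do rewrite addn1 poisson_probS//.
  by rewrite nneseriesZl// poisson_prob_sum1 mule1.
by move=> k; rewrite mule_ge0// ?lee_fin// measure_ge0.
Qed.

Lemma poisson_second_moment r : (0 <= r)%R ->
  \sum_(k <oo) (k%:R%:E * k%:R%:E) * poisson_prob r 0%N [set k]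
  = r%:E * r%:E + r%:E.
Proof.
move=> r0.
have pos k : 0 <= (k%:R%:E * k%:R%:E) * poisson_prob r 0%N [set k].
  by rewrite !mule_ge0// ?lee_fin// measure_ge0.
rewrite nneseries_recl//= !mul0e add0e.
rewrite -(@nneseries_addn _ (fun k => k%:R%:E * k%:R%:E * poisson_prob r 0%N [set k]) 1)//.
transitivity (\sum_(k <oo) r%:E * (k%:R%:E * poisson_prob r 0%N [set k] + poisson_prob r 0%N [set k])).
  apply: eq_eseriesr => k _; rewrite addn1 -muleA poisson_probS//.
  rewrite muleCA; congr *%E.
  by rewrite -natr1 EFinD ge0_muleDl ?lee_fin// mul1e.
rewrite nneseriesZl; last first.
  by move=> k _; rewrite adde_ge0 ?mule_ge0// ?lee_fin// measure_ge0.
rewrite nneseriesD; [|by move=> k _ _; rewrite ?mule_ge0// ?lee_fin// measure_ge0..].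
rewrite poisson_mean// poisson_prob_sum1 muleDr// ?mule1//.
Qed.

End poisson_moments.

Section counting_moments.
Local Open Scope ereal_scope.
Context {R : realType} {disp dispT : measure_display}.
Context {Omega : measurableType disp} {T : measurableType dispT}.
Context (P : probability Omega R) (p : nat -> {mfun Omega >-> T}).
Context (nu : {sigma_finite_measure set T -> \bar R}).
Hypothesis hN :
  poisson_random_measure P nu (fun w => counting_measure_of_points (p^~ w)).

Let N w := @counting_measure_of_points R _ T (p^~ w).

Lemma counting_measureE w A : N w A = \sum_(i <oo) (\1_A (p i w))%:E.
Proof. by []. Qed.

Lemma measurable_count A : measurable A -> measurable_fun setT (N^~ A).
Proof. by case: hN => mN _ _; exact: mN. Qed.

(** A Poisson random measure is specified by the probabilities of the finite values; since these add
    up to 1, the value +oo is excluded almost surely. *)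
Lemma count_nat_valued A : measurable A -> nu A < +oo ->
  P (\bigcup_k [set w | N w A = k%:R%:E]) = 1.
Proof.
move=> mA nA; have [_ hP _] := hN.
rewrite measure_bigcup//=.
- rewrite -[RHS](@poisson_prob_sum1 _ (fine (nu A))).
  rewrite (eq_eseriesl (Q := xpredT)); last by move=> k; rewrite in_setT.
  by apply: eq_eseriesr => k _; exact: hP.
- move=> k _; rewrite [X in measurable X](_ : _ = (N^~ A) @^-1` [set k%:R%:E])//.
  by rewrite -[X in measurable X]setTI; exact: measurable_count.
- apply/trivIsetP => i j _ _ ij; apply/seteqP; split => // w /= [-> []] /eqP.
  by rewrite eqr_nat (negbTE ij).
Qed.

Lemma expectation_count A : measurable A -> nu A < +oo ->
  \int[P]_w N w A = nu A.
Proof.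
move=> mA nA; have [_ hP _] := hN; have nA0 := measure_ge0 nu A.
(* [integral_nat_valued] asks for a function that is nonnegative on the whole extended line, hence
   the positive part. *)
transitivity (\int[P]_w maxe 0 (N w A)).
  by apply: eq_integral => w _; rewrite max_r.
rewrite (@integral_nat_valued _ _ _ P (N^~ A) (maxe 0))//.
- rewrite -[RHS](@fineK _ (nu A)) ?ge0_fin_numE//.
  rewrite -[RHS]poisson_mean ?fine_ge0//.
  by apply: eq_eseriesr => k _; rewrite setTI hP// max_r// lee_fin.
- exact: measurable_count.
- exact: measurable_maxe.
- by move=> x; rewrite le_max lexx.
- exact: count_nat_valued.
Qed.

Lemma second_moment_count A : measurable A -> nu A < +oo ->
  \int[P]_w (N w A * N w A) = nu A * nu A + nu A.
Proof.
move=> mA nA; have [_ hP _] := hN; have nA0 := measure_ge0 nu A.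
transitivity (\int[P]_w (maxe 0 (N w A) * maxe 0 (N w A))).
  by apply: eq_integral => w _; rewrite max_r.
rewrite (@integral_nat_valued _ _ _ P (N^~ A) (fun x => maxe 0 x * maxe 0 x))//.
- rewrite -[in RHS](@fineK _ (nu A)) ?ge0_fin_numE//.
  rewrite -[RHS]poisson_second_moment ?fine_ge0//.
  by apply: eq_eseriesr => k _; rewrite setTI hP// max_r// lee_fin.
- exact: measurable_count.
- by apply: emeasurable_funM; exact: measurable_maxe.
- by move=> x; rewrite mule_ge0// le_max lexx.
- exact: count_nat_valued.
Qed.

Lemma product_moment_count A B : measurable A -> measurable B ->
  nu A < +oo -> nu B < +oo -> A `&` B = set0 ->
  \int[P]_w (N w A * N w B) = nu A * nu B.
Proof.
move=> mA mB nA nB AB; have [_ hP hI] := hN.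
have mNk C k : measurable C -> measurable [set w | N w C = k%:R%:E].
  move=> mC; rewrite [X in measurable X](_ : _ = (N^~ C) @^-1` [set k%:R%:E])//.
  by rewrite -[X in measurable X]setTI; exact: measurable_count.
have PAB k l : P ([set w | N w A = k%:R%:E] `&` [set w | N w B = l%:R%:E]) =
    P [set w | N w A = k%:R%:E] * P [set w | N w B = l%:R%:E].
  pose A' (i : 'I_2) := if (i : nat) == 0%N then A else B.
  pose B' (i : 'I_2) := if (i : nat) == 0%N then [set k%:R%:E] else [set l%:R%:E : \bar R].
  have := hI 2%N A' B'; rewrite big_ord_recr/= big_ord1 /A' /B' /=.
  rewrite (_ : [set w | forall i : 'I_2, _] =
    [set w | N w A = k%:R%:E] `&` [set w | N w B = l%:R%:E]).
    apply.
    + by move=> i; case: ifP.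
    + apply/trivIsetP => i j _ _; rewrite -val_eqE /=.
      case: ifPn => i0; case: ifPn => j0 ij; [|exact: AB|by rewrite setIC|].
        by rewrite (eqP i0) (eqP j0) eqxx in ij.
      by move: i j i0 j0 ij => [[|[|?]] ?] [[|[|?]] ?].
    + by move=> i; case: ifP.
  apply/seteqP; split => [w /= h|w /= [h1 h2] i].
    by split; [exact: (h ord0)|exact: (h (lift ord0 ord0))].
  by case: ifP.
rewrite (integral_partition (F := fun k => [set w | N w A = k%:R%:E]))//.
- transitivity (\sum_(k <oo) nu B * (k%:R%:E * P [set w | N w A = k%:R%:E])).
    apply: eq_eseriesr => k _; rewrite setTI.
    rewrite (eq_integral (fun w => k%:R%:E * maxe 0 (N w B))); last first.
      by move=> w; rewrite inE /= => ->; rewrite max_r.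
    rewrite ge0_integralZl_EFin//; last 3 first.
      exact: mNk.
      by move=> *; rewrite le_max lexx.
      apply: measurable_funTS; apply: measurable_maxe => //.
      exact: measurable_count.
    rewrite (@integral_nat_valued _ _ _ P (N^~ B) (maxe 0))//; last 5 first.
      exact: measurable_count.
      exact: measurable_maxe.
      by move=> x; rewrite le_max lexx.
      exact: mNk.
      exact: count_nat_valued.
    rewrite muleCA; congr (_ * _).
    transitivity (\sum_(l <oo) P [set w | N w A = k%:R%:E] *
        (l%:R%:E * poisson_prob (fine (nu B)) 0%N [set l])).
      apply: eq_eseriesr => l _; rewrite max_r ?lee_fin// PAB muleCA.
      by rewrite (hP B).
    have <- : (fine (P [set w | N w A = k%:R%:E]))%:E =
        P [set w | N w A = k%:R%:E].
      by rewrite fineK// fin_num_measure//; exact: mNk.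
    rewrite nneseriesZl; last first.
      by move=> i _; rewrite mule_ge0 ?measure_ge0 ?lee_fin.
    by rewrite poisson_mean ?fine_ge0// (@fineK _ (nu B)) ?ge0_fin_numE// muleC.
  rewrite -[in LHS](@fineK _ (nu B)) ?ge0_fin_numE//.
  rewrite nneseriesZl; last first.
    by move=> i _; rewrite mule_ge0 ?lee_fin// measure_ge0.
  under eq_eseriesr do rewrite hP//.
  by rewrite poisson_mean ?fine_ge0// !fineK ?ge0_fin_numE// muleC.
- by move=> k; exact: mNk.
- apply/trivIsetP => i j _ _ ij; apply/seteqP; split => // w /= [-> []] /eqP.
  by rewrite eqr_nat (negbTE ij).
- exact: count_nat_valued.
- by apply: emeasurable_funM; exact: measurable_count.
Qed.

(** Splitting off the common part leaves products of counts of disjoint sets, which are independent.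
    The extra term is the variance of the common part; it becomes the diagonal measure in
    [second_moment_measure]. *)
Lemma product_moment_count_gen A B : measurable A -> measurable B ->
  nu A < +oo -> nu B < +oo ->
  \int[P]_w (N w A * N w B) = nu A * nu B + nu (A `&` B).
Proof.
move=> mA mB nA nB.
have mAB : measurable (A `&` B) by exact: measurableI.
have mAB' : measurable (A `\` B) by exact: measurableD.
have mBA' : measurable (B `\` A) by exact: measurableD.
have sub C D : measurable C -> measurable D -> C `<=` D -> nu D < +oo -> nu C < +oo.
  by move=> mC mD CD; apply: le_lt_trans; apply: le_measure; rewrite ?inE.
have nAB : nu (A `&` B) < +oo by apply: (sub _ A) => // x [].
have nA' : nu (A `\` B) < +oo by apply: (sub _ A) => // x [].
have nB' : nu (B `\` A) < +oo by apply: (sub _ B) => // x [].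
have UA : A = (A `&` B) `|` (A `\` B) by rewrite setUIDK.
have UB : B = (A `&` B) `|` (B `\` A) by rewrite setIC setUIDK.
have dA : (A `&` B) `&` (A `\` B) = set0.
  by apply/seteqP; split => x // -[[_ Bx] [_ /(_ Bx)]].
have dB : (A `&` B) `&` (B `\` A) = set0.
  by apply/seteqP; split => x // -[[Ax _] [_ /(_ Ax)]].
have NA w : N w A = N w (A `&` B) + N w (A `\` B) by rewrite -measureU -?UA//.
have NB w : N w B = N w (A `&` B) + N w (B `\` A) by rewrite -measureU -?UB//.
have nuA : nu A = nu (A `&` B) + nu (A `\` B) by rewrite -measureU -?UA//.
have nuB : nu B = nu (A `&` B) + nu (B `\` A) by rewrite -measureU -?UB//.
rewrite (eq_integral (fun w => N w (A `&` B) * N w (A `&` B)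
   + N w (A `&` B) * N w (B `\` A) + N w (A `\` B) * N w B)); last first.
  move=> w _; rewrite NA ge0_muleDl// -/N; congr (_ + _).
  by rewrite [in LHS]NB ge0_muleDr.
have mNN C D : measurable C -> measurable D -> measurable_fun setT (fun w => N w C * N w D).
  by move=> mC mD; apply: emeasurable_funM; exact: measurable_count.
have NN0 C D w : 0 <= N w C * N w D by rewrite mule_ge0.
rewrite ge0_integralD//; last 3 first.
  by move=> w _; rewrite adde_ge0.
  by apply: emeasurable_funD; exact: mNN.
  exact: mNN.
rewrite ge0_integralD//; [|exact: mNN..].
have dAB : (A `\` B) `&` B = set0 by apply/seteqP; split => x // -[[_ nBx] /nBx].
rewrite second_moment_count// (product_moment_count mAB mBA')//.
rewrite (product_moment_count mAB' mB)//.
have -> : nu (A `&` B) * nu (A `&` B) + nu (A `&` B) +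
    nu (A `&` B) * nu (B `\` A) = nu (A `&` B) * nu B + nu (A `&` B).
  by rewrite nuB ge0_muleDr// addeAC.
by rewrite nuA ge0_muleDl// addeAC.
Qed.

End counting_moments.

(** * Campbell's formula and the second moment formula *)

Section campbell.
Local Open Scope ereal_scope.
Context {R : realType}.

Lemma nneseries_mulr (a : nat -> \bar R) (y : \bar R) :
  (forall i, 0 <= a i) -> 0 <= y ->
  (\sum_(i <oo) a i) * y = \sum_(i <oo) (a i * y).
Proof.
move=> a0; case: y => [r r0|_|//].
  by rewrite muleC -nneseriesZl//; apply: eq_eseriesr => i _; rewrite muleC.
have [ae0|/existsNP[i /eqP ai]] := pselect (forall i, a i = 0).
  by rewrite !eseries0// ?mul0e// => i _ _; rewrite ae0// mul0e.
have ai0 : 0 < a i by rewrite lt_neqAle eq_sym ai a0.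
rewrite gt0_muley; last first.
  apply: (lt_le_trans ai0); rewrite (nneseriesD1 (n := i))//.
  by rewrite leeDl// nneseries_ge0.
apply/esym; apply: (@nneseries_pinfty _ _ _ i) => //.
  by move=> n _; rewrite mule_ge0// leey.
by rewrite gt0_muley.
Qed.

(** Moments of counts are available for sets of finite intensity only; this carries the resulting
    identities to all measurable sets. *)
Lemma measure_eq_exhaustion {dispT} {T : measurableType dispT}
    (m1 m2 : {measure set T -> \bar R}) (F : nat -> set T) (A : set T) :
  (forall n, measurable (F n)) -> {homo F : n m / (n <= m)%N >-> (n <= m)%O} ->
  \bigcup_n F n = setT -> measurable A ->
  (forall n, m1 (A `&` F n) = m2 (A `&` F n)) -> m1 A = m2 A.
Proof.
move=> mF ndF UF mA h.
have mAF n : measurable (A `&` F n) by exact: measurableI.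
have AE : A = \bigcup_n (A `&` F n) by rewrite -setI_bigcupr UF setIT.
have ndAF : {homo (fun n => A `&` F n) : n m / (n <= m)%N >-> (n <= m)%O}.
  by move=> n m nm; apply/subsetPset; apply: setIS; exact/subsetPset/ndF.
have cv (m : {measure set T -> \bar R}) : m (A `&` F n) @[n --> \oo] --> m A.
  rewrite [in X in _ --> X]AE; apply: nondecreasing_cvg_mu => //.
  exact: bigcupT_measurable.
transitivity (limn (fun n => m1 (A `&` F n))).
  by apply/esym/cvg_lim => //; exact: cv.
rewrite (_ : (fun n => _) = (fun n => m2 (A `&` F n))); last exact/funext.
by apply/cvg_lim => //; exact: cv.
Qed.

Context {disp dispT : measure_display}.
Context {Omega : measurableType disp} {T : measurableType dispT}.
Context (P : probability Omega R) (p : nat -> {mfun Omega >-> T}).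
Context (nu : {sigma_finite_measure set T -> \bar R}).
Hypothesis hN :
  poisson_random_measure P nu (fun w => counting_measure_of_points (p^~ w)).

Let N w := @counting_measure_of_points R _ T (p^~ w).

Let mean_measure : {measure set T -> \bar R} :=
  mseries (fun i => distribution P (p i)) 0.

Let mean_measureE A : measurable A -> mean_measure A = \int[P]_w N w A.
Proof.
move=> mA; rewrite (eq_integral (fun w => \sum_(i <oo) (\1_A (p i w))%:E));
  last by move=> w _; rewrite counting_measureE.
rewrite integral_nneseries//; last first.
  by move=> i; apply/measurable_EFinP; apply: measurableT_comp.
apply: eq_eseriesr => i _.
transitivity (\int[distribution P (p i)]_y (\1_A y)%:E).
  by rewrite integral_indic// setIT.
by rewrite ge0_integral_distribution//; exact/measurable_EFinP.
Qed.

Lemma mean_measure_intensity A : measurable A -> mean_measure A = nu A.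
Proof.
move=> mA; have /sigma_finiteP[F [TF ndF Foo]] := sigma_finiteT nu.
apply: (@measure_eq_exhaustion _ _ _ _ F) => // n; first by have [] := Foo n.
have [mF nF] := Foo n.
rewrite mean_measureE; last exact: measurableI.
apply: expectation_count => //; first exact: measurableI.
by apply: le_lt_trans nF; apply: le_measure; rewrite ?inE//; exact: measurableI.
Qed.

(** The left side is an integral against the sum of the laws of the points, a measure that agrees
    with [nu] on measurable sets. *)
Lemma campbell (Phi : T -> \bar R) : measurable_fun setT Phi ->
  (forall x, 0 <= Phi x) ->
  \int[P]_w (\sum_(i <oo) Phi (p i w)) = \int[nu]_x Phi x.
Proof.
move=> mPhi Phi0; rewrite integral_nneseries//; last first.
  by move=> i; exact: measurableT_comp.
rewrite (eq_measure_integral mean_measure); last first.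
  by move=> A mA _; rewrite mean_measure_intensity.
rewrite ge0_integral_measure_series//; apply: eq_eseriesr => i _.
by rewrite ge0_integral_distribution.
Qed.

(** Named so that it can carry a structure of measurable function, whose law is then a
    [distribution]. *)
Definition pair_at (i j : nat) (w : Omega) : T * T := (p i w, p j w).

Let measurable_pair_at i j : measurable_fun setT (pair_at i j).
Proof. exact: measurable_fun_pair. Qed.

HB.instance Definition _ i j :=
  isMeasurableFun.Build _ _ _ _ (pair_at i j) (measurable_pair_at i j).

Let pair_measure : {measure set (T * T) -> \bar R} :=
  mseries (fun i => mseries (fun j => distribution P (pair_at i j)) 0) 0.

Let diag (x : T) : T * T := (x, x).

Let measurable_diag : measurable_fun setT diag.
Proof. exact: measurable_fun_pair. Qed.

Let diag_measure : {measure set (T * T) -> \bar R} :=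
  measure_function_pushforward__canonical__measure_function_Measure nu measurable_diag.

Let sum_measure : {measure set (T * T) -> \bar R} :=
  measure_add (nu \x nu) diag_measure.

Let measurable_pair_count C : measurable C ->
  forall i j, measurable_fun setT (fun w => (\1_C (p i w, p j w) : R)%:E).
Proof.
move=> mC i j; apply/measurable_EFinP.
by apply: (@measurableT_comp _ _ _ _ _ _ _ _ (pair_at i j)).
Qed.

Let pair_measureE C : measurable C ->
  pair_measure C = \int[P]_w \sum_(i <oo) \sum_(j <oo) (\1_C (p i w, p j w))%:E.
Proof.
move=> mC; rewrite integral_nneseries//; last 2 first.
  move=> i; apply: ge0_emeasurable_sum => // j _.
  exact: measurable_pair_count.
  by move=> i w _; exact: nneseries_ge0.
apply: eq_eseriesr => i _; rewrite integral_nneseries//; last first.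
  by move=> j; exact: measurable_pair_count.
apply: eq_eseriesr => j _.
transitivity (\int[distribution P (pair_at i j)]_y (\1_C y)%:E).
  by rewrite integral_indic// setIT.
by rewrite ge0_integral_distribution//; exact/measurable_EFinP.
Qed.

Let pair_measure_rect A B : measurable A -> measurable B ->
  pair_measure (A `*` B) = \int[P]_w (N w A * N w B).
Proof.
move=> mA mB; rewrite pair_measureE; last exact: measurableX.
apply: eq_integral => w _; rewrite !counting_measureE.
rewrite nneseries_mulr//; last exact: nneseries_ge0.
apply: eq_eseriesr => i _; rewrite -nneseriesZl//.
by apply: eq_eseriesr => j _; rewrite -EFinM !indicE in_setX -natrM mulnb.
Qed.

Let sum_measure_rect A B : measurable A -> measurable B ->
  sum_measure (A `*` B) = nu A * nu B + nu (A `&` B).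
Proof.
move=> mA mB.
transitivity ((nu \x nu) (A `*` B) + diag_measure (A `*` B)).
  exact: (measure_addE (nu \x nu)).
by rewrite product_measure1E//; congr (_ + _).
Qed.

Let pair_sum_measure_rect A B : measurable A -> measurable B ->
  pair_measure (A `*` B) = sum_measure (A `*` B).
Proof.
move=> mA mB; have /sigma_finiteP[F [TF ndF Foo]] := sigma_finiteT nu.
apply: (@measure_eq_exhaustion _ _ _ _ (fun n => F n `*` F n)).
- by move=> n; have [mF _] := Foo n; exact: measurableX.
- by move=> n m nm; apply/subsetPset => -[x y] [/= Fx Fy];
    split; [move: x Fx|move: y Fy]; exact/subsetPset/ndF.
- rewrite -setXTT TF predeqE => -[x y]; split.
    by move=> [n _ []/= ? ?]; split; exists n.
  move=> [/= [n _ Fnx] [k _ Gky]]; exists (maxn n k) => //; split.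
  + by move: x Fnx; exact/subsetPset/ndF/leq_maxl.
  + by move: y Gky; exact/subsetPset/ndF/leq_maxr.
- exact: measurableX.
move=> n; have [mF nF] := Foo n; rewrite -setXI.
have mI C : measurable C -> measurable (C `&` F n) by move=> mC; exact: measurableI.
have nI C : measurable C -> nu (C `&` F n) < +oo.
  by move=> mC; apply: le_lt_trans nF; apply: le_measure; rewrite ?inE//; exact: mI.
rewrite (pair_measure_rect (mI _ mA) (mI _ mB)).
rewrite (sum_measure_rect (mI _ mA) (mI _ mB)).
exact: (product_moment_count_gen hN (mI _ mA) (mI _ mB) (nI _ mA) (nI _ mB)).
Qed.

Let pair_sum_measure C : measurable C -> pair_measure C = sum_measure C.
Proof.
move=> mC; have /sigma_finiteP[F [TF ndF Foo]] := sigma_finiteT nu.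
pose G : set (set (T * T)) :=
  [set A `*` B | A in measurable & B in measurable].
apply: (measure_unique G (fun n => F n `*` F n)) => //.
- by rewrite measurable_prod_measurableType.
- move=> /= _ _ [A1 mA1 [B1 mB1 <-]] [A2 mA2 [B2 mB2 <-]]; rewrite -setXI.
  by exists (A1 `&` A2); [exact: measurableI|exists (B1 `&` B2) => //; exact: measurableI].
- by move=> n; have [mF _] := Foo n; exists (F n) => //; exists (F n).
- rewrite -setXTT TF predeqE => -[x y]; split.
    by move=> [n _ []/= ? ?]; split; exists n.
  move=> [/= [n _ Fnx] [k _ Gky]]; exists (maxn n k) => //; split.
  + by move: x Fnx; exact/subsetPset/ndF/leq_maxl.
  + by move: y Gky; exact/subsetPset/ndF/leq_maxr.
- by move=> _ [A mA [B mB <-]]; exact: pair_sum_measure_rect.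
- move=> n; have [mF nF] := Foo n.
  rewrite pair_sum_measure_rect// sum_measure_rect// setIid.
  by rewrite lte_add_pinfty// lte_mul_pinfty// ge0_fin_numE.
Qed.

(** The sum of the laws of all pairs of points and [nu \x nu] plus the image of [nu] on the diagonal
    agree on rectangles by [product_moment_count_gen], hence everywhere. The diagonal part comes
    from the pairs with i = j. *)
Lemma second_moment_measure (H : T * T -> \bar R) : measurable_fun setT H ->
  (forall x, 0 <= H x) ->
  \int[P]_w (\sum_(i <oo) \sum_(j <oo) H (p i w, p j w)) =
  \int[nu]_x \int[nu]_y H (x, y) + \int[nu]_x H (x, x).
Proof.
move=> mH H0.
have mHp i j : measurable_fun setT (fun w => H (p i w, p j w)).
  by apply: (@measurableT_comp _ _ _ _ _ _ _ _ (pair_at i j)).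
transitivity (\int[pair_measure]_z H z).
  rewrite integral_nneseries//; last 2 first.
    by move=> i; apply: ge0_emeasurable_sum => // j _; exact: mHp.
    by move=> i w _; exact: nneseries_ge0.
  rewrite ge0_integral_measure_series//; apply: eq_eseriesr => i _.
  rewrite integral_nneseries// ge0_integral_measure_series//.
  by apply: eq_eseriesr => j _; rewrite ge0_integral_distribution.
rewrite (eq_measure_integral sum_measure); last first.
  by move=> C mC _; exact: pair_sum_measure.
rewrite ge0_integral_measure_add//; congr (_ + _).
  by rewrite fubini_tonelli1.
by rewrite ge0_integral_pushforward.
Qed.

End campbell.

Section deviation.
Local Open Scope ereal_scope.
Context {R : realType} {disp dispT : measure_display}.
Context {Omega : measurableType disp} {T : measurableType dispT}.
Context (P : probability Omega R) (p : nat -> {mfun Omega >-> T}).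
Context (nu : {sigma_finite_measure set T -> \bar R}).
Hypothesis hN :
  poisson_random_measure P nu (fun w => counting_measure_of_points (p^~ w)).

Lemma measurable_point_sum (Phi : T -> \bar R) : measurable_fun setT Phi ->
  (forall x, 0 <= Phi x) ->
  measurable_fun setT (fun w => \sum_(i <oo) Phi (p i w)).
Proof.
move=> mPhi Phi0; apply: ge0_emeasurable_sum => // i _.
exact: measurableT_comp.
Qed.

(** The expansion of (S - e)^2, arranged without subtracting infinite quantities, since [S] may be
    +oo. *)
Lemma square_deviationE (S : \bar R) (e : R) : 0 <= S -> (0 <= e)%R ->
  S * S + (e * e)%:E = (2 * e)%:E * S + (S - e%:E) * (S - e%:E).
Proof.
case: S => [s _ _|_|//]; first by rewrite -!EFinM -!EFinD; congr EFin; ring.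
rewrite le_eqVlt => /predU1P[<-|e0].
  by rewrite mulr0 mulr0 mul0e add0e adde0 sube0.
by rewrite /= mulyy gt0_muley// lte_fin mulr_gt0.
Qed.

Lemma integral_probability_cst (r : R) : \int[P]_w r%:E = r%:E.
Proof.
rewrite integral_cst// -[RHS]mule1; congr (_ * _); exact: probability_setT.
Qed.

(** Integrate [square_deviationE] and compute the mean of S^2 with the pair function Phi x * Phi y.
    Both sides may be infinite: only the finite number e * e + e * e is cancelled. *)
Lemma campbell_variance (Phi : T -> \bar R) (e : R) : measurable_fun setT Phi ->
  (forall x, 0 <= Phi x) -> \int[nu]_x Phi x = e%:E ->
  \int[P]_w ((\sum_(i <oo) Phi (p i w) - e%:E) * (\sum_(i <oo) Phi (p i w) - e%:E))
  = \int[nu]_x (Phi x * Phi x).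
Proof.
move=> mPhi Phi0 ePhi.
have e0 : (0 <= e)%R by rewrite -lee_fin -ePhi integral_ge0.
pose S w := \sum_(i <oo) Phi (p i w).
have S0 w : 0 <= S w by exact: nneseries_ge0.
have mS : measurable_fun setT S by exact: measurable_point_sum.
have ES : \int[P]_w S w = e%:E by rewrite (campbell hN).
have ESS : \int[P]_w (S w * S w) = (e * e)%:E + \int[nu]_x (Phi x * Phi x).
  have mH : measurable_fun setT (fun z : T * T => Phi z.1 * Phi z.2).
    by apply: emeasurable_funM; exact: measurableT_comp.
  have := second_moment_measure hN mH (fun z => mule_ge0 (Phi0 z.1) (Phi0 z.2)).
  rewrite /= (_ : \int[nu]_x \int[nu]_y _ = (e * e)%:E); last first.
    under eq_integral do rewrite ge0_integralZl// ePhi.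
    by rewrite ge0_integralZr// ePhi EFinM.
  move=> <-; apply: eq_integral => w _; rewrite nneseries_mulr//.
  apply: eq_eseriesr => i _; rewrite muleC nneseries_mulr//.
  by apply: eq_eseriesr => j _; rewrite muleC.
have : \int[P]_w (S w * S w + (e * e)%:E) =
    \int[P]_w ((2 * e)%:E * S w + (S w - e%:E) * (S w - e%:E)).
  by apply: eq_integral => w _; rewrite square_deviationE.
have sq0 (x : \bar R) : 0 <= x * x.
  by case: x => [x||]; rewrite ?mulyy ?mulNyNy ?leey// -EFinM lee_fin -expr2 sqr_ge0.
have mD : measurable_fun setT (fun w => (S w - e%:E) * (S w - e%:E)).
  by apply: emeasurable_funM; apply: emeasurable_funB.
rewrite ge0_integralD//; last 2 first.
  exact: emeasurable_funM.
  by move=> w _; rewrite lee_fin mulr_ge0.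
rewrite ge0_integralD//; last 2 first.
  by move=> w _; rewrite mule_ge0// lee_fin mulr_ge0.
  exact: measurable_funeM.
rewrite ESS integral_probability_cst ge0_integralZl_EFin//; last first.
  by rewrite mulr_ge0.
rewrite ES -EFinM addeAC -EFinD.
rewrite (_ : (2 * e * e)%R = (e * e + e * e)%R); last by ring.
rewrite addeC (addeC (_%:E) (\int[P]_w _)) => /(congr1 (fun x => x - (e * e + e * e)%:E)).
by rewrite !addeK.
Qed.

End deviation.

(** * The heat kernel in terms of the cube volume *)

Section box_geometry.
Context {R : realType} {d : nat}.
Implicit Types (x : Rd R d) (r s a : R).

Definition supnormRd x : R := \big[Num.max/0]_(i < d) `|tnth x i : R|.

Lemma supnormRd_ge0 x : 0 <= supnormRd x.
Proof. by rewrite /supnormRd; elim/big_ind : _ => // a b a0 b0; rewrite le_max a0. Qed.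

Lemma supnormRd_leP x r : 0 <= r ->
  supnormRd x <= r <-> forall i, `|tnth x i : R| <= r.
Proof.
move=> r0; split => [/bigmax_leP[_ h] i|h]; first exact: h.
by apply/bigmax_leP; split.
Qed.

Lemma supnormRd_le_sqnorm x : supnormRd x ^+ 2 <= sqnormRd x.
Proof.
have q0 : 0 <= sqnormRd x by apply: sumr_ge0 => i _; exact: sqr_ge0.
rewrite -[leRHS]sqr_sqrtr// ler_sqr ?nnegrE ?supnormRd_ge0 ?sqrtr_ge0//.
apply/supnormRd_leP; first exact: sqrtr_ge0.
move=> i; rewrite -sqrtr_sqr ler_wsqrtr// /sqnormRd (bigD1 i)//= lerDl.
by apply: sumr_ge0 => j _; exact: sqr_ge0.
Qed.

Lemma sqnormRd_le_supnorm x : sqnormRd x <= d%:R * supnormRd x ^+ 2.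
Proof.
rewrite mulr_natl -[X in _ *+ X]card_ord -sumr_const; apply: ler_sum => i _.
rewrite -real_normK ?num_real// ler_sqr ?nnegrE ?supnormRd_ge0//.
by apply: (supnormRd_leP x (supnormRd_ge0 x)).1.
Qed.

(* {volRd <= v} is a cube of volume 2 ^ d * v, so estimates in R^d become
   one-dimensional in volRd. *)
Definition volRd x : R := supnormRd x ^+ d.

Lemma volRd_ge0 x : 0 <= volRd x.
Proof. exact/exprn_ge0/supnormRd_ge0. Qed.

Lemma supnormRd_opp x : supnormRd (subRd Rd0 x) = supnormRd x.
Proof. by apply: eq_bigr => i _; rewrite !tnth_mktuple sub0r normrN. Qed.

Lemma volRd_opp x : volRd (subRd Rd0 x) = volRd x.
Proof. by rewrite /volRd supnormRd_opp. Qed.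

End box_geometry.

Section box_volume.
Context {R : realType}.
Local Open Scope ereal_scope.

Lemma measurable_supnormRd d : measurable_fun setT (@supnormRd R d).
Proof.
suff h (s : seq 'I_d) : measurable_fun setT
    (fun x : Rd R d => \big[Num.max/0%R]_(i <- s) `|tnth x i : R|%R).
  by have := h (index_enum 'I_d).
elim: s => [|i s ih].
  by under eq_fun do rewrite big_nil; exact: measurable_cst.
under eq_fun do rewrite big_cons.
apply: measurable_maxr => //; apply: measurableT_comp => //.
exact: (measurable_tnth i).
Qed.

Lemma measurable_volRd d : measurable_fun setT (@volRd R d).
Proof. by apply: measurable_funX; exact: measurable_supnormRd. Qed.

Lemma lebesgue_measureRd_cube d (r : R) : (0 <= r)%R ->
  lebesgue_measureRd R d [set x | forall i, (`|tnth x i : R| <= r)%R]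
  = ((2 * r) ^+ d)%:E.
Proof.
move=> r0; elim: d => [|d ih] /=.
  by rewrite diracE mem_set//= => -[].
rewrite /lebesgue_stepRd /pushforward /sigma_finite_prod.
rewrite (_ : _ @^-1` _ = `[(- r)%R, r]%classic `*`
    [set x : Rd R d | forall i, (`|tnth x i : R| <= r)%R]); last first.
  apply/seteqP; split => -[a x] /=.
    move=> h; split => /=.
      by rewrite in_itv/= -ler_norml; exact: (h ord0).
    by move=> i; have := h (lift ord0 i); rewrite tnthS.
  rewrite in_itv/= -ler_norml => -[ar h] i.
  by case: (unliftP ord0 i) => [j ->|->] /=; rewrite ?tnthS// tnth0.
have mB : measurable [set x : Rd R d | forall i, (`|tnth x i : R| <= r)%R].
  rewrite (_ : mkset _ = supnormRd @^-1` `]-oo, r]%classic).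
    by rewrite -[X in measurable X]setTI; exact: measurable_supnormRd.
  apply/seteqP; split => x /=; rewrite in_itv/=; by move/(supnormRd_leP _ r0).
rewrite product_measure1E//= ih lebesgue_measure_itv/= lte_fin.
have [r0'|] := ltP (- r)%R r.
  by rewrite -EFinB -EFinM exprS; congr ((_ * _)%:E); ring.
move=> rr; have -> : r = 0%R by lra.
by rewrite mulr0 expr0n/= mul0e exprS mul0r.
Qed.

Lemma lebesgue_measureRd_volRd d (a : R) : (0 < d)%N -> (0 <= a)%R ->
  lebesgue_measureRd R d [set x | (volRd x <= a)%R] = (2 ^+ d * a)%:E.
Proof.
move=> d0 a0; pose r := (a `^ d%:R^-1)%R.
have rd : (r ^+ d = a)%R.
  by rewrite -powR_mulrn ?powR_ge0// -powRrM mulVf ?powRr1// pnatr_eq0 -lt0n.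
have r0 : (0 <= r)%R by exact: powR_ge0.
rewrite (_ : mkset _ = [set x | forall i, (`|tnth x i : R| <= r)%R]).
  by rewrite lebesgue_measureRd_cube// exprMn rd.
apply/seteqP; split => x /=; rewrite /volRd -rd
  ler_pXn2r ?nnegrE ?supnormRd_ge0//; by move/(supnormRd_leP _ r0).
Qed.

End box_volume.

Section volume_kernel.
Context {R : realType}.
Implicit Types (V v : R).

(** The Cauchy kernel in v with scale V, up to normalization. It replaces Gaussian decay by the
    bounds 1 / v and V / v^2, which suffice here and are easy to compare across scales. *)
Definition volume_kernel V v : R := V / (V ^+ 2 + v ^+ 2).

Lemma volume_kernel_ge0 V v : 0 <= V -> 0 <= volume_kernel V v.
Proof. by move=> V0; rewrite divr_ge0// addr_ge0// sqr_ge0. Qed.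

Lemma volume_kernel_le_inv V v : 0 < V -> 0 < v -> volume_kernel V v <= v^-1.
Proof.
move=> V0 v0; rewrite /volume_kernel ler_pdivrMr ?addr_gt0 ?exprn_gt0//.
rewrite mulrC ler_pdivlMr//; nra.
Qed.

Lemma volume_kernel_le_square V v : 0 < V -> 0 < v ->
  volume_kernel V v <= V / v ^+ 2.
Proof.
move=> V0 v0; rewrite /volume_kernel ler_pM2l// lef_pV2 ?posrE ?addr_gt0 ?exprn_gt0//.
by rewrite lerDr sqr_ge0.
Qed.

(** A single term suffices. For the least k with v <= 2^k V, either k = 0 and the kernel is at most
    1 / V, or v > 2^(k-1) V and it is at most V / v^2 <= 4 / (V 4^k). Sums of the kernel over points
    thus reduce to sums over cubes. *)
Lemma volume_kernel_dyadic V v : 0 < V -> 0 <= v ->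
  ((volume_kernel V v)%:E <=
   \sum_(k <oo) (4 / V * 4^-1 ^+ k * (v <= 2 ^+ k * V)%R%:R)%:E)%E.
Proof.
move=> V0 v0.
have t0 k : (0 <= (4 / V * 4^-1 ^+ k * (v <= 2 ^+ k * V)%R%:R)%:E)%E.
  by rewrite lee_fin mulr_ge0// mulr_ge0 ?divr_ge0 ?exprn_ge0// ltW.
have ex : exists k, v <= 2 ^+ k * V.
  exists (Num.Def.archi_bound (v / V)); rewrite -ler_pdivrMr//.
  apply: ltW; apply: (lt_le_trans (archi_boundP _)); first by rewrite divr_ge0// ltW.
  by rewrite -natrX ler_nat ltnW// ltn_expl.
have [k vk kmin] := ex_minnP ex.
apply: (@le_trans _ _ (4 / V * 4^-1 ^+ k * (v <= 2 ^+ k * V)%R%:R)%:E).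
  rewrite vk mulr1 lee_fin; case: k vk kmin => [|k] vk kmin.
    rewrite expr0 mulr1; apply: (@le_trans _ _ V^-1).
      rewrite /volume_kernel ler_pdivrMr ?ltr_pwDl ?exprn_gt0 ?sqr_ge0//.
      by rewrite mulrDr expr2 mulKf ?gt_eqF// lerDl mulr_ge0 ?sqr_ge0// invr_ge0 ltW.
    by apply: ler_peMl; [rewrite invr_ge0 ltW|lra].
  have kv : 2 ^+ k * V < v by rewrite ltNge; apply/negP => /kmin; rewrite ltnn.
  have kV0 : 0 < 2 ^+ k * V by rewrite mulr_gt0// exprn_gt0.
  apply: (le_trans (volume_kernel_le_square V0 (lt_trans kV0 kv))).
  apply: (@le_trans _ _ (V / (2 ^+ k * V) ^+ 2)).
    rewrite ler_pM2l// lef_pV2 ?posrE ?exprn_gt0// ?(lt_trans kV0 kv)//.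
    by rewrite ler_sqr ?nnegrE ltW// (lt_trans kV0 kv).
  rewrite exprMn exprAC (_ : 2 ^+ 2 = 4 :> R); last by rewrite -natrX.
  rewrite exprVn le_eqVlt; apply/orP; left; apply/eqP.
  have : 4 ^+ k != 0 :> R by rewrite expf_neq0.
  rewrite [4 ^+ k.+1]exprS; move: (4 ^+ k) => a a0; field.
  by rewrite a0 gt_eqF.
rewrite (nneseriesD1 (n := k))//.
by rewrite leeDl// nneseries_ge0.
Qed.

End volume_kernel.

Section heat_kernel_bounds.
Context {R : realType} {d : nat}.
Hypothesis d0 : (0 < d)%N.
Implicit Types (x : Rd R d) (s : R).

(** Let y = |x|^2 / (4 s) in the maximum norm. Then (v / V)^2 = (4 y)^d, and y^d <= d! e^y gives 1 +
    (v / V)^2 <= [heat_bound] * e^y, which trades the Gaussian factor for [volume_kernel]. *)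
Definition heat_bound : R := 1 + 4 ^+ d * d`!%:R.

Lemma heat_bound_gt0 : 0 < heat_bound.
Proof. by rewrite /heat_bound addr_gt0// mulr_gt0 ?exprn_gt0// ltr0n fact_gt0. Qed.

Lemma heat_kernel_ge0 s x : 0 <= heat_kernel s x.
Proof.
by rewrite /heat_kernel; case: ifP => // _; rewrite mulr_ge0 ?powR_ge0 ?expR_ge0.
Qed.

Lemma powR_half_dim s : 0 <= s -> s `^ (d%:R / 2) = Num.sqrt s ^+ d.
Proof.
by move=> s0; rewrite mulrC powRrM powR12_sqrt// powR_mulrn// sqrtr_ge0.
Qed.

Lemma heat_kernel_le s x : 0 < s ->
  heat_kernel s x <= heat_bound * volume_kernel (Num.sqrt s ^+ d) (volRd x).
Proof.
move=> s0; rewrite /heat_kernel s0.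
set V := Num.sqrt s ^+ d; set v := volRd x.
have V0 : 0 < V by rewrite exprn_gt0// sqrtr_gt0.
have C0 := heat_bound_gt0.
have h1 : (4 * pi * s) `^ (- (d%:R / 2)) <= V^-1.
  rewrite powRN lef_pV2 ?posrE ?powR_gt0 ?mulr_gt0 ?pi_gt0//.
  rewrite /V -powR_half_dim ?(ltW s0)//; apply: ge0_ler_powR.
  - by rewrite divr_ge0.
  - by rewrite nnegrE ltW.
  - by rewrite nnegrE !mulr_ge0 ?pi_ge0// ltW.
  - rewrite ler_peMl ?ltW//; have := @pi_ge2 R; lra.
pose y := supnormRd x ^+ 2 / (4 * s).
have y0 : 0 <= y by rewrite divr_ge0 ?sqr_ge0 ?mulr_ge0 ?ltW.
have h2 : expR (- (sqnormRd x / (4 * s))) <= (expR y)^-1.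
  rewrite -expRN ler_expR lerN2 ler_pM2r ?invr_gt0 ?mulr_gt0//.
  exact: supnormRd_le_sqnorm.
have vV : (v / V) ^+ 2 = (4 * y) ^+ d.
  rewrite /v /V /volRd -expr_div_n exprAC expr_div_n sqr_sqrtr ?ltW//.
  by congr (_ ^+ d); rewrite /y; field; rewrite gt_eqF.
have h3 : 1 + (v / V) ^+ 2 <= heat_bound * expR y.
  have e1 : 1 <= expR y by rewrite -expR0 ler_expR.
  have e2 : y ^+ d <= d`!%:R * expR y.
    have := expR_ge1Dxn d.-1 y0; rewrite prednK//.
    move=> h; rewrite mulrC -ler_pdivrMr ?ltr0n ?fact_gt0//; lra.
  rewrite vV exprMn /heat_bound mulrDl mul1r lerD// -mulrA.
  by rewrite ler_wpM2l ?exprn_ge0.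
apply: (le_trans (ler_pM (powR_ge0 _ _) (expR_ge0 _) h1 h2)).
rewrite (_ : volume_kernel V v = V^-1 * (1 + (v / V) ^+ 2)^-1); last first.
  rewrite /volume_kernel; field; rewrite gt_eqF//=.
  by rewrite gt_eqF// ltr_pwDl ?sqr_ge0// exprn_gt0.
rewrite mulrCA ler_pM2l ?invr_gt0//.
rewrite ler_pdivlMr; last by rewrite ltr_pwDl// sqr_ge0.
by rewrite ler_pdivrMl ?expR_gt0// [leRHS]mulrC.
Qed.

(** At time s equal to the squared maximum norm of x, s^(d/2) is exactly [volRd x], and |x|^2 <= d s
    for the Euclidean norm keeps the exponent above - d / 4. *)
Definition heat_floor : R := (4 * pi) `^ (- (d%:R / 2)) * expR (- (d%:R / 4)).

Lemma heat_floor_gt0 : 0 < heat_floor.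
Proof. by rewrite mulr_gt0 ?expR_gt0// powR_gt0// mulr_gt0// pi_gt0. Qed.

Lemma heat_kernel_ge x : 0 < volRd x ->
  heat_floor / volRd x <= heat_kernel (supnormRd x ^+ 2) x.
Proof.
move=> v0; have r0 : 0 < supnormRd x.
  rewrite lt_neqAle supnormRd_ge0 andbT; apply/eqP => r0.
  by move: v0; rewrite /volRd -r0 expr0n gtn_eqF// ltxx.
have r2 : 0 <= supnormRd x ^+ 2 by exact: sqr_ge0.
have p4 : 0 <= 4 * pi :> R by rewrite mulr_ge0// pi_ge0.
rewrite /heat_kernel exprn_gt0//= (powRM _ p4 r2).
rewrite [X in _ <= _ * X * _]powRN (powR_half_dim r2).
rewrite sqrtr_sqr gtr0_norm// -/(volRd x) /heat_floor mulrAC.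
rewrite ler_pM2l; last by rewrite mulr_gt0 ?invr_gt0// powR_gt0// mulr_gt0// pi_gt0.
rewrite ler_expR lerN2 ler_pdivrMr ?mulr_gt0 ?exprn_gt0//.
apply: (le_trans (sqnormRd_le_supnorm x)).
by rewrite le_eqVlt; apply/orP; left; apply/eqP; field.
Qed.

End heat_kernel_bounds.

(** * Integrals with respect to the noise intensity *)

Section sigma_finite_alias.
Context {dispT : measure_display} {T : measurableType dispT} {R : realType}.
Context (mu : {measure set T -> \bar R}) (mu_sf : sigma_finite setT mu).

(* A measure carrying its sigma-finiteness proof, for canonical inference. *)
Definition with_sigma_finite of sigma_finite setT mu : set T -> \bar R := mu.

HB.instance Definition _ := Measure.on (with_sigma_finite mu_sf).
HB.instance Definition _ :=
  Measure_isSigmaFinite.Build _ _ _ (with_sigma_finite mu_sf) mu_sf.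

End sigma_finite_alias.

Section noise_intensity_integral.
Context {R : realType} {d : nat}.
Context (lambda : {measure set (measurableTypeR R) -> \bar R}).
(** By Markov's inequality the sets |z| >= 1 / (n + 1) have finite measure; adjoining the null set
    {0} makes them cover the line. *)
Lemma levy_sigma_finite : lambda [set 0] = 0%E ->
  (\int[lambda]_z (`|z : R|)%:E < +oo)%E -> sigma_finite setT lambda.
Proof.
move=> l0 l1.
pose G n : set (measurableTypeR R) := [set z : R | n.+1%:R^-1 <= `|z|].
have mn : measurable_fun setT (fun z : R => `|z|) by exact: normr_measurable.
have mE : measurable_fun setT (fun z : measurableTypeR R => (`|z : R|)%:E).
  exact/measurable_EFinP.
have mG n : measurable (G n).
  rewrite (_ : G n = (fun z : R => `|z|) @^-1` `[n.+1%:R^-1, +oo[%classic).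
    by rewrite -[X in measurable X]setTI; exact: mn.
  by apply/seteqP; split => z /=; rewrite in_itv/= andbT.
exists (fun n => G n `|` [set 0]).
  apply/esym; rewrite -subTset => z _; have [->|z0] := eqVneq z 0.
    by exists 0%N => //; right.
  have nz : 0 < `|z : R| by rewrite normr_gt0.
  exists (Num.Def.archi_bound (`|z|^-1)) => //; left; rewrite /G /=.
  rewrite -[leRHS]invrK lef_pV2 ?posrE ?invr_gt0//.
  apply: ltW; apply: (lt_le_trans (archi_boundP _)); first by rewrite invr_ge0.
  by rewrite ler_nat.
move=> n; split; first exact: measurableU.
apply: (@le_lt_trans _ _ (lambda (G n) + lambda [set 0%R])%E).
  exact: measureU2.
rewrite l0 adde0.
have nE0 z : (0 <= n.+1%:R%:E * (`|z : R|)%:E)%E by rewrite -EFinM lee_fin mulr_ge0.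
have mnE : measurable_fun setT (fun z : measurableTypeR R => n.+1%:R%:E * (`|z : R|)%:E)%E.
  exact: measurable_funeM.
apply: (@le_lt_trans _ _ (n.+1%:R%:E * \int[lambda]_z (`|z : R|)%:E)%E); last first.
  by rewrite lte_mul_pinfty ?lee_fin.
rewrite -ge0_integralZl_EFin//.
apply: (@le_trans _ _ (\int[lambda]_(z in G n) 1)%E).
  by rewrite integral_cst// mul1e.
apply: (@le_trans _ _ (\int[lambda]_(z in G n) (n.+1%:R%:E * (`|z : R|)%:E))%E).
  apply: ge0_le_integral => //; first exact: measurable_funTS.
  move=> z /= nz; rewrite -EFinM lee_fin.
  by rewrite -[leLHS](@mulfV _ n.+1%:R)// ler_pM2l.
exact: ge0_subset_integral.
Qed.

Local Open Scope ereal_scope.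

Let L := @lebesgue_spacetime R d.

(** For sigma-finite [lambda] the product [\x^] used in the intensity coincides with [\x], and
    Tonelli's theorem applies. The mark is integrated last because spatial integrals are estimated
    for a fixed mark; the factor with 0 < s is the restriction to positive times. *)
Lemma integral_noise_intensity (lsf : sigma_finite setT lambda)
    (Phi : marked_spacetime R d -> \bar R) :
  measurable_fun setT Phi -> (forall p, 0 <= Phi p) ->
  \int[noise_intensity lambda]_p Phi p =
  \int[lambda]_z \int[lebesgue_measure]_s \int[lebesgue_measureRd R d]_x
    ((0 < (s : R))%R%:R%:E * Phi (s, x, z)).
Proof.
move=> mPhi Phi0.
pose D := [set p : marked_spacetime R d | (0 < (p.1.1 : R))%R].
have mD : measurable D := measurable_pos_time.
pose lam : {sigma_finite_measure set (measurableTypeR R) -> \bar R} :=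
  with_sigma_finite lsf.
transitivity (\int[noise_intensity lambda]_(p in D) Phi p).
  rewrite (@ge0_negligible_integral _ _ _ _ _ (~` D))//; first last.
  - by rewrite /noise_intensity /= /mrestr setICl measure0.
  - exact: measurableC.
  by rewrite setDE setCK setTI.
transitivity (\int[L \x lam]_(p in D) Phi p).
  apply: eq_measure_integral => A mA AD.
  rewrite /noise_intensity /= /mrestr setIidl//.
  apply/esym/product_measure_unique => // B C mB mC.
  exact: (@product_measure2E _ _ _ _ _ L lam B C mB mC).
have mPD : measurable_fun setT (Phi \_ D).
  exact/(measurable_restrictT _ _).1/measurable_funTS.
have PD0 p : 0 <= (Phi \_ D) p by apply: erestrict_ge0.
rewrite integral_mkcond fubini_tonelli2//; apply: eq_integral => z _.
rewrite /fubini_G (_ : \int[L]_p _ =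
  \int[lebesgue_measure \x lebesgue_measureRd R d]_p (Phi \_ D) (p, z))//.
rewrite fubini_tonelli1//; last first.
  by apply: (measurableT_comp mPD); exact: measurable_fun_pair.
apply: eq_integral => s _; apply: eq_integral => x _ /=.
rewrite patchE; case: ifPn => [|].
  by rewrite inE /D /= => ->; rewrite mul1e.
by rewrite notin_setE /D /= => /negP/negbTE ->; rewrite mul0e.
Qed.

Lemma noise_intensity_sigma_finite : sigma_finite setT lambda ->
  sigma_finite setT (@noise_intensity R d lambda).
Proof.
move=> lsf.
pose lam : {sigma_finite_measure set (measurableTypeR R) -> \bar R} :=
  with_sigma_finite lsf.
have [F TF Foo] := sigma_finiteT (sigma_finite_prod L lam).
exists F => // n; have [mF nF] := Foo n; split => //.
apply: le_lt_trans nF; rewrite /noise_intensity /= /mrestr.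
have mFD : measurable (F n `&` [set p : marked_spacetime R d | (0 < (p.1.1 : R))%R]).
  by apply: measurableI => //; exact: measurable_pos_time.
rewrite -(@product_measure_unique _ _ _ _ _ L lam)//.
  by apply: le_measure; rewrite ?inE//.
by move=> B C mB mC; exact: (@product_measure2E _ _ _ _ _ L lam B C mB mC).
Qed.

End noise_intensity_integral.

(** * Spatial integrals of functions of the volume *)

Section spatial_integrals.
Context {R : realType}.

Lemma measurable_natr_bool {dispT} {T : measurableType dispT}
    (b : T -> bool) :
  measurable_fun setT b -> measurable_fun setT (fun x => (b x)%:R : R).
Proof.
move=> mb; rewrite (_ : (fun x => _) = fun x => if b x then 1 else 0).
  exact: measurable_fun_ifT.
by apply/funext => x; case: (b x).
Qed.

Lemma measurable_funV {dispT} {T : measurableType dispT} (f : T -> R) :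
  measurable_fun setT f -> measurable_fun setT (fun x => (f x)^-1).
Proof.
(* The power is taken of a square because [powR_inv1] concerns nonnegative bases; where f vanishes
   both sides are 0. *)
move=> mf; rewrite (_ : (fun x => _) = fun x => f x * (f x ^+ 2) `^ (-1)).
  apply: measurable_funM => //.
  have mp : measurable_fun setT (@powR R ^~ (-1)) by exact: measurable_powR.
  exact: (measurableT_comp mp (measurable_funX 2 mf)).
apply/funext => x; rewrite powR_inv1 ?sqr_ge0// expr2 invfM mulrA.
by have [->|fx0] := eqVneq (f x) 0; rewrite ?invr0 ?mulr0// mulfV// mul1r.
Qed.

Lemma geometric_half_eseries :
  (\sum_(k <oo) ((2^-1 : R) ^+ k)%:E = 2%:E)%E.
Proof.
have := @cvg_geometric_eseries_half R 2 0; rewrite expr0 divr1 => /cvg_lim <- //.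
apply: congr_lim; apply/funext => n; rewrite /eseries /=.
apply: eq_bigr => k _; congr EFin; rewrite addn1 natrX exprS exprVn invfM.
by rewrite mulrA mulfV ?mul1r.
Qed.

Context {d : nat}.
Hypothesis d0 : (0 < d)%N.
Let mu := lebesgue_measureRd R d.

Lemma measurable_volRd_le (a : R) :
  measurable_fun setT (fun x : Rd R d => (volRd x <= a)%R%:R : R).
Proof.
apply: measurable_natr_bool.
by apply: measurable_fun_ler => //; exact: measurable_volRd.
Qed.

Lemma integral_volRd_le (a : R) : 0 <= a ->
  (\int[mu]_x ((volRd x <= a)%R%:R)%:E = (2 ^+ d * a)%:E)%E.
Proof.
move=> a0; rewrite -(lebesgue_measureRd_volRd d0 a0).
have mv : measurable [set x : Rd R d | volRd x <= a].
  rewrite (_ : mkset _ = (@volRd R d) @^-1` `]-oo, a]%classic).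
    by rewrite -[X in measurable X]setTI; exact: measurable_volRd.
  by apply/seteqP; split => x /=; rewrite in_itv.
rewrite -[in RHS](setIT (mkset _)) -integral_indic//.
apply: eq_integral => x _; rewrite indicE; congr (_%:R%:E); congr nat_of_bool.
by apply/idP/idP; rewrite inE.
Qed.

Lemma measurable_volume_kernel (V : R) :
  measurable_fun setT (fun x : Rd R d => volume_kernel V (volRd x)).
Proof.
apply: measurable_funM => //.
apply: measurable_funV.
by apply: measurable_funD => //; apply: measurable_funX; exact: measurable_volRd.
Qed.

(** The k-th dyadic cube contributes (4 / V) 4^-k * 2^d 2^k V = 4 * 2^d * 2^-k. The result is
    uniform in V, hence in the age of a point. *)
Lemma integral_volume_kernel (V : R) : 0 < V ->
  (\int[mu]_x (volume_kernel V (volRd x))%:E <= (8 * 2 ^+ d)%:E)%E.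
Proof.
move=> V0.
pose t k (x : Rd R d) := (4 / V * 4^-1 ^+ k * (volRd x <= 2 ^+ k * V)%R%:R)%:E.
have t0 k x : (0 <= t k x)%E.
  by rewrite lee_fin mulr_ge0// mulr_ge0 ?divr_ge0 ?exprn_ge0// ltW.
have mt k : measurable_fun setT (t k).
  apply/measurable_EFinP; apply: measurable_funM => //.
  exact: measurable_volRd_le.
apply: (@le_trans _ _ (\int[mu]_x \sum_(k <oo) t k x)%E).
  apply: ge0_le_integral => //.
  - by move=> x _; rewrite lee_fin volume_kernel_ge0// ltW.
  - apply/measurable_EFinP; exact: measurable_volume_kernel.
  - by apply: ge0_emeasurable_sum.
  - by move=> x _; apply: volume_kernel_dyadic => //; exact: volRd_ge0.
rewrite integral_nneseries//.
rewrite (eq_eseriesr (g := fun k => ((4 * 2 ^+ d)%:E * (2^-1 ^+ k)%:E)%E)); last first.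
  move=> k _; rewrite /t; under eq_integral do rewrite EFinM.
  rewrite ge0_integralZl_EFin//; last 2 first.
  - apply/measurable_EFinP; exact: measurable_volRd_le.
  - by rewrite mulr_ge0 ?divr_ge0 ?exprn_ge0// ltW.
  rewrite integral_volRd_le ?mulr_ge0 ?exprn_ge0 ?ltW// -!EFinM; congr EFin.
  rewrite !exprVn (_ : 4 = 2 * 2 :> R) ?exprMn; last by rewrite -natrM.
  have : 2 ^+ k != 0 :> R by rewrite expf_neq0.
  move: (2 ^+ k) => a a0; field.
  by rewrite a0 gt_eqF.
rewrite nneseriesZl//.
by rewrite geometric_half_eseries -EFinM lee_fin mulrAC -natrM.
Qed.

Lemma measurable_volRd_tail (a : R) :
  measurable_fun setT (fun x : Rd R d => (a < volRd x)%R%:R / volRd x ^+ 2).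
Proof.
apply: measurable_funM.
  by apply: measurable_natr_bool; apply: measurable_fun_ltr => //; exact: measurable_volRd.
by apply: measurable_funV; apply: measurable_funX; exact: measurable_volRd.
Qed.

(** For v > a one has a^2 + v^2 <= 2 v^2, so 1 / v^2 is at most 2 / a times the kernel of scale a;
    16 is 2 times the 8 of [integral_volume_kernel]. *)
Lemma integral_volRd_tail (a : R) : 0 < a ->
  (\int[mu]_x ((a < volRd x)%R%:R / volRd x ^+ 2)%:E <= (16 * 2 ^+ d / a)%:E)%E.
Proof.
move=> a0.
apply: (@le_trans _ _ (\int[mu]_x ((2 / a)%:E * (volume_kernel a (volRd x))%:E))%E).
  apply: ge0_le_integral => //.
  - by move=> x _; rewrite lee_fin divr_ge0// exprn_ge0// volRd_ge0.
  - apply/measurable_EFinP; exact: measurable_volRd_tail.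
  - by apply: measurable_funeM; apply/measurable_EFinP; exact: measurable_volume_kernel.
  move=> x _; rewrite -EFinM lee_fin; case: ltP => [av|_]; last first.
    rewrite mul0r; apply: mulr_ge0; last exact/volume_kernel_ge0/ltW.
    by rewrite divr_ge0// ltW.
  have v0 := lt_trans a0 av; move: (volRd x) av v0 => v av v0.
  rewrite mul1r /volume_kernel mulrA divfK ?gt_eqF//.
  have av2 : a ^+ 2 <= v ^+ 2 by rewrite ler_sqr ?nnegrE ltW.
  rewrite ler_pdivlMr ?addr_gt0 ?exprn_gt0//.
  rewrite ler_pdivrMl ?exprn_gt0//; lra.
rewrite ge0_integralZl_EFin//; last 3 first.
- by move=> x _; rewrite lee_fin volume_kernel_ge0// ltW.
- apply/measurable_EFinP; exact: measurable_volume_kernel.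
- by rewrite divr_ge0// ltW.
apply: (le_trans (lee_wpmul2l _ (integral_volume_kernel a0))).
  by rewrite lee_fin divr_ge0// ltW.
by rewrite -EFinM lee_fin le_eqVlt; apply/orP; left; apply/eqP; field; rewrite gt_eqF.
Qed.

(** The source of all logarithms: for y = 1 / a it yields the integral of 1 / v over a < v <= 1, for
    y = |z| the number of levels at which a mark is large. *)
Lemma dyadic_count (y : R) :
  (\sum_(k <oo) ((2 ^+ k < y)%R%:R)%:E <=
   ((1 < y)%R%:R * (1 + ln y / ln 2))%:E)%E.
Proof.
case: ltP => [y1|y1]; last first.
  rewrite mul0r eseries0// => k _ _; rewrite ltNge (le_trans y1)//.
  by rewrite exprn_ege1// ler1n.
have ln20 : 0 < ln 2 :> R by rewrite ln_gt0// ltr1n.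
rewrite mul1r.
have ex : exists k, y <= 2 ^+ k.
  exists (Num.Def.archi_bound y).
  apply: ltW; apply: (lt_le_trans (archi_boundP _)); first by rewrite ltW// (lt_trans _ y1).
  by rewrite -natrX ler_nat ltnW// ltn_expl.
have [k yk kmin] := ex_minnP ex.
case: k yk kmin => [|k]; first by rewrite expr0 leNgt y1.
move=> yk kmin.
have ky : 2 ^+ k < y by rewrite ltNge; apply/negP => /kmin; rewrite ltnn.
rewrite (nneseries_split 0 k.+1); last by move=> i _; rewrite lee_fin.
rewrite [X in (_ + X)%E]eseries0; last first.
  move=> i; rewrite add0n => ki _; rewrite ltNge (le_trans yk)//.
  by rewrite ler_weXn2l// ler1n.
rewrite adde0 add0n sumEFin lee_fin.
apply: (@le_trans _ _ (\sum_(0 <= i < k.+1) 1)).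
  by apply: ler_sum => i _; rewrite lern1 leq_b1.
rewrite big_const_nat subn0 iter_addr addr0 -(natr1 k) addrC lerD2l.
rewrite ler_pdivlMr// mulr_natl -lnXn// ler_ln ?posrE ?exprn_gt0//; first exact: ltW.
by rewrite (lt_trans _ y1).
Qed.

Lemma measurable_volRd_near (a : R) :
  measurable_fun setT (fun x : Rd R d => (a < volRd x <= 1)%R%:R / volRd x).
Proof.
apply: measurable_funM.
  apply: measurable_natr_bool; apply: measurable_and.
    by apply: measurable_fun_ltr => //; exact: measurable_volRd.
  by apply: measurable_fun_ler => //; exact: measurable_volRd.
by apply: measurable_funV; exact: measurable_volRd.
Qed.

(** On a shell b < v <= 2 b with b = 2^k a, 1 / v is at most 5 times the kernel of scale b, whose
    mass is bounded. Only the shells with 2^k a < 1 occur, which [dyadic_count] counts; 40 = 5 *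
    8. *)
Lemma integral_volRd_near (a : R) : 0 < a ->
  (\int[mu]_x ((a < volRd x <= 1)%R%:R / volRd x)%:E <=
   (40 * 2 ^+ d * ((1 < a^-1)%R%:R * (1 + ln a^-1 / ln 2)))%:E)%E.
Proof.
move=> a0.
pose t k (x : Rd R d) := (5 * (2 ^+ k < a^-1)%R%:R * volume_kernel (2 ^+ k * a) (volRd x))%:E.
have ka0 k : 0 < 2 ^+ k * a by rewrite mulr_gt0// exprn_gt0.
have t0 k x : (0 <= t k x)%E.
  by rewrite lee_fin; apply: mulr_ge0; [rewrite mulr_ge0|exact/volume_kernel_ge0/ltW].
have mt k : measurable_fun setT (t k).
  apply/measurable_EFinP; apply: measurable_funM => //.
  exact: measurable_volume_kernel.
apply: (@le_trans _ _ (\int[mu]_x \sum_(k <oo) t k x)%E).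
  apply: ge0_le_integral => //.
  - by move=> x _; rewrite lee_fin divr_ge0// volRd_ge0.
  - apply/measurable_EFinP; exact: measurable_volRd_near.
  - by apply: ge0_emeasurable_sum.
  move=> x _; case: (boolP (_ < _ <= _)) => [/andP[av v1]|_]; last first.
    by rewrite mul0r nneseries_ge0.
  have v0 := lt_trans a0 av.
  have ex : exists k, volRd x <= 2 ^+ k * a.
    exists (Num.Def.archi_bound (volRd x / a)); rewrite -ler_pdivrMr//.
    apply: ltW; apply: (lt_le_trans (archi_boundP _)); first by rewrite divr_ge0// ltW.
    by rewrite -natrX ler_nat ltnW// ltn_expl.
  have [k vk kmin] := ex_minnP ex.
  case: k vk kmin => [|k vk kmin]; first by rewrite expr0 mul1r leNgt av.
  have kv : 2 ^+ k * a < volRd x by rewrite ltNge; apply/negP => /kmin; rewrite ltnn.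
  apply: (@le_trans _ _ (t k x)); last first.
    by rewrite (nneseriesD1 (n := k))// leeDl// nneseries_ge0.
  rewrite /t mul1r lee_fin -[a^-1]mul1r ltr_pdivlMr// (lt_le_trans kv v1) mulr1.
  rewrite /volume_kernel; move: vk kv (ka0 k); rewrite exprS -mulrA.
  move: (2 ^+ k * a) (volRd x) v0 => b v v0 vb bv b0.
  rewrite mulrA ler_pdivlMr ?addr_gt0 ?exprn_gt0// ler_pdivrMl//; nra.
rewrite integral_nneseries//.
apply: (@le_trans _ _ (\sum_(k <oo) ((40 * 2 ^+ d)%:E * ((2 ^+ k < a^-1)%R%:R)%:E))%E).
  apply: lee_nneseries => [k _ _|k _]; first exact: integral_ge0.
  rewrite /t; under eq_integral do rewrite EFinM.
  rewrite ge0_integralZl_EFin//; last 2 first.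
  - by move=> x _; rewrite lee_fin volume_kernel_ge0// ltW.
  - apply/measurable_EFinP; exact: measurable_volume_kernel.
  apply: (le_trans (lee_wpmul2l _ (integral_volume_kernel (ka0 k)))) => //.
  by rewrite -!EFinM lee_fin le_eqVlt; apply/orP; left; apply/eqP; ring.
rewrite nneseriesZl; last by move=> k _; rewrite lee_fin.
rewrite [leRHS]EFinM; apply: lee_wpmul2l; last exact: dyadic_count.
by rewrite lee_fin mulr_ge0// exprn_ge0.
Qed.

End spatial_integrals.

(** Integrals of nonnegative functions are suprema over simple functions, hence monotone for
    arbitrary functions; iterated integrals can then be compared without establishing measurability
    of the inner ones. *)
Lemma le_integral_ge0 {dispT} {T : measurableType dispT} {R : realType}
    (mu : {measure set T -> \bar R}) (f g : T -> \bar R) :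
  (forall x, 0 <= f x)%E -> (forall x, f x <= g x)%E ->
  (\int[mu]_x f x <= \int[mu]_x g x)%E.
Proof.
move=> f0 fg; rewrite !ge0_integralTE//; last by move=> x; exact: le_trans (fg x).
apply: le_ereal_sup => _ [h hf <-]; exists h => // x.
exact: le_trans (fg x).
Qed.

(** * Expected size of the jumps and size of the drift *)

Section noise_moments.
Context {R : realType} {d : nat}.
Hypothesis d0 : (0 < d)%N.
Context (lambda : {measure set (measurableTypeR R) -> \bar R}).
Hypothesis lambda0 : lambda [set 0] = 0%E.
Hypothesis lambda1 : (\int[lambda]_z (`|z : R|)%:E < +oo)%E.
Let nu := @noise_intensity R d lambda.
Let lsf := levy_sigma_finite lambda0 lambda1.
Notation MS := (marked_spacetime R d).

Lemma integral_noise_window (a b : R) (psi : Rd R d -> measurableTypeR R -> \bar R) :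
  0 <= a -> a <= b -> measurable_fun setT (fun q => psi q.1 q.2) ->
  (forall x z, 0 <= psi x z)%E ->
  (\int[nu]_q ((a < q.1.1 <= b)%R%:R%:E * psi q.1.2 q.2) =
   (b - a)%:E * \int[lambda]_z \int[lebesgue_measureRd R d]_x psi x z)%E.
Proof.
move=> a0 ab mpsi psi0.
have mw : measurable_fun setT (fun q : MS => ((a < q.1.1 <= b)%R%:R : R)).
  apply: measurable_natr_bool; apply: measurable_and.
    by apply: measurable_fun_ltr => //; exact: measurableT_comp.
  by apply: measurable_fun_ler => //; exact: measurableT_comp.
have mpsi' : measurable_fun setT (fun q : MS => psi q.1.2 q.2).
  apply: (measurableT_comp mpsi (g := fun q : MS => (q.1.2, q.2))).
  by apply: measurable_fun_pair => //; exact: measurableT_comp.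
have mpsiz z : measurable_fun setT (fun x => psi x z).
  by apply: (measurableT_comp mpsi (g := fun x => (x, z))); exact: measurable_fun_pair.
rewrite (integral_noise_intensity lsf); last 2 first.
- by apply: emeasurable_funM => //; exact/measurable_EFinP.
- by move=> q; rewrite mule_ge0// lee_fin.
rewrite -ge0_integralZl_EFin//; last 3 first.
- by move=> z _; apply: integral_ge0.
- have := @measurable_fun_fubini_tonelli_G _ _ (Rd R d) (measurableTypeR R) R
    (lebesgue_measureRd R d) (fun q => psi q.1 q.2) mpsi.
  by apply.
- by rewrite subr_ge0.
apply: eq_integral => z _.
pose I : set (measurableTypeR R) := `]a, b]%classic.
have mI : measurable I by exact: measurable_itv.
transitivity (\int[lebesgue_measure]_s ((\1_I s)%:E *
    \int[lebesgue_measureRd R d]_x psi x z))%E.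
  apply: eq_integral => s _.
  rewrite -ge0_integralZl_EFin//.
  apply: eq_integral => x _; rewrite muleA -EFinM; congr (_%:E * _)%E.
  rewrite indicE /I mem_setE in_itv /= -natrM mulnb.
  (* Since 0 <= a, the restriction of the intensity to positive times is automatic inside the
     window. *)
  by case: (boolP (a < s)) => [as_|]/=; rewrite ?andbF// (le_lt_trans a0 as_).
rewrite ge0_integralZr//; last 2 first.
- by apply/measurable_EFinP.
- by apply: integral_ge0.
rewrite integral_indic// setIT; congr (_ * _)%E.
transitivity (lebesgue_measure (`]a, b]%classic : set R)) => //.
rewrite lebesgue_measure_itv/= lte_fin.
have [ab'|] := ltP a b; first by rewrite EFinB.
by move=> ba; have -> : a = b by [apply/le_anti/andP]; rewrite subrr.
Qed.

Definition jump_majorant (t : R) (q : MS) : R :=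
  heat_kernel (t - q.1.1) (subRd Rd0 q.1.2) * `|q.2 : R|.

Lemma measurable_heat_kernel :
  measurable_fun setT (fun q : measurableTypeR R * Rd R d => heat_kernel (q.1 : R) q.2).
Proof.
have mt : measurable_fun setT (fun q : measurableTypeR R * Rd R d => q.1 : R).
  exact: measurable_fst.
have msq : measurable_fun setT (fun q : measurableTypeR R * Rd R d => sqnormRd q.2).
  rewrite /sqnormRd; apply: measurable_sum => i; apply: measurable_funX.
  exact: (measurableT_comp (measurable_tnth i)).
apply: measurable_fun_ifT => //.
- exact: measurable_fun_ltr.
- apply: measurable_funM.
    apply: (measurableT_comp (measurable_powR _)).
    by apply: measurable_funM.
  apply: measurableT_comp => //; apply: measurableT_comp => //.
  apply: measurable_funM => //; apply: measurable_funV; exact: measurable_funM.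
Qed.

Lemma measurable_subRd0 : measurable_fun setT (fun x : Rd R d => subRd Rd0 x).
Proof.
apply/measurable_fun_tnthP => i.
rewrite (_ : _ \o _ = fun x : Rd R d => - (tnth x i : R)).
  by apply: measurableT_comp => //; exact: measurable_tnth.
by apply/funext => x /=; rewrite tnth_mktuple tnth_mktuple sub0r.
Qed.

Lemma measurable_jump_majorant :
  measurable_fun setT (fun tq : measurableTypeR R * MS => jump_majorant tq.1 tq.2).
Proof.
apply: measurable_funM.
  apply: (measurableT_comp measurable_heat_kernel
    (g := fun tq : measurableTypeR R * MS => (tq.1 - tq.2.1.1, subRd Rd0 tq.2.1.2))).
  apply: measurable_fun_pair.
    apply: measurable_funB => //.
    by do 2 (apply: (@measurableT_comp _ _ _ _ _ _ fst) => //).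
  apply: (measurableT_comp measurable_subRd0).
  by apply: measurableT_comp => //; apply: measurableT_comp.
by apply: measurableT_comp => //; apply: measurableT_comp.
Qed.

(** The exact mass of the heat kernel is 1; any bound uniform in time does, and this one results
    from [heat_kernel_le] and [integral_volume_kernel]. *)
Definition heat_mass : R := @heat_bound R d * (8 * 2 ^+ d).

Lemma heat_mass_ge0 : 0 <= heat_mass.
Proof. by rewrite mulr_ge0 ?mulr_ge0 ?exprn_ge0// ltW// heat_bound_gt0. Qed.

Lemma measurable_heat_kernel_opp (s : R) :
  measurable_fun setT (fun x : Rd R d => heat_kernel s (subRd Rd0 x)).
Proof.
apply: (measurableT_comp measurable_heat_kernel
  (g := fun x : Rd R d => (s : measurableTypeR R, subRd Rd0 x))).
apply: measurable_fun_pair; first exact: measurable_cst.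
exact: measurable_subRd0.
Qed.

Lemma integral_heat_kernel (s : R) :
  (\int[lebesgue_measureRd R d]_x (heat_kernel s (subRd Rd0 x))%:E
   <= ((0 < s)%R%:R * heat_mass)%:E)%E.
Proof.
case: ltP => [s0|s0]; last first.
  rewrite mul0r integral0_eq// => x _.
  by rewrite /heat_kernel ltNge s0.
have V0 : 0 < Num.sqrt s ^+ d by rewrite exprn_gt0// sqrtr_gt0.
apply: (@le_trans _ _ (\int[lebesgue_measureRd R d]_x
    ((@heat_bound R d)%:E * (volume_kernel (Num.sqrt s ^+ d) (volRd x))%:E))%E).
  apply: ge0_le_integral => //.
  - by move=> x _; rewrite lee_fin heat_kernel_ge0.
  - by apply/measurable_EFinP; exact: measurable_heat_kernel_opp.
  - by apply: measurable_funeM; apply/measurable_EFinP; exact: measurable_volume_kernel.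
  by move=> x _; rewrite -EFinM lee_fin -(volRd_opp x) heat_kernel_le.
rewrite ge0_integralZl_EFin//; last 3 first.
- by move=> x _; rewrite lee_fin volume_kernel_ge0// ltW.
- by apply/measurable_EFinP; exact: measurable_volume_kernel.
- exact/ltW/heat_bound_gt0.
rewrite mul1r EFinM lee_wpmul2l//; first by rewrite lee_fin ltW// heat_bound_gt0.
exact: integral_volume_kernel.
Qed.

Definition jump_mean : R := fine (\int[lambda]_z (`|z : R|)%:E)%E.

Lemma jump_mean_ge0 : 0 <= jump_mean.
Proof. by rewrite fine_ge0// integral_ge0. Qed.

Lemma integral_jump_mean : (\int[lambda]_z (`|z : R|)%:E = jump_mean%:E)%E.
Proof. by rewrite fineK// ge0_fin_numE// integral_ge0. Qed.

Lemma measurable_normz : measurable_fun setT (fun z : measurableTypeR R => (`|z : R|)%:E).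
Proof. exact/measurable_EFinP. Qed.

Lemma integral_open_time (t : R) : 0 <= t ->
  (\int[lebesgue_measure]_s (((0 < (s : R)) && (s < t))%R%:R)%:E = t%:E)%E.
Proof.
move=> t0; pose I : set (measurableTypeR R) := `]0, t[%classic.
have mI : measurable I by exact: measurable_itv.
rewrite (eq_integral (fun s => (\1_I s)%:E)); last first.
  by move=> s _; rewrite indicE /I mem_setE in_itv.
rewrite integral_indic// setIT.
transitivity (lebesgue_measure (`]0, t[%classic : set R)) => //.
rewrite lebesgue_measure_itv/= lte_fin.
have [ab'|] := ltP 0 t; first by rewrite oppr0 adde0.
by move=> ba; have -> : t = 0 by apply/le_anti/andP.
Qed.

Lemma expectation_jump_majorant (t : R) : 0 <= t ->
  (\int[nu]_q (jump_majorant t q)%:E <= (heat_mass * jump_mean * t)%:E)%E.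
Proof.
move=> t0.
have mJ : measurable_fun setT (fun q : MS => (jump_majorant t q)%:E).
  apply/measurable_EFinP; apply: (measurableT_comp measurable_jump_majorant
    (g := fun q : MS => (t : measurableTypeR R, q))).
  by apply: measurable_fun_pair => //; exact: measurable_cst.
have J0 q : (0 <= (jump_majorant t q)%:E)%E.
  by rewrite lee_fin mulr_ge0// heat_kernel_ge0.
have mhk s : measurable_fun setT (fun x : Rd R d => (heat_kernel s (subRd Rd0 x))%:E).
  by apply/measurable_EFinP; exact: measurable_heat_kernel_opp.
have hk0 s (x : Rd R d) : (0 <= (heat_kernel s x)%:E)%E by rewrite lee_fin heat_kernel_ge0.
rewrite (integral_noise_intensity lsf)//.
pose w (s : measurableTypeR R) : R := ((0 < (s : R)) && ((s : R) < t))%R%:R.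
have wint : (\int[lebesgue_measure]_s (w s)%:E = t%:E)%E by exact: integral_open_time.
have mw : measurable_fun setT (fun s : measurableTypeR R => (w s)%:E).
  apply/measurable_EFinP; apply: measurable_natr_bool.
  by apply: measurable_and; exact: measurable_fun_ltr.
apply: (@le_trans _ _ (\int[lambda]_z \int[lebesgue_measure]_s
    ((`|z : R|)%:E * (heat_mass%:E * (w s)%:E)))%E).
  apply: le_integral_ge0 => z.
    by do 2 (apply: integral_ge0 => ? _); rewrite mule_ge0// lee_fin.
  apply: le_integral_ge0 => s.
    by apply: integral_ge0 => ? _; rewrite mule_ge0// lee_fin.
  rewrite (eq_integral (fun x => ((0 < s)%R%:R * `|z|)%:E *
      (heat_kernel (t - s) (subRd Rd0 x))%:E)%E); last first.
    by move=> x _; rewrite -!EFinM /jump_majorant mulrA mulrAC.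
  rewrite ge0_integralZl_EFin//.
  apply: (le_trans (lee_wpmul2l _ (integral_heat_kernel (t - s)))).
    by rewrite lee_fin mulr_ge0.
  rewrite -!EFinM lee_fin subr_gt0 /w -mulnb natrM le_eqVlt; apply/orP; left.
  by apply/eqP; ring.
have hm0 := heat_mass_ge0.
have w0 s : (0 <= (w s)%:E)%E by rewrite lee_fin.
rewrite (eq_integral (fun z : measurableTypeR R =>
    (`|z : R|)%:E * (heat_mass * t)%:E)%E); last first.
  move=> z _; rewrite ge0_integralZl_EFin//; last 2 first.
  - by move=> s _; rewrite mule_ge0.
  - exact: measurable_funeM.
  by congr (_ * _)%E; rewrite ge0_integralZl_EFin// wint EFinM.
rewrite ge0_integralZr//; last 2 first.
- exact: measurable_normz.
- by rewrite lee_fin mulr_ge0.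
rewrite integral_jump_mean -!EFinM lee_fin le_eqVlt; apply/orP; left.
by apply/eqP; ring.
Qed.

Let ST := @lebesgue_spacetime R d.

Lemma integral_heat_kernel_spacetime (t : R) : 0 <= t ->
  (\int[ST]_(p in `]0%R, t[ `*` setT) (heat_kernel (t - p.1) (subRd Rd0 p.2))%:E
   <= (heat_mass * t)%:E)%E.
Proof.
move=> t0; pose D : set (measurableTypeR R * Rd R d) := `]0%R, t[%classic `*` setT.
have mD : measurable D by apply: measurableX => //; exact: measurable_itv.
pose F (p : measurableTypeR R * Rd R d) := (heat_kernel (t - p.1) (subRd Rd0 p.2))%:E.
have F0 p : (0 <= F p)%E by rewrite lee_fin heat_kernel_ge0.
have mF : measurable_fun setT F.
  apply/measurable_EFinP; apply: (measurableT_comp measurable_heat_kernel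
    (g := fun p : measurableTypeR R * Rd R d => (t - p.1, subRd Rd0 p.2))).
  apply: measurable_fun_pair; first exact: measurable_funB.
  by apply: (measurableT_comp measurable_subRd0).
have mFD : measurable_fun setT (F \_ D).
  exact/(measurable_restrictT _ _).1/measurable_funTS.
rewrite integral_mkcond -/D -/F.
rewrite (_ : (\int[ST]_p _ = \int[lebesgue_measure \x lebesgue_measureRd R d]_p (F \_ D) p)%E)//.
rewrite fubini_tonelli1//; last by move=> p; apply: erestrict_ge0.
pose w (s : measurableTypeR R) : R := ((0 < (s : R)) && ((s : R) < t))%R%:R.
have wint : (\int[lebesgue_measure]_s (w s)%:E = t%:E)%E by exact: integral_open_time.
have hm0 := heat_mass_ge0.
apply: (@le_trans _ _ (\int[lebesgue_measure]_s (heat_mass%:E * (w s)%:E))%E); last first.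
  rewrite ge0_integralZl_EFin ?wint ?EFinM//.
    by move=> s _; rewrite lee_fin.
  apply/measurable_EFinP; apply: measurable_natr_bool.
  by apply: measurable_and; exact: measurable_fun_ltr.
apply: le_integral_ge0 => s.
  by apply: integral_ge0 => x _; apply: erestrict_ge0.
rewrite /fubini_F /w; case: (boolP ((0 < (s : R)) && ((s : R) < t))) => st; last first.
  rewrite mule0 integral0_eq// => x _.
  have nD : ~ D (s, x) by rewrite /D /= in_itv/= => -[sx _]; rewrite sx in st.
  by rewrite patchE memNset.
rewrite mule1; apply: (le_trans _ (le_trans (integral_heat_kernel (t - s)) _)).
  apply: le_integral_ge0 => x; first by apply: erestrict_ge0.
  by rewrite patchE; case: ifP => _ //; exact: F0 (s, x).
by case/andP: st => _ st; rewrite subr_gt0 st mul1r.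
Qed.

Lemma Rintegral_heat_kernel_le (t k : R) (h : measurableTypeR R * Rd R d -> R) :
  0 <= t -> 0 <= k ->
  ST.-integrable (`]0%R, t[ `*` setT) (EFin \o h) ->
  (forall p, `|h p| <= k * heat_kernel (t - p.1) (subRd Rd0 p.2)) ->
  `|\int[ST]_(p in `]0%R, t[ `*` setT) h p| <= k * heat_mass * t.
Proof.
move=> t0 k0 ih hb.
pose D : set (measurableTypeR R * Rd R d) := `]0%R, t[%classic `*` setT.
have mD : measurable D by apply: measurableX => //; exact: measurable_itv.
have [mh _] := integrableP _ _ _ ih.
rewrite -lee_fin /Rintegral -abse_EFin fineK; last exact: integrable_fin_num.
apply: (le_trans (le_abse_integral _ _ _)) => //.
pose F (p : measurableTypeR R * Rd R d) := (heat_kernel (t - p.1) (subRd Rd0 p.2))%:E.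
have F0 p : (0 <= F p)%E by rewrite lee_fin heat_kernel_ge0.
have mF : measurable_fun setT F.
  apply/measurable_EFinP; apply: (measurableT_comp measurable_heat_kernel
    (g := fun p : measurableTypeR R * Rd R d => (t - p.1, subRd Rd0 p.2))).
  apply: measurable_fun_pair; first exact: measurable_funB.
  by apply: (measurableT_comp measurable_subRd0).
apply: (@le_trans _ _ (\int[ST]_(p in D) (k%:E * F p))%E).
  apply: ge0_le_integral => //.
  - exact: measurableT_comp.
  - by apply: measurable_funeM; exact: measurable_funTS.
  - by move=> p _ /=; rewrite -EFinM lee_fin.
rewrite ge0_integralZl_EFin//; last exact: measurable_funTS.
rewrite -mulrA EFinM lee_wpmul2l ?lee_fin//.
exact: integral_heat_kernel_spacetime.
Qed.

End noise_moments.

(** * Point sums over time windows *)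

Section noise_points.
Context {R : realType} {d : nat}.
Hypothesis d0 : (0 < d)%N.
Context {disp : measure_display} {Omega : measurableType disp}.
Context (P : probability Omega R).
Notation MS := (marked_spacetime R d).
Context (p : nat -> {mfun Omega >-> MS}).
Context (lambda : {measure set (measurableTypeR R) -> \bar R}).
Hypothesis lambda0 : lambda [set 0] = 0%E.
Hypothesis lambda1 : (\int[lambda]_z (`|z : R|)%:E < +oo)%E.
Hypothesis hN : poisson_random_measure P (noise_intensity lambda)
  (fun w => counting_measure_of_points (p^~ w)).

Let nu : {sigma_finite_measure set MS -> \bar R} :=
  with_sigma_finite (noise_intensity_sigma_finite (d := d) (levy_sigma_finite lambda0 lambda1)).
Let hnu : poisson_random_measure P nu
  (fun w => counting_measure_of_points (p^~ w)) := hN.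

(** Open on the left, so that consecutive windows tile the positive times without overlap. *)
Definition in_window (a b : R) (q : MS) : R := (a < q.1.1 <= b)%R%:R.

Definition window_sum (a b : R) (psi : Rd R d -> measurableTypeR R -> R) (w : Omega) : \bar R :=
  (\sum_(i <oo) (in_window a b (p i w) * psi (p i w).1.2 (p i w).2)%:E)%E.

Lemma measurable_in_window (a b : R) : measurable_fun setT (in_window a b).
Proof.
apply: measurable_natr_bool; apply: measurable_and.
  by apply: measurable_fun_ltr => //; exact: measurableT_comp.
by apply: measurable_fun_ler => //; exact: measurableT_comp.
Qed.

Section window.
Context (a b : R) (psi : Rd R d -> measurableTypeR R -> R).
Hypotheses (a0 : 0 <= a) (ab : a <= b).
Hypothesis mpsi : measurable_fun setT (fun q => psi q.1 q.2).
Hypothesis psi0 : forall x z, 0 <= psi x z.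

Let Phi (q : MS) : \bar R := (in_window a b q * psi q.1.2 q.2)%:E.

Let mPhi : measurable_fun setT Phi.
Proof.
apply/measurable_EFinP; apply: measurable_funM; first exact: measurable_in_window.
apply: (measurableT_comp mpsi (g := fun q : MS => (q.1.2, q.2))).
by apply: measurable_fun_pair => //; exact: measurableT_comp.
Qed.

Let Phi0 q : (0 <= Phi q)%E.
Proof. by rewrite lee_fin mulr_ge0. Qed.

Lemma window_sum_ge0 w : (0 <= window_sum a b psi w)%E.
Proof. by apply: nneseries_ge0 => i _ _; exact: Phi0. Qed.

Lemma measurable_window_sum : measurable_fun setT (window_sum a b psi).
Proof. exact: measurable_point_sum mPhi Phi0. Qed.

Let intPhi : (\int[nu]_q Phi q =
  (b - a)%:E * \int[lambda]_z \int[lebesgue_measureRd R d]_x (psi x z)%:E)%E.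
Proof.
rewrite -(integral_noise_window lambda0 lambda1 (psi := fun x z => (psi x z)%:E))//.
exact/measurable_EFinP.
Qed.

Lemma window_mean : (\int[P]_w window_sum a b psi w =
  (b - a)%:E * \int[lambda]_z \int[lebesgue_measureRd R d]_x (psi x z)%:E)%E.
Proof. by rewrite -intPhi -(campbell hnu mPhi Phi0). Qed.

Lemma window_variance (e : R) :
  ((b - a)%:E * \int[lambda]_z \int[lebesgue_measureRd R d]_x (psi x z)%:E = e%:E)%E ->
  (\int[P]_w ((window_sum a b psi w - e%:E) * (window_sum a b psi w - e%:E)) =
  (b - a)%:E * \int[lambda]_z \int[lebesgue_measureRd R d]_x (psi x z ^+ 2)%:E)%E.
Proof.
rewrite -intPhi => /(campbell_variance hnu mPhi Phi0) ->.
rewrite -(integral_noise_window lambda0 lambda1 (psi := fun x z => (psi x z ^+ 2)%:E))//.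
- apply: eq_integral => q _; rewrite /Phi -!EFinM; congr EFin.
  by rewrite /in_window; case: (_ < _ <= _); rewrite ?mul1r// !mul0r.
- by apply/measurable_EFinP; apply: measurable_funX.
- by move=> x z; rewrite lee_fin sqr_ge0.
Qed.

Lemma sqr_deviation_ge0 (e : R) w :
  (0 <= (window_sum a b psi w - e%:E) * (window_sum a b psi w - e%:E))%E.
Proof.
case: (_ - _)%E => [x||]; rewrite ?mulyy ?mulNyNy ?leey//.
by rewrite -EFinM lee_fin -expr2 sqr_ge0.
Qed.

Lemma measurable_sqr_deviation (e : R) : measurable_fun setT
  (fun w => (window_sum a b psi w - e%:E) * (window_sum a b psi w - e%:E))%E.
Proof.
by apply: emeasurable_funM; apply: emeasurable_funB => //; exact: measurable_window_sum.
Qed.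

End window.

(** From x <= 1 + x^2. It replaces a sum by its mean plus a squared deviation, and the latter can be
    summed over the levels m while the means cannot. *)
Lemma deviation_bound (S : \bar R) (e : R) : (0 <= S)%E ->
  (S <= (e + 1)%:E + (S - e%:E) * (S - e%:E))%E.
Proof.
case: S => [s _|_|//]; last by rewrite /= mulyy.
by rewrite -EFinB -EFinM -EFinD lee_fin; have := sqr_ge0 (s - e - 1/2); nra.
Qed.

Lemma deviation_lt (S : \bar R) (e c : R) : (0 <= S)%E -> 0 < c ->
  ((S - e%:E) * (S - e%:E) < (c ^+ 2)%:E)%E -> (S < (e + c)%:E)%E.
Proof.
move=> S0 c0; case: S S0 => [s _|_|//]; last by rewrite /= mulyy.
rewrite -EFinB -EFinM !lte_fin => h; rewrite addrC -ltrBlDr.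
rewrite ltNge; apply/negP => cs.
have : 0 <= (s - e - c) * (s - e + c) by rewrite mulr_ge0//; lra.
by move: h; lra.
Qed.

Let c := jump_mean lambda.
Let c0 : 0 <= c := jump_mean_ge0 lambda.

(** * Points at least one time unit old *)

Section old_slabs.
Context (eps : R).
Hypothesis eps0 : 0 < eps.
Hypothesis lambda_eps : (\int[lambda]_z (`|z : R| `^ (1 + eps))%:E < +oo)%E.

(** Marks averaged over a cube of volume of order 4^m are cut at 2^m: below this level their
    variance decays like 2^-m, above it their means are summable over m by the moment of order 1 +
    eps. *)
Let psi1 m (x : Rd R d) (z : measurableTypeR R) : R :=
  4^-1 ^+ m * (volRd x <= 4 ^+ m)%R%:R * (`|z : R| * (`|z : R| <= 2 ^+ m)%R%:R).

Let psi2 m (x : Rd R d) (z : measurableTypeR R) : R :=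
  4^-1 ^+ m * (volRd x <= 4 ^+ m)%R%:R * (`|z : R| * (2 ^+ m < `|z : R|)%R%:R).

Let mnz1 m : measurable_fun setT
  (fun z : measurableTypeR R => `|z : R| * (`|z : R| <= 2 ^+ m)%R%:R).
Proof.
apply: measurable_funM => //; apply: measurable_natr_bool.
exact: measurable_fun_ler.
Qed.

Let mnz2 m : measurable_fun setT
  (fun z : measurableTypeR R => `|z : R| * (2 ^+ m < `|z : R|)%R%:R).
Proof.
apply: measurable_funM => //; apply: measurable_natr_bool.
exact: measurable_fun_ltr.
Qed.

Let mvol m : measurable_fun setT (fun q : Rd R d * measurableTypeR R =>
  4^-1 ^+ m * (volRd q.1 <= 4 ^+ m)%R%:R : R).
Proof.
apply: measurable_funM => //.
by apply: (measurableT_comp (measurable_volRd_le (4 ^+ m))).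
Qed.

Let mpsi1 m : measurable_fun setT (fun q => psi1 m q.1 q.2).
Proof.
by apply: measurable_funM; [exact: mvol|apply: (measurableT_comp (mnz1 m))].
Qed.

Let mpsi2 m : measurable_fun setT (fun q => psi2 m q.1 q.2).
Proof.
by apply: measurable_funM; [exact: mvol|apply: (measurableT_comp (mnz2 m))].
Qed.

Let psi1_ge0 m x z : 0 <= psi1 m x z.
Proof. by rewrite /psi1 !mulr_ge0// exprn_ge0// invr_ge0. Qed.

Let psi2_ge0 m x z : 0 <= psi2 m x z.
Proof. by rewrite /psi2 !mulr_ge0// exprn_ge0// invr_ge0. Qed.

Let int_box (k : R) m : 0 <= k ->
  (\int[lebesgue_measureRd R d]_x (4^-1 ^+ m * (volRd x <= 4 ^+ m)%R%:R * k)%:E =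
   (2 ^+ d * k)%:E)%E.
Proof.
move=> k0; under eq_integral do rewrite mulrAC EFinM.
rewrite ge0_integralZl_EFin//; last 2 first.
- by apply/measurable_EFinP; exact: measurable_volRd_le.
- by rewrite mulr_ge0// exprn_ge0// invr_ge0.
rewrite integral_volRd_le// ?exprn_ge0// -EFinM; congr EFin.
rewrite exprVn; have : 4 ^+ m != 0 :> R by rewrite expf_neq0.
by move: (4 ^+ m) => u u0; field.
Qed.

Let e1 m : R := fine (\int[lambda]_z \int[lebesgue_measureRd R d]_x (psi1 m x z)%:E)%E.

Let int_psi1_le m :
  (\int[lambda]_z \int[lebesgue_measureRd R d]_x (psi1 m x z)%:E <= (2 ^+ d * c)%:E)%E.
Proof.
apply: (@le_trans _ _ (\int[lambda]_z ((2 ^+ d)%:E * (`|z : R|)%:E))%E).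
  apply: le_integral_ge0 => z; first by apply: integral_ge0 => x _; rewrite lee_fin.
  rewrite /psi1 int_box ?mulr_ge0// -EFinM lee_fin ler_wpM2l ?exprn_ge0//.
  by rewrite ler_piMr// lern1 leq_b1.
rewrite ge0_integralZl_EFin ?exprn_ge0//; last exact: measurable_normz.
by rewrite (integral_jump_mean lambda1) -EFinM.
Qed.

Let e1E m : (\int[lambda]_z \int[lebesgue_measureRd R d]_x (psi1 m x z)%:E = (e1 m)%:E)%E.
Proof.
rewrite fineK// ge0_fin_numE; first exact: le_lt_trans (int_psi1_le m) (ltry _).
by do 2 apply: integral_ge0 => ? _; rewrite lee_fin.
Qed.

Let e1_le m : e1 m <= 2 ^+ d * c.
Proof. by rewrite -lee_fin -e1E. Qed.

(** Since z^2 <= 2^m |z| for the marks kept, the square of the normalization, the volume and the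
    mark give 4^(-2m) * 4^m * 2^m = 2^-m, with the first moment of the marks as the only cost. *)
Let int_psi1_sqr m :
  (\int[lambda]_z \int[lebesgue_measureRd R d]_x (psi1 m x z ^+ 2)%:E
   <= (2 ^+ d * c)%:E * (2^-1 ^+ m)%:E)%E.
Proof.
apply: (@le_trans _ _ (\int[lambda]_z ((2 ^+ d * 2^-1 ^+ m)%:E * (`|z : R|)%:E))%E).
  apply: le_integral_ge0 => z.
    by apply: integral_ge0 => x _; rewrite lee_fin sqr_ge0.
  pose k : R := 4^-1 ^+ m * `|z : R| ^+ 2 * (`|z : R| <= 2 ^+ m)%R%:R.
  rewrite (eq_integral (fun x => (4^-1 ^+ m * (volRd x <= 4 ^+ m)%R%:R * k)%:E)); last first.
    move=> x _; congr EFin; rewrite /psi1 /k.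
    by case: (volRd x <= _); case: (_ <= _); rewrite ?(mulr0, mul0r, mulr1, expr0n)//=; ring.
  rewrite int_box ?mulr_ge0 ?exprn_ge0 ?invr_ge0// -EFinM lee_fin -mulrA.
  rewrite ler_wpM2l ?exprn_ge0// /k.
  case: (leP `|z : R| (2 ^+ m)) => zm; last by rewrite mulr0 mulr_ge0// exprn_ge0// invr_ge0.
  rewrite mulr1 expr2 mulrA ler_wpM2r//.
  rewrite (_ : 4 = 2 * 2 :> R); last by rewrite -natrM.
  rewrite !exprVn exprMn invfM -mulrA ler_piMr// ?invr_ge0 ?exprn_ge0//.
  by rewrite mulrC ler_pdivrMr ?mul1r// exprn_gt0.
rewrite ge0_integralZl_EFin//; last exact: measurable_normz.
by rewrite (integral_jump_mean lambda1) -!EFinM lee_fin mulrAC.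
Qed.

(** A mark with |z| > 1 is large at no more than 1 + ln |z| / ln 2 levels, and eps * ln |z| <=
    |z|^eps bounds this by [keps] * |z|^eps. *)
Let keps : R := 1 + (eps * ln 2)^-1.
Let ceps : R := fine (\int[lambda]_z (`|z : R| `^ (1 + eps))%:E)%E.

Let mpow : measurable_fun setT (fun z : measurableTypeR R => (`|z : R| `^ (1 + eps))%:E).
Proof.
apply/measurable_EFinP.
have mp : measurable_fun setT (@powR R ^~ (1 + eps)) by exact: measurable_powR.
exact: (measurableT_comp mp).
Qed.

Let sum_psi2 :
  (\sum_(m <oo) \int[lambda]_z \int[lebesgue_measureRd R d]_x (psi2 m x z)%:E
   <= (2 ^+ d * keps * ceps)%:E)%E.
Proof.
have ln20 : 0 < ln 2 :> R by rewrite ln_gt0// ltr1n.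
have keps0 : 0 <= keps by rewrite addr_ge0// invr_ge0 mulr_ge0 ?ltW.
under eq_eseriesr => m _.
  rewrite (eq_integral (fun z : measurableTypeR R => (2 ^+ d * (`|z : R| * (2 ^+ m < `|z : R|)%R%:R))%:E)); last first.
    by move=> z _; rewrite /psi2 int_box// mulr_ge0.
  over.
rewrite -integral_nneseries//; last first.
  by move=> m; apply/measurable_EFinP; apply: measurable_funM.
apply: (@le_trans _ _ (\int[lambda]_z ((2 ^+ d * keps)%:E * (`|z : R| `^ (1 + eps))%:E))%E).
  apply: le_integral_ge0 => z.
    by apply: nneseries_ge0 => m _ _; rewrite lee_fin !mulr_ge0// exprn_ge0.
  under eq_eseriesr do rewrite mulrA EFinM.
  rewrite nneseriesZl//.
  apply: (le_trans (lee_wpmul2l _ (dyadic_count _))).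
    by rewrite lee_fin mulr_ge0// exprn_ge0.
  rewrite -!EFinM lee_fin; case: ltP => z1; last first.
    by rewrite mul0r mulr0 !mulr_ge0 ?exprn_ge0 ?powR_ge0.
  have z0 : 0 < `|z : R| := lt_trans ltr01 z1.
  rewrite mul1r -!mulrA ler_wpM2l ?exprn_ge0//.
  rewrite powRD; last by rewrite (gt_eqF z0) implybT.
  rewrite (powRr1 (ltW z0)) mulrCA ler_pM2l//.
  rewrite /keps mulrDl mul1r lerD//.
    by rewrite -[leLHS](powRr0 `|z : R|) ler_powR// ltW.
  have h : eps * ln `|z : R| <= `|z : R| `^ eps.
    by rewrite -ln_powR; apply/ltW/ln_sublinear; rewrite powR_gt0.
  by rewrite invfM mulrAC ler_pM2r ?invr_gt0// ler_pdivlMl.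
rewrite ge0_integralZl_EFin//; last by rewrite mulr_ge0// exprn_ge0.
by rewrite [leRHS]EFinM /ceps fineK// ge0_fin_numE// integral_ge0// => z _; rewrite lee_fin powR_ge0.
Qed.

Definition slab_const : R := 2 ^+ d * c + 1 + (2 * (2 ^+ d * c) + 2 ^+ d * keps * ceps).

(** [B] dominates a maximal function, the supremum over m of the averages of the marks over the
    dyadic cubes, by the sum over m of squared deviations and of large marks. One variable thus
    serves all levels, and its mean is bounded uniformly in j. *)
Lemma slab_majorant (j : nat) : exists B : Omega -> \bar R,
  [/\ measurable_fun setT B, forall w, (0 <= B w)%E,
      (\int[P]_w B w <= slab_const%:E)%E &
      forall w m, (window_sum j%:R j.+1%:R
        (fun x z => ((volRd x <= 4 ^+ m)%R%:R * `|z : R|)%R) w <= (4 ^+ m)%:E * B w)%E].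
Proof.
have j0 : 0 <= j%:R :> R by [].
have jj : j%:R <= j.+1%:R :> R by rewrite ler_nat.
have j1 : j.+1%:R - j%:R = 1 :> R by rewrite -natr1 addrAC subrr add0r.
pose S1 m := window_sum j%:R j.+1%:R (psi1 m).
pose S2 m := window_sum j%:R j.+1%:R (psi2 m).
pose D m w := ((S1 m w - (e1 m)%:E) * (S1 m w - (e1 m)%:E))%E.
have S10 m w : (0 <= S1 m w)%E by exact: window_sum_ge0.
have S20 m w : (0 <= S2 m w)%E by exact: window_sum_ge0.
have D0 m w : (0 <= D m w)%E by exact: sqr_deviation_ge0.
have mS2 m : measurable_fun setT (S2 m) by exact: measurable_window_sum.
have mD m : measurable_fun setT (D m) by exact: measurable_sqr_deviation.
have mDS m : measurable_fun setT (fun w => D m w + S2 m w)%E by exact: emeasurable_funD.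
have DS0 m w : (0 <= D m w + S2 m w)%E by rewrite adde_ge0.
have k0 : 0 <= 2 ^+ d * c + 1 by rewrite addr_ge0// mulr_ge0// exprn_ge0.
exists (fun w => (2 ^+ d * c + 1)%:E + \sum_(m <oo) (D m w + S2 m w))%E; split.
- by apply: emeasurable_funD => //; apply: ge0_emeasurable_sum.
- by move=> w; rewrite adde_ge0 ?lee_fin// nneseries_ge0.
- rewrite ge0_integralD//; last 2 first.
  + by move=> w _; exact: nneseries_ge0.
  + by apply: ge0_emeasurable_sum.
  rewrite integral_probability_cst [leRHS]EFinD leeD2l//.
  rewrite integral_nneseries//.
  rewrite (eq_eseriesr (g := fun m => (\int[P]_w D m w + \int[P]_w S2 m w)%E)); last first.
    by move=> m _; rewrite ge0_integralD.
  rewrite nneseriesD; [|by move=> m _ _; exact: integral_ge0..].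
  rewrite [leRHS]EFinD leeD//.
    apply: (@le_trans _ _ (\sum_(m <oo) ((2 ^+ d * c)%:E * (2^-1 ^+ m)%:E))%E).
      apply: lee_nneseries => [m _ _|m _]; first exact: integral_ge0.
      have := window_variance j0 jj (mpsi1 m) (psi1_ge0 m) (e := e1 m).
      by rewrite j1 !mul1e => /(_ (e1E m)) ->.
    rewrite nneseriesZl// geometric_half_eseries -EFinM lee_fin mulrC.
    by rewrite lexx.
  apply: le_trans sum_psi2.
  apply: lee_nneseries => [m _ _|m _]; first exact: integral_ge0.
  by rewrite (window_mean j0 jj (mpsi2 m) (psi2_ge0 m)) j1 mul1e.
move=> w m.
apply: (@le_trans _ _ ((4 ^+ m)%:E * (S1 m w + S2 m w))%E); last first.
  rewrite lee_wpmul2l ?lee_fin ?exprn_ge0//.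
  apply: (@le_trans _ _ ((2 ^+ d * c + 1)%:E + (D m w + S2 m w))%E).
    rewrite addeA leeD2r//; apply: (le_trans (deviation_bound (e1 m) (S10 m w))).
    by rewrite leeD2r// lee_fin lerD2r.
  rewrite leeD2l// (nneseriesD1 (n := m))//.
  by rewrite leeDl// nneseries_ge0.
rewrite /S1 /S2 /window_sum -nneseriesD; last 2 first.
- by move=> i _ _; rewrite lee_fin mulr_ge0.
- by move=> i _ _; rewrite lee_fin mulr_ge0.
rewrite -nneseriesZl; last first.
  by move=> i _; rewrite adde_ge0// lee_fin mulr_ge0.
apply: lee_nneseries => [i _ _|i _]; first by rewrite lee_fin !mulr_ge0.
rewrite -EFinD -EFinM lee_fin.
rewrite -mulrDr [leRHS]mulrCA ler_wpM2l//.
rewrite /psi1 /psi2 -mulrDr -mulrDr.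
have -> : (`|(p i w).2 : R| <= 2 ^+ m)%R%:R + (2 ^+ m < `|(p i w).2 : R|)%R%:R = 1 :> R.
  by case: leP => _; rewrite ?addr0 ?add0r.
by rewrite mulr1 !mulrA exprVn mulfV ?expf_neq0// mul1r.
Qed.

End old_slabs.
End noise_points.

(** * Points less than two time units old *)

Section recent_points.
Context {R : realType} {d : nat}.
Hypothesis d0 : (0 < d)%N.
Context {disp : measure_display} {Omega : measurableType disp}.
Context (P : probability Omega R).
Notation MS := (marked_spacetime R d).
Context (p : nat -> {mfun Omega >-> MS}).
Context (lambda : {measure set (measurableTypeR R) -> \bar R}).
Hypothesis lambda0 : lambda [set 0] = 0%E.
Hypothesis lambda1 : (\int[lambda]_z (`|z : R|)%:E < +oo)%E.
Hypothesis hN : poisson_random_measure P (noise_intensity lambda)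
  (fun w => counting_measure_of_points (p^~ w)).
Hypothesis lambda_log : (\int[lambda]_(z in `[(-1)%R, 1%R])
  (`|(z : R) * ln `|(z : R)| |)%:E < +oo)%E.

Let c := jump_mean lambda.
Let c0 : 0 <= c := jump_mean_ge0 lambda.

Let ell (z : measurableTypeR R) : R :=
  (-1 <= (z : R) <= 1)%R%:R * `|(z : R) * ln `|(z : R)| |.

Let clog : R := fine (\int[lambda]_z (ell z)%:E)%E.

Let ell_ge0 z : 0 <= ell z.
Proof. exact: mulr_ge0. Qed.

Let int_ell : (\int[lambda]_z (ell z)%:E = clog%:E)%E.
Proof.
rewrite fineK// ge0_fin_numE; last by apply: integral_ge0 => z _; rewrite lee_fin.
apply: le_lt_trans lambda_log; rewrite [leRHS]integral_mkcond.
apply: le_integral_ge0 => z; first by rewrite lee_fin.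
rewrite patchE mem_setE in_itv/= /ell; case: ifP => _; rewrite ?mul1r//.
by rewrite mul0r.
Qed.

Let clog_ge0 : 0 <= clog.
Proof. by rewrite -lee_fin -int_ell; apply: integral_ge0 => z _; rewrite lee_fin. Qed.

Let mell : measurable_fun setT (fun z => (ell z)%:E).
Proof.
apply/measurable_EFinP; apply: measurable_funM.
  by apply: measurable_natr_bool; apply: measurable_and; exact: measurable_fun_ler.
apply: measurableT_comp => //; apply: measurable_funM => //.
by apply: (measurableT_comp (@measurable_ln R)).
Qed.

Section window.
Context (a b F : R).
Hypotheses (a0 : 0 <= a) (ab : a <= b) (F1 : 1 <= F).

Let F0 : 0 < F := lt_le_trans ltr01 F1.

(* the jumps which alone contribute more than F *)
Let psir (x : Rd R d) (z : measurableTypeR R) : R := (volRd x <= `|z : R| / F)%R%:R.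

Let near (x : Rd R d) (z : measurableTypeR R) : R :=
  (`|z : R| / F < volRd x <= 1)%R%:R / volRd x.

Let far (x : Rd R d) (z : measurableTypeR R) : R :=
  (Num.max (`|z : R| / F) 1 < volRd x)%R%:R / volRd x ^+ 2.

(** A bound on the contribution of a point free of its scale V, valid for 0 < V <= 2^d, which holds
    for ages up to 4: the kernel is at most 1 / v in the unit cube and V / v^2 <= 2^d / v^2
    outside. *)
Let psih (x : Rd R d) (z : measurableTypeR R) : R :=
  `|z : R| * (near x z + 2 ^+ d * far x z).

Let mnz : measurable_fun setT (fun q : Rd R d * measurableTypeR R => `|q.2 : R|).
Proof. by apply: (@measurableT_comp _ _ _ _ _ _ (@Num.norm _ R)) => //; exact: measurable_snd. Qed.

Let mv : measurable_fun setT (fun q : Rd R d * measurableTypeR R => volRd q.1).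
Proof. by apply: (measurableT_comp (@measurable_volRd R d)); exact: measurable_fst. Qed.

Let mzF : measurable_fun setT (fun q : Rd R d * measurableTypeR R => `|q.2 : R| / F).
Proof. by apply: measurable_funM. Qed.

Let mpsir : measurable_fun setT (fun q => psir q.1 q.2).
Proof. by apply: measurable_natr_bool; exact: measurable_fun_ler. Qed.

Let mpsih : measurable_fun setT (fun q => psih q.1 q.2).
Proof.
apply: measurable_funM => //; apply: measurable_funD; last apply: measurable_funM => //.
  apply: measurable_funM; last exact: measurable_funV.
  apply: measurable_natr_bool; apply: measurable_and; first exact: measurable_fun_ltr.
  exact: measurable_fun_ler.
apply: measurable_funM; last by apply: measurable_funV; exact: measurable_funX.
by apply: measurable_natr_bool; apply: measurable_fun_ltr => //; exact: measurable_maxr.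
Qed.

Let psir0 x z : 0 <= psir x z. Proof. exact: ler0n. Qed.

Let near0 x z : 0 <= near x z.
Proof. by rewrite divr_ge0// volRd_ge0. Qed.

Let far0 x z : 0 <= far x z.
Proof. by rewrite divr_ge0// exprn_ge0// volRd_ge0. Qed.

Let psih0 x z : 0 <= psih x z.
Proof. by rewrite mulr_ge0// addr_ge0// mulr_ge0// exprn_ge0. Qed.

Let int_psir :
  (\int[lambda]_z \int[lebesgue_measureRd R d]_x (psir x z)%:E = (2 ^+ d * c / F)%:E)%E.
Proof.
rewrite (eq_integral (fun z : measurableTypeR R => ((2 ^+ d / F)%:E * (`|z : R|)%:E)%E)); last first.
  move=> z _; rewrite /psir integral_volRd_le//; last by rewrite divr_ge0// ltW.
  by rewrite -EFinM mulrAC -mulrA.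
rewrite ge0_integralZl_EFin//; last 2 first.
- exact: measurable_normz.
- by rewrite divr_ge0 ?exprn_ge0// ltW.
by rewrite (integral_jump_mean lambda1) -EFinM mulrAC.
Qed.

(** The mean of [psih] per unit of time and of F. The terms of that mean which do not grow with F
    are absorbed by 1 <= F. *)
Definition recent_mean : R :=
  40 * 2 ^+ d * (c + (c + clog) / ln 2) + 2 ^+ d * (16 * 2 ^+ d) * c.

Let int_near (z : R) : z != 0 ->
  (\int[lebesgue_measureRd R d]_x (near x z)%:E <=
    (40 * 2 ^+ d * ((1 < F / `|z|)%R%:R * (1 + ln (F / `|z|) / ln 2)))%:E)%E.
Proof.
move=> z0; have zF0 : 0 < `|z| / F by rewrite divr_gt0// normr_gt0.
by have := integral_volRd_near d0 zF0; rewrite invf_div.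
Qed.

Let int_far (z : R) :
  (\int[lebesgue_measureRd R d]_x (far x z)%:E <= (16 * 2 ^+ d)%:E)%E.
Proof.
have m0 : 0 < Num.max (`|z| / F) 1 by rewrite lt_max ltr01 orbT.
apply: (le_trans (integral_volRd_tail d0 m0)); rewrite lee_fin.
by rewrite ler_piMr ?mulr_ge0 ?exprn_ge0// invf_le1// le_max lexx orbT.
Qed.

(** Write ln (F / |z|) = ln F - ln |z|. The crude bound ln F <= F is enough, and - |z| ln |z| is
    positive only for |z| < 1, the range of the logarithmic condition. *)
Let near_log (z : R) : z != 0 ->
  `|z| * ((1 < F / `|z|)%R%:R * (1 + ln (F / `|z|) / ln 2)) <=
  `|z| + (`|z| * F + ell z) / ln 2.
Proof.
have ln20 : 0 < ln 2 :> R by rewrite ln_gt0// ltr1n.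
move=> z0; have nz0 : 0 < `|z| by rewrite normr_gt0.
have r0 : 0 <= `|z| + (`|z| * F + ell z) / ln 2.
  by rewrite addr_ge0// divr_ge0 ?(ltW ln20)// addr_ge0// mulr_ge0// ltW.
case: ltP => zF; last by rewrite mul0r mulr0.
rewrite mul1r mulrDr mulr1 lerD2l mulrA ler_pM2r ?invr_gt0//.
rewrite ln_div ?posrE// mulrBr lerD//.
  by rewrite ler_pM2l// ltW// ln_sublinear.
rewrite /ell; case: (boolP (-1 <= z <= 1)) => z1.
  by rewrite mul1r normrM -mulrN ler_wpM2l// ler_normr lexx orbT.
rewrite mul0r oppr_le0 mulr_ge0// ln_ge0//.
by move: z1; rewrite -ler_norml -ltNge => /ltW.
Qed.

Let int_psih_x (z : R) :
  (\int[lebesgue_measureRd R d]_x (psih x z)%:E <=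
   (40 * 2 ^+ d * (`|z| + (`|z| * F + ell z) / ln 2) +
    2 ^+ d * (16 * 2 ^+ d) * `|z|)%:E)%E.
Proof.
have mn : measurable_fun setT (fun x => near x z).
  apply: (measurable_volRd_near (`|z| / F)).
have mf : measurable_fun setT (fun x => far x z).
  exact: (measurable_volRd_tail (Num.max (`|z| / F) 1)).
have [->|z0] := eqVneq z 0.
  rewrite integral0_eq; last by move=> x _; rewrite /psih normr0 mul0r.
  rewrite normr0 lee_fin mulr0 addr0 mul0r !add0r.
  apply: mulr_ge0; first by rewrite mulr_ge0 ?exprn_ge0.
  by apply: divr_ge0; [exact: ell_ge0|rewrite ln_ge0 ?ler1n].
rewrite (eq_integral (fun x => (`|z|)%:E * ((near x z)%:E + (2 ^+ d)%:E * (far x z)%:E))%E)//.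
rewrite ge0_integralZl_EFin//; last 2 first.
- by move=> x _; rewrite adde_ge0 ?mule_ge0 ?lee_fin ?exprn_ge0.
- apply: emeasurable_funD; first exact/measurable_EFinP.
  by apply: measurable_funeM; exact/measurable_EFinP.
rewrite ge0_integralD//; last 4 first.
- by move=> x _; rewrite lee_fin.
- exact/measurable_EFinP.
- by move=> x _; rewrite mule_ge0 ?lee_fin ?exprn_ge0.
- by apply: measurable_funeM; exact/measurable_EFinP.
rewrite ge0_integralZl_EFin ?exprn_ge0//; last 2 first.
- by move=> x _; rewrite lee_fin.
- exact/measurable_EFinP.
apply: (@le_trans _ _ (`|z|%:E * ((40 * 2 ^+ d *
    ((1 < F / `|z|)%R%:R * (1 + ln (F / `|z|) / ln 2)))%:E +
    (2 ^+ d)%:E * (16 * 2 ^+ d)%:E))%E).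
  apply: lee_wpmul2l; first by rewrite lee_fin.
  apply: leeD; first exact: int_near.
  by apply: lee_wpmul2l; [rewrite lee_fin exprn_ge0|exact: int_far].
rewrite -?EFinM -?EFinD -?EFinM lee_fin mulrDr lerD//; last by rewrite mulrC.
by rewrite mulrCA ler_wpM2l ?mulr_ge0 ?exprn_ge0// near_log.
Qed.

Let int_psih :
  (\int[lambda]_z \int[lebesgue_measureRd R d]_x (psih x z)%:E <= (recent_mean * F)%:E)%E.
Proof.
have ln20 : 0 < ln 2 :> R by rewrite ln_gt0// ltr1n.
pose u : R := 40 * 2 ^+ d * (1 + F / ln 2) + 2 ^+ d * (16 * 2 ^+ d).
pose v : R := 40 * 2 ^+ d / ln 2.
have u0 : 0 <= u.
  have q0 : 0 <= F / ln 2 by rewrite divr_ge0 ?(ltW ln20) ?(ltW F0).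
  by rewrite /u addr_ge0 ?mulr_ge0 ?exprn_ge0// addr_ge0.
have v0 : 0 <= v by rewrite divr_ge0 ?mulr_ge0 ?exprn_ge0 ?(ltW ln20).
apply: (@le_trans _ _ (\int[lambda]_z (u%:E * (`|z : R|)%:E + v%:E * (ell z)%:E))%E).
  apply: le_integral_ge0 => z; first by apply: integral_ge0 => x _; rewrite lee_fin.
  apply: (le_trans (int_psih_x z)); rewrite -!EFinM -EFinD lee_fin le_eqVlt.
  by apply/orP; left; apply/eqP; rewrite /u /v; field; rewrite gt_eqF.
rewrite ge0_integralD//; last 4 first.
- by move=> z _; rewrite mule_ge0 ?lee_fin.
- by apply: measurable_funeM; exact: measurable_normz.
- by move=> z _; rewrite mule_ge0 ?lee_fin.
- exact: measurable_funeM.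
rewrite !ge0_integralZl_EFin//; [|by move=> z _; rewrite lee_fin|exact: measurable_normz].
rewrite (integral_jump_mean lambda1) int_ell -!EFinM -EFinD lee_fin /recent_mean -/c.
have cF : c <= c * F by rewrite ler_peMr.
have clF : clog <= clog * F by rewrite ler_peMr.
have vc : v * clog <= v * (clog * F) by rewrite ler_wpM2l.
rewrite (_ : (_ + _) * F = 40 * 2 ^+ d * (c * F) + v * (c * F + clog * F) +
   2 ^+ d * (16 * 2 ^+ d) * (c * F)); last by rewrite /v; field; rewrite gt_eqF.
rewrite (_ : u * c = 40 * 2 ^+ d * c + v * (c * F) + 2 ^+ d * (16 * 2 ^+ d) * c); last first.
  by rewrite /u /v; field; rewrite gt_eqF.
have h1 : 40 * 2 ^+ d * c <= 40 * 2 ^+ d * (c * F).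
  by rewrite ler_wpM2l ?mulr_ge0 ?exprn_ge0.
have h2 : 2 ^+ d * (16 * 2 ^+ d) * c <= 2 ^+ d * (16 * 2 ^+ d) * (c * F).
  by rewrite ler_wpM2l ?mulr_ge0 ?exprn_ge0.
lra.
Qed.

Let psih_le x z : psih x z <= 2 ^+ d * `|z : R| * ((`|z : R| / F < volRd x)%R%:R / volRd x).
Proof.
rewrite mulrAC mulrC /psih ler_wpM2l// /near /far.
have d1 : 1 <= 2 ^+ d :> R by rewrite exprn_ege1// ler1n.
rewrite gt_max; case: (ltP (`|z : R| / F) (volRd x)) => /= zv; last first.
  by rewrite !(mul0r, mulr0, addr0).
have v0 : 0 < volRd x by apply: le_lt_trans zv; rewrite divr_ge0// ltW.
move: (volRd x) zv v0 => v zv v0.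
case: leP => v1; rewrite ?mul0r ?mulr0 ?addr0 ?add0r !mul1r.
  by rewrite ler_peMl// invr_ge0 ltW.
rewrite ler_wpM2l ?exprn_ge0// lef_pV2 ?posrE ?exprn_gt0//.
by rewrite expr2 ler_peMl// ltW.
Qed.

(** Removing the points with v <= |z| / F makes the variance finite: the integral of z^2 / v^2 over
    v > |z| / F is of order F |z|, so the first moment of the marks suffices. *)
Let int_psih_sqr :
  (\int[lambda]_z \int[lebesgue_measureRd R d]_x (psih x z ^+ 2)%:E
   <= (16 * 8 ^+ d * c * F)%:E)%E.
Proof.
apply: (@le_trans _ _ (\int[lambda]_z ((16 * 8 ^+ d * F)%:E * (`|z : R|)%:E))%E).
  apply: le_integral_ge0 => z.
    by apply: integral_ge0 => x _; rewrite lee_fin sqr_ge0.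
  have [->|z0] := eqVneq z (0 : R).
    by rewrite integral0_eq ?normr0 ?mule0// => x _; rewrite /psih normr0 mul0r expr0n.
  have zF0 : 0 < `|z : R| / F by rewrite divr_gt0// normr_gt0.
  apply: (@le_trans _ _ (\int[lebesgue_measureRd R d]_x (((2 ^+ d * `|z : R|) ^+ 2)%:E *
      ((`|z : R| / F < volRd x)%R%:R / volRd x ^+ 2)%:E))%E).
    apply: le_integral_ge0 => x; first by rewrite lee_fin sqr_ge0.
    rewrite -EFinM lee_fin.
    apply: (@le_trans _ _ ((2 ^+ d * `|z : R| * ((`|z : R| / F < volRd x)%R%:R / volRd x)) ^+ 2)).
      by rewrite ler_sqr ?nnegrE// (le_trans (psih0 x z)).
    rewrite exprMn ler_wpM2l ?sqr_ge0// expr_div_n.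
    by case: (_ < _); rewrite ?expr1n ?expr0n.
  rewrite ge0_integralZl_EFin ?sqr_ge0//; last 2 first.
  - by move=> x _; rewrite lee_fin divr_ge0 ?sqr_ge0.
  - by apply/measurable_EFinP; exact: measurable_volRd_tail.
  apply: (le_trans (lee_wpmul2l _ (integral_volRd_tail d0 zF0))); first by rewrite lee_fin sqr_ge0.
  rewrite -!EFinM lee_fin le_eqVlt; apply/orP; left; apply/eqP.
  rewrite (_ : 8 = 2 * 2 * 2 :> R) ?exprMn; last by rewrite -!natrM.
  by field; rewrite normr_eq0 z0 gt_eqF.
rewrite ge0_integralZl_EFin//; last 2 first.
- exact: measurable_normz.
- by rewrite !mulr_ge0 ?exprn_ge0// ltW.
by rewrite (integral_jump_mean lambda1) -EFinM lee_fin mulrAC.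
Qed.

Let kernel_le_psih (V : R) x z : 0 < V <= 2 ^+ d -> `|z : R| / F < volRd x ->
  volume_kernel V (volRd x) * `|z : R| <= psih x z.
Proof.
move=> /andP[V0 V2] zv.
have v0 : 0 < volRd x by apply: le_lt_trans zv; rewrite divr_ge0// ltW.
rewrite mulrC ler_wpM2l// /near /far gt_max zv /=.
case: leP => v1; rewrite ?mul0r ?mulr0 ?addr0 ?add0r !mul1r.
  exact: volume_kernel_le_inv.
apply: (le_trans (volume_kernel_le_square V0 v0)).
by rewrite ler_wpM2r// invr_ge0 sqr_ge0.
Qed.

(** Chebyshev's inequality and the exclusion of exceptional points in one variable: if G < 1, then
    no point has v <= |z| / F, as each would count 1, and the squared deviation is below F^2. The
    mean of G is of order 1 / F. The scales [V] are arbitrary after G, so one event covers all times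
    of a unit interval. *)
Lemma recent_majorant : exists G : Omega -> \bar R,
  [/\ measurable_fun setT G, forall w, (0 <= G w)%E,
      (\int[P]_w G w <= ((b - a) * (2 ^+ d * c + 16 * 8 ^+ d * c) / F)%:E)%E &
      forall w, (G w < 1)%E -> forall V : nat -> R, (forall i, 0 < V i <= 2 ^+ d) ->
        (\sum_(i <oo) (in_window a b (p i w) *
           (volume_kernel (V i) (volRd (p i w).1.2) * `|(p i w).2 : R|)%R)%:E
         <= (((b - a) * recent_mean + 1) * F)%:E)%E].
Proof.
have ba0 : 0 <= b - a by rewrite subr_ge0.
pose e : R := fine ((b - a)%:E *
  \int[lambda]_z \int[lebesgue_measureRd R d]_x (psih x z)%:E)%E.
have int0 : (0 <= \int[lambda]_z \int[lebesgue_measureRd R d]_x (psih x z)%:E)%E.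
  by do 2 apply: integral_ge0 => ? _; rewrite lee_fin.
have eE : ((b - a)%:E *
    \int[lambda]_z \int[lebesgue_measureRd R d]_x (psih x z)%:E = e%:E)%E.
  rewrite fineK// ge0_fin_numE ?mule_ge0 ?lee_fin// lte_mul_pinfty ?lee_fin//.
  exact: le_lt_trans int_psih (ltry _).
have e_le : e <= (b - a) * (recent_mean * F).
  rewrite -lee_fin -eE EFinM; apply: lee_wpmul2l; first by rewrite lee_fin.
  exact: int_psih.
pose N := window_sum p a b psir.
pose S := window_sum p a b psih.
pose D w := ((S w - e%:E) * (S w - e%:E))%E.
have N0 w : (0 <= N w)%E by exact: window_sum_ge0.
have S0 w : (0 <= S w)%E by exact: window_sum_ge0.
have D0 w : (0 <= D w)%E by exact: sqr_deviation_ge0.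
have mN : measurable_fun setT N by exact: measurable_window_sum.
have mD : measurable_fun setT D by exact: measurable_sqr_deviation.
have F20 : 0 <= F ^- 2 by rewrite invr_ge0 sqr_ge0.
exists (fun w => N w + (F ^- 2)%:E * D w)%E; split.
- by apply: emeasurable_funD => //; exact: measurable_funeM.
- by move=> w; rewrite adde_ge0// mule_ge0.
- rewrite ge0_integralD//; last 2 first.
  + by move=> w _; rewrite mule_ge0.
  + exact: measurable_funeM.
  rewrite ge0_integralZl_EFin//.
  rewrite (window_mean lambda0 lambda1 hN a0 ab mpsir psir0) int_psir.
  rewrite (window_variance lambda0 lambda1 hN a0 ab mpsih psih0 eE).
  apply: (@le_trans _ _ ((b - a)%:E * (2 ^+ d * c / F)%:E +
      (F ^- 2)%:E * ((b - a)%:E * (16 * 8 ^+ d * c * F)%:E))%E).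
    apply: leeD => //; apply: lee_wpmul2l; first by rewrite lee_fin.
    by apply: lee_wpmul2l; [rewrite lee_fin|exact: int_psih_sqr].
  rewrite -?EFinM -?EFinD lee_fin le_eqVlt; apply/orP; left; apply/eqP.
  by field; rewrite gt_eqF.
move=> w Gw V V2.
have N1 : (N w < 1)%E.
  by apply: le_lt_trans Gw; rewrite leeDl// mule_ge0.
have DF : (D w < (F ^+ 2)%:E)%E.
  have : ((F ^- 2)%:E * D w < 1)%E by apply: le_lt_trans Gw; rewrite leeDr.
  by rewrite lte_pdivrMl ?exprn_gt0// mule1.
have SF : (S w < (e + F)%:E)%E by exact: deviation_lt.
apply: (@le_trans _ _ (S w)); last first.
  by apply: (le_trans (ltW SF)); rewrite lee_fin mulrDl mul1r lerD2r -mulrA.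
apply: lee_nneseries => [i _ _|i _].
  rewrite lee_fin; do 2 apply: mulr_ge0 => //.
  by apply: volume_kernel_ge0; case/andP: (V2 i) => /ltW.
rewrite lee_fin /in_window; case: (boolP (_ < _ <= _)) => wi; last by rewrite !mul0r.
rewrite !mul1r; apply: kernel_le_psih => //; rewrite ltNge; apply/negP => vz.
move: N1; rewrite ltNge => /negP; apply; rewrite /N /window_sum.
rewrite (nneseriesD1 (n := i))//; last by move=> k _; rewrite lee_fin mulr_ge0.
rewrite /in_window wi /psir vz mul1r leeDl// nneseries_ge0//.
Qed.

End window.
End recent_points.

(** * Series of inverses of a nondecreasing function *)

Section series_lemmas.
Context {R : realType}.

Lemma kronecker (a F : nat -> R) :
  (forall n, 0 <= a n) -> (forall n, 0 < F n) ->
  (forall m n, (m <= n)%N -> F m <= F n) ->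
  (forall M : R, exists n, M <= F n) ->
  (\sum_(n <oo) (a n / F n)%:E < +oo)%E ->
  forall e : R, 0 < e ->
    exists n0, forall n, (n0 <= n)%N -> \sum_(0 <= k < n) a k <= e * F n.
Proof.
move=> a0 F0 Fle Foo aF e e0.
have t0 n : (0 <= (a n / F n)%:E)%E by rewrite lee_fin divr_ge0// ltW.
have := nneseries_tail_cvg aF (fun n _ => t0 n).
move=> /fine_cvgP[_ /cvgrPdist_lt /(_ (e / 2))].
rewrite divr_gt0// => /(_ isT)[N1 _ hN1].
have [N2 hN2] := Foo ((\sum_(0 <= k < N1) a k) / (e / 2)).
exists (maxn N1 N2) => n; rewrite geq_max => /andP[n1 n2].
rewrite (@big_cat_nat _ _ _ N1)//=.
rewrite [leRHS](_ : _ = e / 2 * F n + e / 2 * F n); last by field.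
apply: lerD.
  by rewrite -ler_pdivrMl ?divr_gt0// mulrC (le_trans hN2)// Fle.
have hs : \sum_(N1 <= k < n) a k / F k <= e / 2.
  have := hN1 N1 (leqnn _); rewrite /= sub0r normrN => h.
  have tl : (\sum_(N1 <= k <oo) (a k / F k)%:E)%E \is a fin_num.
    rewrite ge0_fin_numE ?nneseries_ge0//; apply: le_lt_trans aF.
    by rewrite (nneseries_split 0 N1)//= add0n leeDr// sume_ge0.
  apply: le_trans (ltW h); apply: le_trans (ler_norm _).
  rewrite -lee_fin fineK// -sumEFin; exact: nneseries_lim_ge.
apply: (@le_trans _ _ (\sum_(N1 <= k < n) a k / F k * F n)).
  rewrite big_nat [leRHS]big_nat; apply: ler_sum => k /andP[_ kn].
  by rewrite -[leLHS](divfK (lt0r_neq0 (F0 k))) ler_wpM2l ?divr_ge0 ?Fle ?(ltW (F0 k))// ltnW.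
by rewrite -mulr_suml ler_wpM2r// ltW.
Qed.

Lemma near_dyadic_level (y : R) : 1 <= y ->
  exists m, y <= 4 ^+ m /\ 4 ^+ m <= 4 * y.
Proof.
move=> y1; have ex : exists m, y <= 4 ^+ m.
  exists (Num.Def.archi_bound y); apply: ltW.
  apply: (lt_le_trans (archi_boundP _)); first exact: le_trans y1.
  by rewrite -natrX ler_nat ltnW// ltn_expl.
have [m ym mmin] := ex_minnP ex; exists m; split => //.
case: m ym mmin => [|m] ym mmin; first by rewrite expr0; lra.
by rewrite exprS ler_pM2l// leNgt; apply/negP => /ltW /mmin; rewrite ltnn.
Qed.

Section inverse_integral.
Context (f : R -> R).
Hypothesis f0 : forall t, 0 < t -> 0 < f t.
Hypothesis fle : forall s t, 0 < s -> s <= t -> f s <= f t.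

Let u (t : R) : \bar R := (1 / f t)%:E.
Let I n : set (measurableTypeR R) := `[n.+1%:R, n.+2%:R[%classic.

Let mI n : measurable (I n).
Proof. exact: measurable_itv. Qed.

Let IE : `[1, +oo[%classic = \bigcup_n I n :> set (measurableTypeR R).
Proof.
apply/seteqP; split => [t /=|t [n _] +] /=; rewrite in_itv/= ?andbT.
  move=> t1; have /truncn_itv/andP[n1 n2] : 0 <= t by rewrite (le_trans ler01).
  have : (0 < Num.truncn t)%N.
    by rewrite -ltnS -(ltr_nat R); apply: le_lt_trans n2.
  case E : (Num.truncn t) n1 n2 => [//|n] n1 n2 _; exists n => //.
  by rewrite /I /= in_itv/= n1 n2.
by rewrite /I /= in_itv/= => /andP[+ _]; apply: le_trans; rewrite ler1n.
Qed.

Let I_le n t : I n t -> n.+1%:R <= t /\ t < n.+2%:R.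
Proof. by rewrite /I /= in_itv/= => /andP[]. Qed.

Let I_pos n t : I n t -> 0 < t.
Proof. by move=> /I_le[+ _]; apply: lt_le_trans. Qed.

Let mu_I n : lebesgue_measure (I n) = 1%:E.
Proof.
transitivity (lebesgue_measure (`[n.+1%:R, n.+2%:R[%classic : set R)) => //.
by rewrite lebesgue_measure_itv/= lte_fin ltr_nat ltnSn -EFinB -natrB// subSnn.
Qed.

Let measurable_inv_f (D : set (measurableTypeR R)) :
  measurable D -> D `<=` `[1, +oo[%classic -> measurable_fun D u.
Proof.
move=> mD D1; apply/measurable_EFinP.
(* [f] is monotone on positive arguments only; the truncation gives a function monotone on the whole
   line. *)
apply: (@eq_measurable_fun _ _ _ _ _ (fun t : R => 1 / f (Num.max 1 t))).
  move=> t; rewrite inE => /D1 /=; rewrite in_itv/= andbT => t1.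
  by rewrite max_r.
apply: nonincreasing_measurable => // s t st.
have m0 x : 0 < Num.max 1 x :> R by rewrite lt_max ltr01.
rewrite !div1r lef_pV2 ?posrE ?f0 ?fle//.
by rewrite ge_max !le_max lexx /= st orbT.
Qed.

Let int_split : (\int[lebesgue_measure]_(t in `[1%R, +oo[) u t =
  \sum_(n <oo) \int[lebesgue_measure]_(t in I n) u t)%E.
Proof.
rewrite [X in integral _ X _]IE ge0_integral_bigcup//.
- by apply: measurable_inv_f; rewrite -IE//; exact: measurable_itv.
- by move=> t [n _ /I_pos t0]; rewrite lee_fin divr_ge0// ltW// f0.
- apply/trivIsetP => i j _ _; rewrite neq_ltn => /orP[] ij; apply/seteqP; split => // t [].
    move=> /I_le[_ t1] /I_le[t2 _]; have := le_lt_trans t2 t1.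
    by rewrite ltr_nat ltnS leqNgt ltnS ij.
  move=> /I_le[t2 _] /I_le[_ t1]; have := le_lt_trans t2 t1.
  by rewrite ltr_nat ltnS leqNgt ltnS ij.
Qed.

Let mu_n n : measurable_fun (I n) u.
Proof.
by apply: measurable_inv_f => //; rewrite IE; exact: bigcup_sup.
Qed.

Lemma integral_inv_le : (\int[lebesgue_measure]_(t in `[1%R, +oo[) (1 / f t)%:E
  <= \sum_(n <oo) (1 / f n.+1%:R)%:E)%E.
Proof.
rewrite int_split; apply: lee_nneseries => [n _ _|n _].
  by apply: integral_ge0 => t /I_pos t0; rewrite lee_fin divr_ge0// ltW// f0.
apply: (@le_trans _ _ (\int[lebesgue_measure]_(t in I n) (1 / f n.+1%:R)%:E)%E).
  apply: ge0_le_integral => //.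
  - by move=> t /I_pos t0; rewrite lee_fin divr_ge0// ltW// f0.
  - by move=> t It; rewrite lee_fin !div1r lef_pV2 ?posrE ?f0 ?(I_pos It)// fle//; case: (I_le It).
by rewrite integral_cst// [X in (_ * X)%E](_ : _ = 1%:E) ?mule1//; exact: mu_I.
Qed.

Lemma integral_inv_ge : (\sum_(n <oo) (1 / f n.+2%:R)%:E
  <= \int[lebesgue_measure]_(t in `[1%R, +oo[) (1 / f t)%:E)%E.
Proof.
rewrite int_split; apply: lee_nneseries => [n _ _|n _].
  by rewrite lee_fin divr_ge0// ltW// f0.
apply: (@le_trans _ _ (\int[lebesgue_measure]_(t in I n) (1 / f n.+2%:R)%:E)%E).
  by rewrite integral_cst// [X in (_ * X)%E](_ : _ = 1%:E) ?mule1//; exact: mu_I.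
apply: ge0_le_integral => //.
- by move=> t _; rewrite lee_fin divr_ge0// ltW// f0.
- by move=> t It; rewrite lee_fin !div1r lef_pV2 ?posrE ?f0 ?(I_pos It)// fle// ?(I_pos It)//; case: (I_le It) => _ /ltW.
Qed.

End inverse_integral.

Section monotone_growth.
Context (F : nat -> R).
Hypothesis F0 : forall n, 0 < F n.
Hypothesis Fle : forall m n, (m <= n)%N -> F m <= F n.

Lemma summable_inv_unbounded : (\sum_(n <oo) (1 / F n)%:E < +oo)%E ->
  forall M : R, exists n, M <= F n.
Proof.
move=> sF M; apply: contrapT => /forallNP h.
have FM n : F n < M by rewrite ltNge; apply/negP/h.
have M0 : 0 < M := lt_trans (F0 0) (FM 0%N).
have [N hN] : exists N : nat, (\sum_(n <oo) (1 / F n)%:E < (N%:R)%:E)%E.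
  have : (\sum_(n <oo) (1 / F n)%:E)%E \is a fin_num.
    by rewrite ge0_fin_numE// nneseries_ge0// => n _ _; rewrite lee_fin divr_ge0// ltW.
  move=> /fineK <-; set s := fine _; exists (Num.Def.archi_bound s).
  by rewrite lte_fin; apply: archi_boundP; rewrite /s fine_ge0// nneseries_ge0// => n _ _; rewrite lee_fin divr_ge0// ltW.
have t0 n : (0 <= (1 / F n)%:E)%E by rewrite lee_fin divr_ge0// ltW.
have := le_lt_trans (@nneseries_lim_ge R (fun n => (1 / F n)%:E) xpredT 0%N
  (Num.Def.archi_bound M * N)%N (fun n _ _ => t0 n)) hN.
rewrite sumEFin lte_fin ltNge => /negP; apply.
apply: (@le_trans _ _ (\sum_(0 <= i < Num.Def.archi_bound M * N) M^-1)).
  rewrite big_const_nat subn0 iter_addr addr0 -[leRHS]mulr_natl natrM mulrAC.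
  rewrite ler_peMl// ler_pdivlMr// mul1r.
  exact/ltW/archi_boundP/ltW.
by apply: ler_sum => i _; rewrite div1r lef_pV2 ?posrE// ltW.
Qed.

(** Kronecker's lemma with constant numerators 1. It shows that the linear drift is negligible
    against f in (1b). *)
Lemma summable_inv_superlinear : (\sum_(n <oo) (1 / F n)%:E < +oo)%E ->
  forall e : R, 0 < e -> exists n0, forall n, (n0 <= n)%N -> n%:R <= e * F n.
Proof.
move=> sF e e0.
have [n0 h] := kronecker (fun=> ler01) F0 Fle (summable_inv_unbounded sF) sF e0.
exists n0 => n /h; rewrite big_const_nat subn0 iter_addr addr0.
by rewrite (_ : 1 *+ n = n%:R).
Qed.

End monotone_growth.

(* The truncation 1 / max (F n) (n + 2) is summable only if it is eventually
   1 / F n, since a summable nonincreasing sequence is o(1 / n). *)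
Lemma divergent_inv_max (F : nat -> R) :
  (forall n, 0 < F n) -> (forall m n, (m <= n)%N -> F m <= F n) ->
  (\sum_(n <oo) (1 / F n)%:E = +oo)%E ->
  (\sum_(n <oo) (1 / Num.max (F n) n.+2%:R)%:E = +oo)%E.
Proof.
move=> F0 Fle Foo; apply/eqP/negPn/negP; rewrite -ltey => h.
pose G n := Num.max (F n) n.+2%:R.
have G0 n : 0 < G n by rewrite lt_max F0.
have Gle m n : (m <= n)%N -> G m <= G n.
  move=> mn; rewrite ge_max !le_max Fle//=.
  by apply/orP; right; rewrite ler_nat !ltnS.
(* With 1 / 4 one gets G n >= 4 n > n + 2 for n >= 1, so the maximum defining G n must be F n. *)
have q0 : 0 < 4^-1 :> R by rewrite invr_gt0.
have [n0 hn] := summable_inv_superlinear G0 Gle h q0.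
have GF n : (n0.+1 <= n)%N -> G n = F n.
  move=> n0n; have := hn n (ltnW n0n); rewrite ler_pdivlMl// => nG.
  have n1 : 1 <= n%:R :> R by rewrite ler1n; exact: leq_ltn_trans n0n.
  rewrite /G max_l// leNgt; apply/negP => Fn.
  move: nG; rewrite /G max_r ?(ltW Fn)// -addn2 natrD; lra.
have : (\sum_(n <oo) (1 / F n)%:E < +oo)%E.
  have t0 n : (0 <= (1 / F n)%:E)%E by rewrite lee_fin divr_ge0// ltW.
  have g0 n : (0 <= (1 / G n)%:E)%E by rewrite lee_fin divr_ge0// ltW.
  rewrite (nneseries_split 0 n0.+1)// sumEFin lte_add_pinfty ?ltry//.
  rewrite add0n (_ : (\sum_(n0.+1 <= k <oo) _)%E = \sum_(n0.+1 <= k <oo) (1 / G k)%:E)%E.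
    have hs : (\sum_(n <oo) (1 / G n)%:E < +oo)%E := h.
    apply: le_lt_trans hs.
    rewrite (@nneseries_split _ (fun k => (1 / G k)%:E) 0 n0.+1)//.
    by rewrite leeDr// sume_ge0.
  apply: congr_lim; apply/funext => n; rewrite big_nat_cond [RHS]big_nat_cond.
  by apply: eq_bigr => k /andP[/andP[kn _] _]; rewrite GF.
by rewrite Foo ltxx.
Qed.

End series_lemmas.

(** * Smallness of the jump sum *)

Section almost_sure_bound.
Context {R : realType} {d : nat}.
Hypothesis d0 : (0 < d)%N.
Context {disp : measure_display} {Omega : measurableType disp}.
Notation MS := (marked_spacetime R d).
Context (p : nat -> {mfun Omega >-> MS}).

(** The cube of volume parameter 2^k V lies in one of level 4^m <= 4 * 2^k V. The k-th layer then
    costs (4 / V) 4^-k * 4 * 2^k V = 16 * 2^-k, and these add up to 32. *)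
Lemma window_sum_kernel_le (a b : R) (w : Omega) (B : \bar R) (V : R) :
  (0 <= B)%E -> 1 <= V ->
  (forall m, window_sum p a b
    (fun x z => ((volRd x <= 4 ^+ m)%R%:R * `|z : R|)%R) w <= (4 ^+ m)%:E * B)%E ->
  (window_sum p a b (fun x z => (volume_kernel V (volRd x) * `|z : R|)%R) w
    <= 32%:E * B)%E.
Proof.
move=> B0 V1 hB; have V0 : 0 < V := lt_le_trans ltr01 V1.
pose t i k : \bar R := (4 / V * 4^-1 ^+ k * (in_window a b (p i w) *
  ((volRd (p i w).1.2 <= 2 ^+ k * V)%R%:R * `|(p i w).2 : R|)))%:E.
have c0 k : 0 <= 4 / V * 4^-1 ^+ k by rewrite mulr_ge0 ?divr_ge0 ?exprn_ge0// ltW.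
have w0 i : 0 <= in_window a b (p i w) by exact: ler0n.
have t0 i k : (0 <= t i k)%E.
  by rewrite lee_fin; apply: mulr_ge0 => //; apply: mulr_ge0 => //; exact: mulr_ge0.
apply: (@le_trans _ _ (\sum_(i <oo) \sum_(k <oo) t i k)%E).
  apply: lee_nneseries => [i _ _|i _].
    rewrite lee_fin mulr_ge0// mulr_ge0//; apply: volume_kernel_ge0; exact: ltW.
  rewrite mulrCA mulrC EFinM.
  apply: (@le_trans _ _ ((in_window a b (p i w) * `|(p i w).2 : R|)%:E *
    \sum_(k <oo) (4 / V * 4^-1 ^+ k * (volRd (p i w).1.2 <= 2 ^+ k * V)%R%:R)%:E)%E).
    apply: lee_wpmul2l; first by rewrite lee_fin mulr_ge0.
    by apply: volume_kernel_dyadic => //; exact: volRd_ge0.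
  rewrite -nneseriesZl; last by move=> k _; rewrite lee_fin mulr_ge0.
  rewrite le_eqVlt; apply/orP; left; apply/eqP; apply: eq_eseriesr => k _.
  by rewrite -EFinM /t; congr EFin; ring.
rewrite nneseries_interchange//.
apply: (@le_trans _ _ (\sum_(k <oo) ((16 * 2^-1 ^+ k)%:E * B))%E).
  apply: lee_nneseries => [k _ _|k _]; first exact: nneseries_ge0.
  have kV1 : 1 <= 2 ^+ k * V.
    by rewrite mulr_ege1// exprn_ege1// ler1n.
  have [m [m1 m2]] := near_dyadic_level kV1.
  apply: (@le_trans _ _ ((4 / V * 4^-1 ^+ k)%:E * ((4 ^+ m)%:E * B))%E).
    apply: (@le_trans _ _ ((4 / V * 4^-1 ^+ k)%:E * window_sum p a b
        (fun x z => ((volRd x <= 4 ^+ m)%R%:R * `|z : R|)%R) w)%E); last first.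
      by apply: lee_wpmul2l; [rewrite lee_fin|exact: hB].
    rewrite -nneseriesZl; last by move=> i _; rewrite lee_fin !mulr_ge0.
    apply: lee_nneseries => // i _.
    rewrite -EFinM lee_fin ler_wpM2l// ler_wpM2l// ler_wpM2r// ler_nat.
    by case: (leP (volRd _) (2 ^+ k * V)) => // h; rewrite (le_trans h).
  rewrite muleA lee_wpmul2r// -EFinM lee_fin.
  apply: (@le_trans _ _ (4 / V * 4^-1 ^+ k * (4 * (2 ^+ k * V)))).
    by rewrite ler_wpM2l.
  rewrite le_eqVlt; apply/orP; left; apply/eqP.
  rewrite !exprVn (_ : 4 = 2 * 2 :> R) ?exprMn; last by rewrite -natrM.
  have : 2 ^+ k != 0 :> R by rewrite expf_neq0.
  move: (2 ^+ k) => z z0; field.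
  by rewrite z0 gt_eqF.
rewrite -nneseries_mulr//.
apply: lee_wpmul2r => //.
under eq_eseriesr do rewrite EFinM.
by rewrite nneseriesZl// geometric_half_eseries -EFinM lee_fin -natrM.
Qed.

Let sqrt4 : Num.sqrt 4 = 2 :> R.
Proof.
have -> : 4 = 2 ^+ 2 :> R by ring.
by rewrite sqrtr_sqr ger0_norm.
Qed.

Lemma volume_kernel_shift (V V' v : R) : 0 < V -> V <= V' <= 2 ^+ d * V -> 0 <= v ->
  volume_kernel V' v <= 2 ^+ d * volume_kernel V v.
Proof.
move=> V0 /andP[VV' V'V] v0; have V'0 : 0 < V' := lt_le_trans V0 VV'.
rewrite /volume_kernel mulrA; apply: ler_pM => //; [exact: ltW| |].
  by rewrite invr_ge0 addr_ge0 ?sqr_ge0.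
rewrite lef_pV2 ?posrE ?ltr_pwDl ?exprn_gt0 ?sqr_ge0// lerD2r.
by rewrite ler_sqr ?nnegrE ?(ltW V0) ?(ltW V'0).
Qed.

Definition jump_sum (w : Omega) (t : R) : \bar R :=
  (\sum_(i <oo) (jump_majorant t (p i w))%:E)%E.

Let hb := @heat_bound R d.
Let hb0 : 0 < hb := @heat_bound_gt0 R d.

Lemma jump_majorant_ge0 t (q : MS) : 0 <= jump_majorant t q.
Proof. by rewrite /jump_majorant mulr_ge0// heat_kernel_ge0. Qed.

Lemma jump_majorant_le t (q : MS) : q.1.1 < t ->
  jump_majorant t q <=
  hb * (volume_kernel (Num.sqrt (t - q.1.1) ^+ d) (volRd q.1.2) * `|q.2 : R|).
Proof.
move=> qt; rewrite /jump_majorant mulrA ler_wpM2r// -(volRd_opp q.1.2).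
by rewrite heat_kernel_le// subr_gt0.
Qed.

Lemma jump_majorant_future t (q : MS) : t <= q.1.1 -> jump_majorant t q = 0.
Proof. by move=> tq; rewrite /jump_majorant /heat_kernel subr_gt0 ltNge tq mul0r. Qed.

(** With s = t - (j + 1) >= 1, the ages in the slab lie between s and s + 1 <= 4 s, so the scales
    differ by at most 2^d and one kernel serves the whole slab. The bound does not depend on t. *)
Lemma old_slab_sum_le (w : Omega) (j : nat) (t : R) (B : \bar R) :
  (0 <= B)%E -> j.+2%:R <= t ->
  (forall m, window_sum p j%:R j.+1%:R
    (fun x z => ((volRd x <= 4 ^+ m)%R%:R * `|z : R|)%R) w <= (4 ^+ m)%:E * B)%E ->
  (\sum_(i <oo) (in_window j%:R j.+1%:R (p i w) * jump_majorant t (p i w))%:E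
    <= (hb * 2 ^+ d * 32)%:E * B)%E.
Proof.
move=> B0 jt hB.
have s1 : 1 <= t - j.+1%:R by move: jt; rewrite -natr1; lra.
pose V : R := Num.sqrt (t - j.+1%:R) ^+ d.
have q1 : 1 <= Num.sqrt (t - j.+1%:R) by rewrite -[leLHS]sqrtr1 ler_wsqrtr.
have V1 : 1 <= V by rewrite exprn_ege1.
apply: (@le_trans _ _ ((hb * 2 ^+ d)%:E * window_sum p j%:R j.+1%:R
    (fun x z => (volume_kernel V (volRd x) * `|z : R|)%R) w)%E); last first.
  rewrite [in leRHS]EFinM -muleA lee_wpmul2l ?lee_fin ?mulr_ge0 ?exprn_ge0 ?(ltW hb0)//.
  exact: window_sum_kernel_le.
have vk0 x : 0 <= volume_kernel V x by apply: volume_kernel_ge0; rewrite ltW// (lt_le_trans ltr01).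
rewrite -nneseriesZl; last first.
  by move=> i _; rewrite lee_fin mulr_ge0// mulr_ge0.
apply: lee_nneseries => [i _ _|i _].
  by rewrite lee_fin mulr_ge0// jump_majorant_ge0.
rewrite -EFinM lee_fin [leRHS]mulrCA /in_window; case: (boolP (_ < _ <= _)) => ji; last by rewrite !mul0r.
rewrite !mul1r; case/andP: ji => j1 j2.
have it : (p i w).1.1 < t.
  by apply: le_lt_trans j2 _; move: s1; lra.
apply: (le_trans (jump_majorant_le it)); rewrite -[leRHS]mulrA ler_pM2l// [leRHS]mulrA ler_wpM2r//.
apply: volume_kernel_shift; rewrite ?volRd_ge0//; first exact: lt_le_trans V1.
have le1 : Num.sqrt (t - j.+1%:R) <= Num.sqrt (t - (p i w).1.1).
  by rewrite ler_wsqrtr// lerB.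
rewrite lerXn2r ?nnegrE ?sqrtr_ge0//= /V -exprMn lerXn2r ?nnegrE ?mulr_ge0 ?sqrtr_ge0//.
rewrite -sqrt4.
rewrite -sqrtrM// ler_wsqrtr//.
by move: j1 s1; rewrite -natr1; lra.
Qed.

Lemma recent_sum_le (w : Omega) (n : nat) (t : R) (K : R) : (0 < n)%N ->
  n%:R <= t < n.+1%:R ->
  (forall V : nat -> R, (forall i, (0 < V i <= 2 ^+ d)%R) ->
    \sum_(i <oo) (in_window n.-1%:R n.+1%:R (p i w) *
      (volume_kernel (V i) (volRd (p i w).1.2) * `|(p i w).2 : R|)%R)%:E <= K%:E)%E ->
  (\sum_(i <oo) (in_window n.-1%:R n.+1%:R (p i w) * jump_majorant t (p i w))%:E
    <= (hb * K)%:E)%E.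
Proof.
move=> n0 /andP[nt tn] hK.
(* The value 1 is a placeholder: the other points are outside the window or not before t, and
   contribute 0. *)
pose V i : R := if (n.-1%:R < (p i w).1.1) && ((p i w).1.1 < t)
  then Num.sqrt (t - (p i w).1.1) ^+ d else 1.
have V2 i : 0 < V i <= 2 ^+ d.
  rewrite /V; case: ifP => [/andP[i1 i2]|_]; last by rewrite ltr01 exprn_ege1// ler1n.
  rewrite exprn_gt0 ?sqrtr_gt0 ?subr_gt0//= lerXn2r ?nnegrE ?sqrtr_ge0//.
  rewrite -sqrt4.
  apply: ler_wsqrtr; move: i1 tn; rewrite -[in n.+1](prednK n0) -!natr1; lra.
have vk0 i x : 0 <= volume_kernel (V i) x.
  by apply: volume_kernel_ge0; case/andP: (V2 i) => /ltW.
apply: (@le_trans _ _ (hb%:E * \sum_(i <oo) (in_window n.-1%:R n.+1%:R (p i w) *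
      (volume_kernel (V i) (volRd (p i w).1.2) * `|(p i w).2 : R|)%R)%:E)%E); last first.
  by rewrite [leRHS]EFinM lee_wpmul2l ?hK// lee_fin ltW.
rewrite -nneseriesZl; last first.
  by move=> i _; rewrite lee_fin mulr_ge0// mulr_ge0.
apply: lee_nneseries => [i _ _|i _].
  by rewrite lee_fin mulr_ge0// jump_majorant_ge0.
rewrite -EFinM lee_fin [leRHS]mulrCA /in_window; case: (boolP (_ < _ <= _)) => ji; last by rewrite !mul0r.
rewrite !mul1r; case/andP: ji => j1 j2.
case: (ltP (p i w).1.1 t) => it; last first.
  by rewrite (jump_majorant_future it) mulr_ge0 ?(ltW hb0)// mulr_ge0.
by apply: (le_trans (jump_majorant_le it)); rewrite /V j1 it.
Qed.

End almost_sure_bound.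

Section nonnegative_series.
Context {R : realType}.

Lemma ae_lt_pinfty {disp : measure_display} {T : measurableType disp}
    (mu : {measure set T -> \bar R}) (f : T -> \bar R) :
  measurable_fun setT f -> (forall x, 0 <= f x)%E -> (\int[mu]_x f x < +oo)%E ->
  {ae mu, forall x, (f x < +oo)%E}.
Proof.
move=> mf f0 foo.
have fi : mu.-integrable setT f.
  apply/integrableP; split => //.
  by rewrite (eq_integral f)// => x _; rewrite gee0_abs.
have := integrable_ae measurableT fi; apply: filterS => x /(_ I).
by rewrite ge0_fin_numE.
Qed.

(** With [ae_lt_pinfty], this is the Borel-Cantelli argument: variables with summable means are
    almost surely eventually below 1. *)
Lemma nneseries_lt1 (a : nat -> \bar R) : (forall n, 0 <= a n)%E ->
  (\sum_(n <oo) a n < +oo)%E -> exists n0, forall n, (n0 <= n)%N -> (a n < 1)%E.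
Proof.
move=> a0 /nneseries_tail_cvg /(_ (fun n _ => a0 n)).
move=> /fine_cvgP[tf /cvgrPdist_lt /(_ 1 ltr01)] tl.
have [n0 _ hn] := filterI tf tl.
exists n0 => n /hn /= [tn]; rewrite sub0r normrN => h.
apply: (@le_lt_trans _ _ (\sum_(n <= k <oo) a k)%E).
  have := @nneseries_lim_ge R a xpredT n n.+1 (fun k _ _ => a0 k).
  by rewrite big_nat1.
by rewrite -(fineK tn) lte_fin; apply: le_lt_trans h; exact: ler_norm.
Qed.

End nonnegative_series.

Section almost_sure_smallness.
Context {R : realType} {d : nat}.
Hypothesis d0 : (0 < d)%N.
Context {disp : measure_display} {Omega : measurableType disp}.
Context (P : probability Omega R).
Notation MS := (marked_spacetime R d).
Context (p : nat -> {mfun Omega >-> MS}).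
Context (lambda : {measure set (measurableTypeR R) -> \bar R}).
Hypothesis lambda0 : lambda [set 0] = 0%E.
Hypothesis lambda1 : (\int[lambda]_z (`|z : R|)%:E < +oo)%E.
Hypothesis hN : poisson_random_measure P (noise_intensity lambda)
  (fun w => counting_measure_of_points (p^~ w)).
Hypothesis lambda_log : (\int[lambda]_(z in `[(-1)%R, 1%R])
  (`|(z : R) * ln `|(z : R)| |)%:E < +oo)%E.
Context (eps : R).
Hypothesis eps0 : 0 < eps.
Hypothesis lambda_eps : (\int[lambda]_z (`|z : R| `^ (1 + eps))%:E < +oo)%E.
Hypothesis p_pos : forall i w, 0 < (p i w).1.1.

Context (f : R -> R).
Hypothesis f0 : forall t, 0 < t -> 0 < f t.
Hypothesis fle : forall s t, 0 < s -> s <= t -> f s <= f t.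
Hypothesis fint : (\int[lebesgue_measure]_(t in `[1%R, +oo[) (1 / f t)%:E < +oo)%E.

Let F n : R := f n.+1%:R.
Let F0 n : 0 < F n. Proof. by apply: f0. Qed.
Let Fle m n : (m <= n)%N -> F m <= F n.
Proof. by move=> mn; apply: fle; rewrite // ler_nat. Qed.
Let invF0 n : (0 <= (1 / F n)%:E)%E.
Proof. by rewrite lee_fin divr_ge0// ltW. Qed.

Let sF : (\sum_(n <oo) (1 / F n)%:E < +oo)%E.
Proof.
rewrite (nneseries_split 0 1)// big_nat1 lte_add_pinfty ?ltry//.
rewrite -(nneseries_addn 1)//.
apply: le_lt_trans fint; apply: le_trans (integral_inv_ge f0 fle).
rewrite le_eqVlt; apply/orP; left; apply/eqP; apply: eq_eseriesr => n _.
by rewrite /F addn1.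
Qed.

Let sF_fin : (\sum_(n <oo) (1 / F n)%:E)%E \is a fin_num.
Proof. by rewrite ge0_fin_numE// nneseries_ge0. Qed.

Let hb := @heat_bound R d.
Let hb0 : 0 < hb := @heat_bound_gt0 R d.

(** The slabs j < n - 1 end at time n - 1 or before, hence at least one unit before t, as
    [old_slab_sum_le] requires; the last window holds all remaining points up to t. The
    decomposition is the same for all t of the unit interval. *)
Lemma jump_sum_split (w : Omega) (n : nat) (t : R) : (0 < n)%N ->
  n%:R <= t < n.+1%:R ->
  (jump_sum p w t <=
   \sum_(0 <= j < n.-1) \sum_(i <oo)
     (in_window j%:R j.+1%:R (p i w) * jump_majorant t (p i w))%:E +
   \sum_(i <oo) (in_window n.-1%:R n.+1%:R (p i w) * jump_majorant t (p i w))%:E)%E.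
Proof.
move=> n0 /andP[nt tn].
have t0 a b i : (0 <= (in_window a b (p i w) * jump_majorant t (p i w))%:E)%E.
  by rewrite lee_fin mulr_ge0// jump_majorant_ge0.
rewrite -nneseries_sum_nat; last by move=> *; exact: t0.
rewrite -nneseriesD; last 2 first.
- by move=> i _ _; apply: sume_ge0 => j _; exact: t0.
- by move=> i _ _; exact: t0.
apply: lee_nneseries => [i _ _|i _]; first by rewrite lee_fin jump_majorant_ge0.
have S0 : (0 <= \sum_(0 <= j < n.-1)
    (in_window j%:R j.+1%:R (p i w) * jump_majorant t (p i w))%:E)%E.
  by apply: sume_ge0 => j _; exact: t0.
have [ti|it] := leP t (p i w).1.1.
  by rewrite [X in (X%:E <= _)%E](jump_majorant_future ti) adde_ge0.
have [in1|ni1] := leP (p i w).1.1 n.-1%:R; last first.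
  rewrite -[leLHS]add0e leeD// lee_fin /in_window ni1.
  by rewrite (le_trans (ltW it)) ?mul1r// ltW.
have ex : exists k, (p i w).1.1 <= k%:R by exists n.-1.
have [k ik kmin] := ex_minnP ex.
case: k ik kmin => [|j] ij jmin.
  by have := lt_le_trans (p_pos i w) ij; rewrite ltxx.
have jn : (j < n.-1)%N by exact: jmin.
have ji : j%:R < (p i w).1.1 by rewrite ltNge; apply/negP => /jmin; rewrite ltnn.
rewrite -[leLHS]adde0 leeD//.
rewrite big_mkord (bigD1 (Ordinal jn))//= /in_window ji ij mul1r leeDl//.
by apply: sume_ge0 => k _; exact: t0.
Qed.

Theorem jump_sum_small : {ae P, forall w, forall e : R, 0 < e ->
  exists T : R, forall t, T <= t -> (jump_sum p w t <= (e * f t)%:E)%E}.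
Proof.
have [B hB] := choice (slab_majorant d0 lambda0 lambda1 hN eps0 lambda_eps).
pose K := @slab_const R d lambda eps.
have mB j : measurable_fun setT (B j) by case: (hB j).
have B0 j w : (0 <= B j w)%E by case: (hB j).
have BF0 j w : (0 <= (1 / F j)%:E * B j w)%E by rewrite mule_ge0.
have mBF j : measurable_fun setT (fun w => (1 / F j)%:E * B j w)%E.
  exact: measurable_funeM.
(* The means of the [B j] are bounded in j, so the sum weighted by 1 / F j has finite mean.
   Kronecker's lemma then makes the sum of the first n of them o(F n). *)
have ae1 : {ae P, forall w, (\sum_(j <oo) (1 / F j)%:E * B j w < +oo)%E}.
  apply: ae_lt_pinfty.
  - exact: ge0_emeasurable_sum.
  - by move=> w; exact: nneseries_ge0.
  rewrite integral_nneseries//.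
  apply: (@le_lt_trans _ _ (\sum_(j <oo) ((1 / F j)%:E * K%:E))%E).
    apply: lee_nneseries => [j _ _|j _]; first exact: integral_ge0.
    rewrite ge0_integralZl_EFin// ?divr_ge0 ?(ltW (F0 j))//.
    by apply: lee_wpmul2l => //; case: (hB j).
  have K0 : (0 <= K%:E)%E.
    by have [_ _ h _] := hB 0%N; apply: le_trans h; exact: integral_ge0.
  rewrite -nneseries_mulr//; apply: lte_mul_pinfty; [|exact: sF_fin|exact: ltry].
  exact: nneseries_ge0.
(* Recent points are compared with a fraction of F, small in terms of e; countably many fractions
   suffice for all e. The maximum with 1 meets the hypothesis of [recent_majorant] and is inactive
   for large m. *)
pose Fq q m : R := Num.max 1 (F m / q.+1%:R).
have Fq1 q m : 1 <= Fq q m by rewrite le_max lexx.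
have mm m : m%:R <= m.+2%:R :> R by rewrite ler_nat -addn2 leq_addr.
have m0 m : 0 <= m%:R :> R by exact: ler0n.
have [G' hG'] := choice (fun qm : nat * nat => recent_majorant d0 lambda0 lambda1 hN
  lambda_log (m0 qm.2) (mm qm.2) (Fq1 qm.1 qm.2)).
pose G q m := G' (q, m).
have hG q m := hG' (q, m).
have mG q m : measurable_fun setT (G q m) by have [h _ _ _] := hG q m; exact: h.
have G0 q m w : (0 <= G q m w)%E by have [_ h _ _] := hG q m; exact: h.
have ae2 : {ae P, forall w, forall q, (\sum_(m <oo) G q m w < +oo)%E}.
  apply/ae_foralln => q; apply: ae_lt_pinfty.
  - exact: ge0_emeasurable_sum.
  - by move=> w; exact: nneseries_ge0.
  rewrite integral_nneseries//.
  set C := 2 ^+ d * jump_mean lambda + 16 * 8 ^+ d * jump_mean lambda.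
  have C0 : 0 <= C.
    by rewrite addr_ge0// mulr_ge0 ?jump_mean_ge0 ?mulr_ge0 ?exprn_ge0.
  apply: (@le_lt_trans _ _ (\sum_(m <oo) ((1 / F m)%:E * (2 * C * q.+1%:R)%:E))%E).
    apply: lee_nneseries => [j _ _|j _]; first exact: integral_ge0.
    have [_ _ h _] := hG q j; apply: (le_trans h).
    rewrite -/C -EFinM lee_fin.
    rewrite (_ : j.+2%:R - j%:R = 2); last by rewrite -addn2 natrD addrAC subrr add0r.
    have Fq0 : 0 < Fq q j := lt_le_trans ltr01 (Fq1 q j).
    have h1 : (Fq q j)^-1 <= q.+1%:R / F j.
      by rewrite -[leRHS]invf_div lef_pV2 ?posrE ?divr_gt0// le_max lexx orbT.
    rewrite (_ : 1 / F j * _ = 2 * C * (q.+1%:R / F j)).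
      by rewrite ler_wpM2l// mulr_ge0.
    by rewrite div1r mulrC -!mulrA.
  rewrite -nneseries_mulr ?lee_fin ?mulr_ge0//.
  apply: lte_mul_pinfty; [|exact: sF_fin|exact: ltry].
  exact: nneseries_ge0.
move: ae1 ae2; apply: filterS2 => w h1 h2 e e0.
have Ffin j : B j w \is a fin_num.
  rewrite ge0_fin_numE// ltNge leye_eq; apply/negP => /eqP Boo.
  move: h1; rewrite (@nneseries_pinfty _ _ _ j)//.
  by rewrite Boo gt0_muley// lte_fin divr_gt0.
pose a j : R := fine (B j w).
have a0 j : 0 <= a j by exact: fine_ge0.
have aE j : B j w = (a j)%:E by rewrite fineK.
have aF : (\sum_(n <oo) (a n / F n)%:E < +oo)%E.
  apply: le_lt_trans h1; rewrite le_eqVlt; apply/orP; left; apply/eqP.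
  by apply: eq_eseriesr => n _; rewrite aE -EFinM div1r mulrC.
have Foo := summable_inv_unbounded F0 sF.
pose c1 : R := hb * 2 ^+ d * 32.
have c10 : 0 < c1 by rewrite !mulr_gt0// exprn_gt0.
have e10 : 0 < e / 2 / c1 by rewrite !divr_gt0.
have [n1 hn1] := kronecker a0 F0 Fle Foo aF e10.
pose c2 : R := hb * (2 * @recent_mean R d lambda + 1).
pose q := Num.Def.archi_bound (`|c2| / (e / 2)).
have [n2 hn2] := nneseries_lt1 (fun m => G0 q m w) (h2 q).
have [n3 hn3] := Foo q.+1%:R.
pose n0 := (maxn n1 (maxn n2 n3)).+2.
exists n0%:R => t n0t.
have t0 : 0 <= t by apply: le_trans n0t.
have /andP[nt tn] := truncn_itv t0.
have : (n0 <= Num.truncn t)%N.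
  by rewrite -ltnS -(ltr_nat R); exact: le_lt_trans tn.
case En : (Num.truncn t) nt tn => [//|n] nt tn n0n.
have nn1 : (n1 <= n)%N by apply: leq_trans (leq_maxl _ _) _; exact: (ltnW n0n).
have nn23 : (maxn n2 n3 <= n)%N by apply: leq_trans (leq_maxr n1 _) _; exact: (ltnW n0n).
have nn2 : (n2 <= n)%N := leq_trans (leq_maxl _ _) nn23.
have nn3 : (n3 <= n)%N := leq_trans (leq_maxr _ _) nn23.
have ntn : n.+1%:R <= t < n.+2%:R by rewrite nt tn.
apply: (le_trans (jump_sum_split w _ ntn)) => //=.
have Ft : F n <= f t by apply: fle.
apply: (@le_trans _ _ ((e * F n)%:E)); last by rewrite lee_fin ler_pM2l.
rewrite (_ : e * F n = e / 2 * F n + e / 2 * F n); last by field.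
rewrite EFinD leeD//.
  apply: (@le_trans _ _ (\sum_(0 <= j < n) (c1 * a j)%:E)%E).
    rewrite big_nat [leRHS]big_nat; apply: lee_sum => j /andP[_ jn].
    rewrite EFinM -aE; apply: old_slab_sum_le => //.
      by apply: le_trans nt; rewrite ler_nat ltnS.
    by case: (hB j) => _ _ _ /(_ w).
  rewrite sumEFin lee_fin -mulr_sumr -ler_pdivlMl// mulrA.
  by rewrite (mulrC c1^-1) hn1.
have FqE : Fq q n = F n / q.+1%:R.
  by rewrite /Fq max_r// ler_pdivlMr// mul1r (le_trans hn3)// Fle.
have [_ _ _ hGq] := hG q n.
apply: le_trans (recent_sum_le d0 _ ntn (hGq w (hn2 _ nn2))) _ => //=.
rewrite lee_fin FqE (_ : n.+2%:R - n%:R = 2); last first.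
  by rewrite -addn2 natrD addrAC subrr add0r.
rewrite mulrA -/c2 mulrCA mulrC ler_pM2r// ler_pdivrMr//.
apply: (le_trans (ler_norm _)); rewrite mulrC -ler_pdivrMr ?divr_gt0//.
apply: (le_trans (ltW (archi_boundP _))); first by rewrite divr_ge0// ltW// divr_gt0.
by rewrite ler_nat.
Unshelve. all: by end_near.
Qed.

End almost_sure_smallness.

(** * Large jumps of a given sign *)

Section big_jumps.
Context {R : realType} {d : nat}.
Hypothesis d0 : (0 < d)%N.
Context {disp : measure_display} {Omega : measurableType disp}.
Context (P : probability Omega R).
Notation MS := (marked_spacetime R d).
Context (p : nat -> {mfun Omega >-> MS}).
Context (lambda : {measure set (measurableTypeR R) -> \bar R}).
Hypothesis lambda0 : lambda [set 0] = 0%E.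
Hypothesis lambda1 : (\int[lambda]_z (`|z : R|)%:E < +oo)%E.
Hypothesis hN : poisson_random_measure P (noise_intensity lambda)
  (fun w => counting_measure_of_points (p^~ w)).
Hypothesis p_pos : forall i w, 0 < (p i w).1.1.

Context (f : R -> R).
Hypothesis f0 : forall t, 0 < t -> 0 < f t.
Hypothesis fle : forall s t, 0 < s -> s <= t -> f s <= f t.
Hypothesis fint : (\int[lebesgue_measure]_(t in `[1%R, +oo[) (1 / f t)%:E = +oo)%E.

Context (sg : R).
Hypothesis sg1 : `|sg| = 1.
Hypothesis lambda_sg : (0 < lambda [set z | (0 < sg * (z : R))%R])%E.

Let nu : {sigma_finite_measure set MS -> \bar R} :=
  with_sigma_finite (noise_intensity_sigma_finite (d := d) (levy_sigma_finite lambda0 lambda1)).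
Let hnu : poisson_random_measure P nu
  (fun w => counting_measure_of_points (p^~ w)) := hN.

Let msg : measurable_fun setT (fun z : measurableTypeR R => sg * (z : R)).
Proof. exact: measurable_funM. Qed.

Let mark_set (a : R) : set (measurableTypeR R) := [set z | (a < sg * (z : R))%R].

Let mmark a : measurable (mark_set a).
Proof.
rewrite (_ : mark_set a = (fun z : measurableTypeR R => sg * (z : R)) @^-1` `]a, +oo[%classic).
  by rewrite -[X in measurable X]setTI; exact: msg.
by apply/seteqP; split => z; rewrite /mark_set /= in_itv/= andbT.
Qed.

Let mark_level : exists2 a : R, 0 < a & (0 < lambda (mark_set a))%E.
Proof.
apply: contrapT => h.
have z0 n : lambda (mark_set n.+1%:R^-1) = 0%E.
  apply/eqP; rewrite eq_le measure_ge0 andbT leNgt; apply/negP => ln.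
  by apply: h; exists n.+1%:R^-1.
move: lambda_sg; rewrite ltNge => /negP; apply.
rewrite (_ : mkset _ = \bigcup_n mark_set n.+1%:R^-1).
  have -> : 0%E = (\sum_(n <oo) lambda (mark_set n.+1%:R^-1))%E.
    by rewrite eseries0.
  by apply: measure_sigma_subadditive => //; exact: bigcup_measurable.
apply/seteqP; split => [z /= z1|z [n _]]; last first.
  by rewrite /mark_set /=; apply: lt_trans.
exists (Num.Def.archi_bound (sg * z)^-1) => //; rewrite /mark_set /=.
rewrite -[ltRHS]invrK ltf_pV2 ?posrE ?invr_gt0//.
apply: (lt_le_trans (archi_boundP _)); first by rewrite invr_ge0 ltW.
by rewrite ler_nat.
Qed.

Definition adverse (t : R) (q : MS) : R := (sg * q.2 < 0)%R%:R * jump_majorant t q.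

Definition adverse_sum (w : Omega) (t : R) : \bar R := (\sum_(j <oo) (adverse t (p j w))%:E)%E.

Let adverse_ge0 t q : 0 <= adverse t q.
Proof. by apply: mulr_ge0 => //; exact: jump_majorant_ge0. Qed.

Let adverse_le t q : adverse t q <= jump_majorant t q.
Proof. by rewrite ler_piMl ?jump_majorant_ge0// lern1 leq_b1. Qed.

Section level.
Context (a : R).
Hypothesis a0 : 0 < a.
Hypothesis lambda_a : (0 < lambda (mark_set a))%E.

Let hit (z : measurableTypeR R) : R := (a < sg * (z : R))%R%:R.

Let mhit : measurable_fun setT hit.
Proof. by apply: measurable_natr_bool; exact: measurable_fun_ltr. Qed.

Let hit_le z : hit z <= a^-1 * `|z : R|.
Proof.
rewrite /hit; case: ltP => az; last by rewrite mulr_ge0// invr_ge0 ltW.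
rewrite ler_pdivlMl// mulr1 (le_trans (ltW az))// (le_trans (ler_norm _))//.
by rewrite normrM sg1 mul1r.
Qed.

Let la : R := fine (\int[lambda]_z (hit z)%:E)%E.

Let laE : (\int[lambda]_z (hit z)%:E = la%:E)%E.
Proof.
rewrite fineK// ge0_fin_numE; last by apply: integral_ge0 => z _; rewrite lee_fin.
apply: (@le_lt_trans _ _ (\int[lambda]_z (a^-1%:E * (`|z : R|)%:E))%E).
  by apply: le_integral_ge0 => z; rewrite ?lee_fin// hit_le.
rewrite ge0_integralZl_EFin//; last 2 first.
- exact: measurable_normz.
- by rewrite invr_ge0 ltW.
by rewrite lte_mul_pinfty ?lee_fin// invr_ge0 ltW.
Qed.

Let la0 : 0 < la.
Proof.
rewrite -lte_fin -laE (eq_integral (fun z => (\1_(mark_set a) z)%:E)).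
  by rewrite integral_indic// setIT.
move=> z _; rewrite indicE /hit /mark_set; congr (_%:R%:E); congr nat_of_bool.
by apply/idP/idP; rewrite inE.
Qed.

Let kap : R := @heat_floor R d.
Let kap0 : 0 < kap := heat_floor_gt0.

(** A point of the slab (n, n + 1] lying in the unit cube is observed no later than n + 2, so F n
    bounds both t and f t at that time. Divergence survives by [divergent_inv_max]. *)
Let F n : R := Num.max (f n.+2%:R) n.+2%:R.
Let F0 n : 0 < F n. Proof. by rewrite lt_max f0. Qed.
Let F2 n : n.+2%:R <= F n. Proof. by rewrite le_max lexx orbT. Qed.

Let sumF : (\sum_(n <oo) (1 / F n)%:E = +oo)%E.
Proof.
apply: divergent_inv_max.
- by move=> n; exact: f0.
- by move=> m n mn; apply: fle => //; rewrite ler_nat !ltnS.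
have t0 n : (0 <= (1 / f n.+1%:R)%:E)%E by rewrite lee_fin divr_ge0// ltW// f0.
have := integral_inv_le f0 fle; rewrite fint leye_eq => /eqP.
rewrite (nneseries_split 0 1)// big_nat1 -(nneseries_addn 1)//.
under eq_eseriesr do rewrite addn1.
by case: (\sum_(_ <oo) _)%E.
Qed.

(* The factor 8 ^ k makes a single favourable jump beat the adverse ones, which
   exceed 4 ^ k times their mean with probability at most 4 ^- k. *)
Let M k : R := 8 ^+ k * (1 + kap * a).
Let M0 k : 0 < M k.
Proof. by rewrite mulr_gt0 ?exprn_gt0// addr_gt0// mulr_gt0. Qed.

(** The largest volume v at which the guaranteed jump kap / v * a still reaches M k * F n. The
    factor 1 + kap * a in M k keeps it below 1. *)
Let b k n : R := kap * a / (M k * F n).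
Let b0 k n : 0 < b k n.
Proof. by apply: divr_gt0; apply: mulr_gt0. Qed.
Let b1 k n : b k n <= 1.
Proof.
rewrite /b ler_pdivrMr; last exact: mulr_gt0.
rewrite mul1r -[leLHS]mulr1.
have ka0 : 0 <= kap * a by rewrite mulr_ge0 ?ltW.
apply: ler_pM => //; last by apply: le_trans (F2 n); rewrite ler1n.
rewrite /M -[leLHS]mul1r; apply: ler_pM => //; last by rewrite lerDr.
by rewrite exprn_ege1// ler1n.
Qed.

(** Volume 0 is excluded: the observation time would then be the jump time itself, where the kernel
    vanishes by convention. *)
Let psi k n (x : Rd R d) (z : measurableTypeR R) : R :=
  (0 < volRd x <= b k n)%R%:R * hit z.

Let mpsi k n : measurable_fun setT (fun q => psi k n q.1 q.2).
Proof.
have mv : measurable_fun setT (fun q : Rd R d * measurableTypeR R => volRd q.1).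
  by apply: (measurableT_comp (@measurable_volRd R d)); exact: measurable_fst.
apply: measurable_funM.
  apply: measurable_natr_bool; apply: measurable_and; first exact: measurable_fun_ltr.
  exact: measurable_fun_ler.
by apply: (measurableT_comp mhit); exact: measurable_snd.
Qed.

Let psi0 k n x z : 0 <= psi k n x z.
Proof. by rewrite mulr_ge0. Qed.

Let int_vol k n :
  (\int[lebesgue_measureRd R d]_x ((0 < volRd x <= b k n)%R%:R)%:E = (2 ^+ d * b k n)%:E)%E.
Proof.
have m0 := @measurable_volRd_le R d 0.
have mb : measurable_fun setT (fun x : Rd R d => (0 < volRd x <= b k n)%R%:R : R).
  by apply: measurable_natr_bool; apply: measurable_and; [apply: measurable_fun_ltr|apply: measurable_fun_ler] => //; exact: measurable_volRd.
have h0 : (\int[lebesgue_measureRd R d]_x ((volRd x <= 0)%R%:R)%:E = 0 :> \bar R)%E.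
  by rewrite (integral_volRd_le d0)// mulr0.
rewrite -(integral_volRd_le d0 (ltW (b0 k n))) -[LHS]adde0 -h0 -ge0_integralD//; last 2 first.
- exact/measurable_EFinP.
- exact/measurable_EFinP.
apply: eq_integral => x _; rewrite -EFinD; congr EFin; move: (volRd x) => v.
case: (ltP 0 v) => v0 /=; rewrite ?addr0// add0r.
by rewrite (le_trans v0 (ltW (b0 k n))).
Qed.

Let int_psi k n : (\int[lambda]_z \int[lebesgue_measureRd R d]_x (psi k n x z)%:E =
  (2 ^+ d * b k n * la)%:E)%E.
Proof.
rewrite (eq_integral (fun z : measurableTypeR R => ((2 ^+ d * b k n)%:E * (hit z)%:E)%E)); last first.
  move=> z _; rewrite -(int_vol k n) /psi; under eq_integral do rewrite EFinM.
  rewrite /hit; case: (_ < _); rewrite ?mule1.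
    by under eq_integral do rewrite mule1.
  by under eq_integral do rewrite mule0; rewrite integral0 mule0.
rewrite ge0_integralZl_EFin; [|exact: measurableT|by move=> z _; rewrite lee_fin|exact/measurable_EFinP|].
  by rewrite laE -EFinM.
by rewrite mulr_ge0 ?exprn_ge0// ltW.
Qed.

(* At this time the kernel issued from q is of maximal order 1 / volRd at 0. *)
Let time_of (q : MS) : R := q.1.1 + supnormRd q.1.2 ^+ 2.

(** Bounds the number of favourable points up to time n in every stage k at once. Being finite, it
    cannot account for the growing number of favourable points, so some occur after time n. *)
Let count (n : nat) : Omega -> \bar R :=
  window_sum p 0 n%:R (fun x z => (volRd x <= 1)%R%:R * hit z).

Section stage.
Context (k N : nat).

(** The windows are disjoint, so this sum of indicators is itself an indicator, of the favourable
    points up to time N. *)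
Let Phi (q : MS) : R :=
  \sum_(0 <= n < N) in_window n%:R n.+1%:R q * psi k n q.1.2 q.2.

Let mterm n : measurable_fun setT
  (fun q : MS => in_window n%:R n.+1%:R q * psi k n q.1.2 q.2).
Proof.
apply: measurable_funM; first exact: measurable_in_window.
apply: (measurableT_comp (@mpsi k n) (g := fun q : MS => (q.1.2, q.2))).
by apply: measurable_fun_pair => //; exact: measurableT_comp.
Qed.

Let mPhi : measurable_fun setT Phi.
Proof. exact: measurable_sum. Qed.

Let term0 n (q : MS) : 0 <= in_window n%:R n.+1%:R q * psi k n q.1.2 q.2.
Proof. exact: mulr_ge0. Qed.

Let Phi_ge0 q : 0 <= Phi q.
Proof. exact: sumr_ge0. Qed.

Let sum_window (q : MS) : \sum_(0 <= n < N) in_window n%:R n.+1%:R q = in_window 0 N%:R q :> R.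
Proof.
rewrite /in_window; elim: N => [|n IH].
  by rewrite big_nil; case: ltP => // s0; rewrite leNgt s0.
rewrite big_nat_recr//= IH; case: (leP q.1.1 n%:R) => sn.
  by rewrite (le_trans sn) ?ler_nat// addr0.
by rewrite andbF add0r (le_lt_trans _ sn).
Qed.

Let psi_le1 n x z : psi k n x z <= 1.
Proof. by rewrite /psi -natrM mulnb lern1 leq_b1. Qed.

Let Phi_le q : Phi q <= in_window 0 N%:R q.
Proof.
rewrite -sum_window; apply: ler_sum => n _.
by rewrite -[leRHS]mulr1 ler_wpM2l.
Qed.

Let Phi_le1 q : Phi q <= 1.
Proof. by apply: (le_trans (Phi_le q)); rewrite /in_window lern1 leq_b1. Qed.

Let Phi_gt0 q : 0 < Phi q -> exists n, [/\ n%:R < (q.1.1 : R) <= n.+1%:R,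
  0 < volRd q.1.2 <= b k n & a < sg * q.2].
Proof.
move=> P0; apply: contrapT => h; move: P0; rewrite /Phi big1 ?ltxx// => n _.
rewrite /in_window /psi /hit; case: (boolP (_ < q.1.1 <= _)) => h1; last by rewrite mul0r.
case: (boolP (_ < volRd _ <= _)) => h2; last by rewrite mul0r mulr0.
case: (boolP (a < _)) => h3; last by rewrite !mulr0.
by exfalso; apply: h; exists n.
Qed.

Let e : R := \sum_(0 <= n < N) 2 ^+ d * b k n * la.

Let int_Phi : (\int[nu]_q (Phi q)%:E = e%:E)%E.
Proof.
under eq_integral do rewrite -sumEFin.
rewrite ge0_integral_sum; [|exact: measurableT|by move=> n; apply/measurable_EFinP|by move=> n q _; rewrite lee_fin].
rewrite -sumEFin; apply: eq_bigr => n _; rewrite -int_psi.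
rewrite (integral_noise_window lambda0 lambda1 (a := n%:R) (b := n.+1%:R) (psi := fun x z => (psi k n x z)%:E))//.
- by rewrite -natr1 addrAC subrr add0r mul1e.
- by rewrite ler_nat.
- exact/measurable_EFinP.
- by move=> x z; rewrite lee_fin.
Qed.

Let mtime : measurable_fun setT time_of.
Proof.
apply: measurable_funD; first exact: measurableT_comp.
apply: measurable_funX; apply: (measurableT_comp (@measurable_supnormRd R d)).
exact: measurableT_comp.
Qed.

(* Summed over pairs of points, H counts the favourable points weighted by
   Markov's bound for the adverse jumps at the time the point is observed. *)
Let H (q : MS * MS) : \bar R :=
  (Phi q.1 * ((4 ^+ k * time_of q.1)^-1 * adverse (time_of q.1) q.2))%:E.

Let H_ge0 q : (0 <= H q)%E.
Proof.
rewrite /H; case: (ltP 0 (Phi q.1)) => [P0|P0]; last first.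
  by have -> : Phi q.1 = 0; [apply/eqP; rewrite eq_le P0 Phi_ge0|rewrite mul0r].
have [n [/andP[s0 _] _ _]] := Phi_gt0 P0.
rewrite lee_fin; apply: mulr_ge0 => //; apply: mulr_ge0 => //.
rewrite invr_ge0; apply: mulr_ge0; first exact: exprn_ge0.
by rewrite addr_ge0 ?sqr_ge0// (le_trans _ (ltW s0)).
Qed.

Let mH : measurable_fun setT H.
Proof.
have mt1 : measurable_fun setT (fun q : MS * MS => time_of q.1).
  exact: measurableT_comp.
apply/measurable_EFinP; apply: measurable_funM; first exact: measurableT_comp.
apply: measurable_funM; first by apply: measurable_funV; exact: measurable_funM.
apply: measurable_funM.
  apply: measurable_natr_bool; apply: measurable_fun_ltr => //.
  apply: (measurableT_comp msg (g := fun q : MS * MS => q.2.2)).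
  exact: measurableT_comp.
apply: (measurableT_comp (@measurable_jump_majorant R d) (g := fun q : MS * MS => (time_of q.1, q.2))).
by apply: measurable_fun_pair.
Qed.

Let D w : \bar R := (\sum_(i <oo) \sum_(j <oo) H (p i w, p j w))%E.

Let D_ge0 w : (0 <= D w)%E.
Proof. by apply: nneseries_ge0 => i _ _; exact: nneseries_ge0. Qed.

Let mD : measurable_fun setT D.
Proof.
apply: ge0_emeasurable_sum => [i w _ _|i _]; first exact: nneseries_ge0.
apply: ge0_emeasurable_sum => // j _.
apply: (measurableT_comp mH (g := fun w => (p i w, p j w))).
by apply: measurable_fun_pair.
Qed.

(** The diagonal term vanishes because a favourable mark is not adverse. In the remaining product
    integral the observation time is fixed while the adverse points are integrated, which costs at
    most a constant times that time, cancelled by the weight in [H]. *)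
Let int_D : (\int[P]_w D w <= (@heat_mass R d * jump_mean lambda / 4 ^+ k * e)%:E)%E.
Proof.
rewrite (second_moment_measure hnu mH H_ge0) [X in (_ + X)%E]integral0_eq ?adde0; last first.
  move=> q _; rewrite /H /adverse /=.
  case: (ltP 0 (Phi q)) => [P0|P0]; last first.
    by have -> : Phi q = 0; [apply/eqP; rewrite eq_le P0 Phi_ge0|rewrite mul0r].
  have [n [_ _ az]] := Phi_gt0 P0.
  by rewrite (ltNge _ 0) (ltW (lt_trans a0 az)) mul0r !mulr0.
have c0 : 0 <= @heat_mass R d * jump_mean lambda / 4 ^+ k.
  by rewrite divr_ge0 ?exprn_ge0// mulr_ge0 ?heat_mass_ge0 ?jump_mean_ge0.
rewrite EFinM -int_Phi -ge0_integralZl_EFin//; last 2 first.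
- by move=> q _; rewrite lee_fin.
- exact/measurable_EFinP.
apply: le_integral_ge0 => q; first exact: integral_ge0.
have HE q' : H (q, q') = ((Phi q * (4 ^+ k * time_of q)^-1)%:E * (adverse (time_of q) q')%:E)%E.
  by rewrite -EFinM -mulrA.
under eq_integral do rewrite HE.
case: (ltP 0 (Phi q)) => [P0|P0]; last first.
  have -> : Phi q = 0 by apply/eqP; rewrite eq_le P0 Phi_ge0.
  by rewrite mul0r integral0_eq ?mule0// => q' _; rewrite mul0e.
have [n [/andP[s0 _] _ _]] := Phi_gt0 P0.
have t0 : 0 < time_of q.
  by rewrite ltr_wpDr ?sqr_ge0// (le_lt_trans _ s0).
have g0 : 0 <= Phi q * (4 ^+ k * time_of q)^-1.
  by apply: mulr_ge0 => //; rewrite invr_ge0; apply: mulr_ge0; rewrite ?exprn_ge0// ltW.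
apply: (@le_trans _ _ ((Phi q * (4 ^+ k * time_of q)^-1)%:E *
    \int[nu]_q' (jump_majorant (time_of q) q')%:E)%E).
  rewrite -ge0_integralZl_EFin//; last 2 first.
  - by move=> q' _; rewrite lee_fin jump_majorant_ge0.
  - apply/measurable_EFinP.
    apply: (measurableT_comp (@measurable_jump_majorant R d) (g := fun q' : MS => (time_of q, q'))).
    by apply: measurable_fun_pair.
  apply: le_integral_ge0 => q'; first by rewrite -EFinM lee_fin; apply: mulr_ge0.
  by rewrite lee_wpmul2l ?lee_fin.
apply: (le_trans (lee_wpmul2l _ (expectation_jump_majorant d0 lambda0 lambda1 (ltW t0)))).
  by rewrite lee_fin.
rewrite -!EFinM lee_fin le_eqVlt; apply/orP; left; apply/eqP.
have : 4 ^+ k != 0 :> R by rewrite expf_neq0.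
by move: (4 ^+ k) => u u0; field; rewrite u0 gt_eqF.
Qed.

Let Phi2 q : ((Phi q)%:E * (Phi q)%:E <= (Phi q)%:E)%E.
Proof. by rewrite -EFinM lee_fin ler_piMl. Qed.

Let cnt0 n (q : MS) : 0 <= in_window 0 n%:R q * ((volRd q.1.2 <= 1)%R%:R * hit q.2).
Proof. by apply: mulr_ge0 => //; apply: mulr_ge0. Qed.

(** W < 1 encodes Chebyshev's bound S > e / 2 for the number S of favourable points and Markov's
    bound D < e / 4. If every favourable point after time n met adverse jumps of at least 4^k times
    its observation time, each would contribute at least 1 to D. Then S <= l + D, so l > e / 4,
    which is impossible for fixed l and large k. *)
Lemma stage_majorant : 2 ^+ k <= e -> exists W : Omega -> \bar R,
  [/\ measurable_fun setT W, forall w, (0 <= W w)%E,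
      (\int[P]_w W w <= ((4 + 4 * (@heat_mass R d * jump_mean lambda)) * 2^-1 ^+ k)%:E)%E &
      forall w n l, (W w < 1)%E -> count n w = l%:E ->
        (forall i, (exists m, [/\ m%:R < ((p i w).1.1 : R) <= m.+1%:R,
            0 < volRd (p i w).1.2 <= b k m & a < sg * (p i w).2]) ->
          n%:R < ((p i w).1.1 : R) ->
          ((4 ^+ k * time_of (p i w))%:E <= adverse_sum w (time_of (p i w)))%E) ->
        2 ^+ k < 4 * l].
Proof.
move=> ke; have e0 : 0 < e by apply: lt_le_trans ke; rewrite exprn_gt0.
pose S w : \bar R := (\sum_(i <oo) (Phi (p i w))%:E)%E.
pose V w := ((S w - e%:E) * (S w - e%:E))%E.
have V0 w : (0 <= V w)%E.
  rewrite /V; case: (_ - _)%E => [x||]; rewrite ?mulyy ?mulNyNy ?leey//.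
  by rewrite -EFinM lee_fin -expr2 sqr_ge0.
have mPhiE : measurable_fun setT (fun q : MS => (Phi q)%:E) by exact/measurable_EFinP.
have PhiE0 (q : MS) : (0 <= (Phi q)%:E)%E by rewrite lee_fin.
have mS : measurable_fun setT S by exact: measurable_point_sum mPhiE PhiE0.
have mV : measurable_fun setT V.
  by apply: emeasurable_funM; apply: emeasurable_funB.
have g1 : 0 <= 4 / e ^+ 2 by rewrite divr_ge0// sqr_ge0.
have g2 : 0 <= 4 / e by rewrite divr_ge0// ltW.
exists (fun w => (4 / e ^+ 2)%:E * V w + (4 / e)%:E * D w)%E; split.
- by apply: emeasurable_funD; exact: measurable_funeM.
- by move=> w; rewrite adde_ge0// mule_ge0.
- rewrite ge0_integralD//; last 4 first.
  + by move=> w _; rewrite mule_ge0.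
  + exact: measurable_funeM.
  + by move=> w _; rewrite mule_ge0.
  + exact: measurable_funeM.
  rewrite !ge0_integralZl_EFin//.
  have VE : (\int[P]_w V w <= e%:E)%E.
    rewrite (campbell_variance hnu mPhiE PhiE0 int_Phi)// -int_Phi.
    by apply: le_integral_ge0 => q //; rewrite mule_ge0.
  apply: (@le_trans _ _ ((4 / e ^+ 2)%:E * e%:E + (4 / e)%:E * (@heat_mass R d * jump_mean lambda / 4 ^+ k * e)%:E)%E).
    by apply: leeD; apply: lee_wpmul2l; rewrite ?lee_fin.
  rewrite -!EFinM -EFinD lee_fin [leRHS]mulrDl exprVn; apply: lerD.
    rewrite (_ : 4 / e ^+ 2 * e = 4 / e); last by field; rewrite gt_eqF.
    by rewrite ler_pM2l// lef_pV2// posrE exprn_gt0.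
  rewrite (_ : 4 / e * _ = 4 * (@heat_mass R d * jump_mean lambda) / 4 ^+ k); last first.
    have : 4 ^+ k != 0 :> R by rewrite expf_neq0.
    by move: (4 ^+ k) => u u0; field; rewrite u0 gt_eqF.
  apply: ler_wpM2l.
    by apply: mulr_ge0 => //; apply: mulr_ge0; rewrite ?heat_mass_ge0 ?jump_mean_ge0.
  by rewrite lef_pV2 ?posrE ?exprn_gt0// lerXn2r ?nnegrE// ler_nat.
move=> w n l W1 nl hw.
have V1 : (V w < ((e / 2) ^+ 2)%:E)%E.
  have : ((4 / e ^+ 2)%:E * V w < 1)%E by apply: le_lt_trans W1; rewrite leeDl// mule_ge0.
  rewrite -invf_div lte_pdivrMl ?divr_gt0 ?exprn_gt0// mule1.
  by rewrite expr_div_n (_ : 2 ^+ 2 = 4)// expr2 -natrM.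
have D1 : (D w < (e / 4)%:E)%E.
  have : ((4 / e)%:E * D w < 1)%E by apply: le_lt_trans W1; rewrite leeDr// mule_ge0.
  by rewrite -invf_div lte_pdivrMl ?divr_gt0// mule1.
have SD : (S w <= l%:E + D w)%E.
  rewrite -nl /count /window_sum -nneseriesD; last 2 first.
  - by move=> i _ _; rewrite lee_fin; exact: cnt0.
  - by move=> i _ _; apply: nneseries_ge0.
  apply: lee_nneseries => [i _ _|i _]; first by rewrite lee_fin.
  case: (ltP 0 (Phi (p i w))) => [P0|P0]; last first.
    apply: (@le_trans _ _ 0%E); first by rewrite lee_fin.
    by apply: adde_ge0; [rewrite lee_fin; exact: cnt0|exact: nneseries_ge0].
  have hm := Phi_gt0 P0; have [m [/andP[s0 s1] /andP[v0 v1] az]] := hm.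
  have sp : 0 < ((p i w).1.1 : R) by apply: le_lt_trans s0.
  case: (leP ((p i w).1.1 : R) n%:R) => sn.
    rewrite -[leLHS]adde0 leeD//; last exact: nneseries_ge0.
    by rewrite lee_fin /in_window sp sn /hit az (le_trans v1 (b1 k m)) mulr1 mul1r Phi_le1.
  have t0 : 0 < time_of (p i w) by rewrite ltr_wpDr ?sqr_ge0.
  apply: (@le_trans _ _ (\sum_(j <oo) H (p i w, p j w))%E); last first.
    by rewrite leeDr// lee_fin; exact: cnt0.
  have g0 : 0 <= Phi (p i w) * (4 ^+ k * time_of (p i w))^-1.
    by apply: mulr_ge0 => //; rewrite invr_ge0; apply: mulr_ge0; rewrite ?exprn_ge0// ltW.
  under eq_eseriesr do rewrite /H /= mulrA EFinM.
  rewrite nneseriesZl//; last by move=> j _; rewrite lee_fin.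
  apply: (@le_trans _ _ ((Phi (p i w) * (4 ^+ k * time_of (p i w))^-1)%:E * (4 ^+ k * time_of (p i w))%:E)%E).
    by rewrite -EFinM mulrVK// unitfE gt_eqF// mulr_gt0// exprn_gt0.
  by apply: lee_wpmul2l; [rewrite lee_fin|apply: hw].
have S0 : (0 <= S w)%E by apply: nneseries_ge0 => i _ _; rewrite lee_fin.
move: V1 SD D1 S0 (D_ge0 w); rewrite /V.
case: (S w) => [s||]//; case: (D w) => [u||]//.
rewrite -EFinB -EFinM -EFinD !lee_fin !lte_fin => V1 SD D1 _ _.
have : e / 2 < s.
  rewrite ltNge; apply/negP => s2; move: V1; rewrite ltNge => /negP; apply.
  rewrite (_ : (s - e) * (s - e) = (e - s) ^+ 2); last by ring.
  by rewrite lerXn2r ?nnegrE; lra.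
by move: ke; lra.
Qed.

End stage.

Let mean_large (k : nat) : exists N,
  2 ^+ k <= \sum_(0 <= n < N) 2 ^+ d * b k n * la.
Proof.
apply: contrapT => /forallNP h.
pose c : R := 2 ^+ d * (kap * a / M k) * la.
have c0 : 0 < c.
  by apply: mulr_gt0 => //; apply: mulr_gt0; [exact: exprn_gt0|apply: divr_gt0 => //; exact: mulr_gt0].
suff : (\sum_(n <oo) (1 / F n)%:E <= (2 ^+ k / c)%:E)%E by rewrite sumF leye_eq.
apply: lime_le; first by apply: is_cvg_nneseries => n _ _; rewrite lee_fin divr_ge0// ltW.
apply: nearW => N; rewrite sumEFin lee_fin ler_pdivlMr// mulr_suml.
have /negP := h N; rewrite -ltNge => /ltW; apply: le_trans.
rewrite le_eqVlt; apply/orP; left; apply/eqP; apply: eq_bigr => n _.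
by rewrite /b /c; field; rewrite !gt_eqF.
Qed.

Let count_fin : {ae P, forall w, forall n, (count n w < +oo)%E}.
Proof.
apply/ae_foralln => n.
have mc : measurable_fun setT (fun q : Rd R d * measurableTypeR R =>
    (volRd q.1 <= 1)%R%:R * hit q.2).
  apply: measurable_funM; first by apply: (measurableT_comp (measurable_volRd_le 1)).
  by apply: (measurableT_comp mhit); exact: measurable_snd.
have c0 (x : Rd R d) (z : measurableTypeR R) : 0 <= (volRd x <= 1)%R%:R * hit z by exact: mulr_ge0.
have n0 : 0 <= n%:R :> R by [].
apply: ae_lt_pinfty.
- exact: measurable_window_sum.
- by move=> w; exact: window_sum_ge0.
rewrite (window_mean lambda0 lambda1 hN (lexx 0) n0 mc c0) lte_mul_pinfty ?lee_fin ?subr_ge0//.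
rewrite (eq_integral (fun z : measurableTypeR R => ((2 ^+ d * 1)%:E * (hit z)%:E)%E)); last first.
  move=> z _; rewrite -(integral_volRd_le d0 ler01); under eq_integral do rewrite EFinM.
  rewrite /hit; case: (_ < _); rewrite ?mule1.
    by under eq_integral do rewrite mule1.
  by under eq_integral do rewrite mule0; rewrite integral0 mule0.
rewrite ge0_integralZl_EFin; [|exact: measurableT|by move=> z _; rewrite lee_fin|exact/measurable_EFinP|].
  by rewrite laE -EFinM ltry.
by rewrite mulr1 exprn_ge0.
Qed.

Let time_le (q : MS) k m : q.1.1 <= m.+1%:R -> volRd q.1.2 <= b k m ->
  time_of q <= m.+2%:R.
Proof.
move=> qm vb; rewrite /time_of -[in leRHS]natr1; apply: lerD => //.
have h : volRd q.1.2 <= 1 := le_trans vb (b1 k m).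
rewrite -(ler_pXn2r d0) ?nnegrE ?sqr_ge0// expr1n -exprM mulnC exprM.
by rewrite -(expr1n _ 2) lerXn2r ?nnegrE// volRd_ge0.
Qed.

Let jump_ge (q : MS) k m : 0 < volRd q.1.2 <= b k m -> a < sg * q.2 ->
  8 ^+ k * F m <= jump_majorant (time_of q) q.
Proof.
move=> /andP[v0 vb] az.
have az' : a <= `|q.2 : R|.
  by rewrite (le_trans (ltW az))// (le_trans (ler_norm _))// normrM sg1 mul1r.
rewrite /jump_majorant /time_of addrAC subrr add0r.
have v0' : 0 < volRd (subRd Rd0 q.1.2) by rewrite volRd_opp.
have := heat_kernel_ge d0 v0'; rewrite volRd_opp supnormRd_opp => hk.
apply: (@le_trans _ _ (kap / volRd q.1.2 * a)); last first.
  by apply: ler_pM => //; [by rewrite divr_ge0 ?ltW|exact: ltW].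
apply: (@le_trans _ _ (M k * F m)).
  by rewrite ler_wpM2r ?(ltW (F0 m))// /M ler_peMr ?exprn_ge0// lerDl ltW// mulr_gt0.
rewrite [leRHS]mulrAC ler_pdivlMr//.
move: vb; rewrite /b ler_pdivlMr; last exact: mulr_gt0.
by rewrite mulrC.
Qed.

(** By contradiction at one large stage k: if no time works, all favourable points after time n fall
    under the last clause of [stage_majorant], whose conclusion is false for this k. *)
Lemma big_jumps_level : {ae P, forall w, forall c1 C L T : R, 0 < c1 -> 0 < C -> 0 <= L ->
  exists t, [/\ T <= t, 0 < t & exists i, [/\ (p i w).1.1 < t, 0 < sg * (p i w).2 &
    ((C * t + L * f t)%:E + C%:E * adverse_sum w t <=
     (c1 * jump_majorant t (p i w))%:E)%E]]}.
Proof.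
have [N hNk] := choice mean_large.
have [W hW] := choice (fun k => stage_majorant (hNk k)).
have mW k : measurable_fun setT (W k) by have [h _ _ _] := hW k.
have W0 k w : (0 <= W k w)%E by have [_ h _ _] := hW k.
have sumW : {ae P, forall w, (\sum_(k <oo) W k w < +oo)%E}.
  apply: ae_lt_pinfty; first by apply: ge0_emeasurable_sum.
    by move=> w; exact: nneseries_ge0.
  rewrite integral_nneseries//.
  pose K : R := 4 + 4 * (@heat_mass R d * jump_mean lambda).
  have K0 : 0 <= K.
    apply: addr_ge0 => //; apply: mulr_ge0 => //.
    by apply: mulr_ge0; [exact: heat_mass_ge0|exact: jump_mean_ge0].
  apply: (@le_lt_trans _ _ (\sum_(k <oo) (K%:E * (2^-1 ^+ k)%:E))%E).
    apply: lee_nneseries => [k _ _|k _]; first exact: integral_ge0.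
    by have [_ _ h _] := hW k; rewrite -EFinM.
  rewrite nneseriesZl ?geometric_half_eseries -?EFinM ?ltry//.
move: sumW count_fin; apply: filterS2 => w sw cw c1 C L T c10 C0 L0.
have [k0 hk0] := nneseries_lt1 (fun k => W0 k w) sw.
pose n := Num.Def.archi_bound `|T|.
have Tn : T <= n%:R.
  by rewrite (le_trans (ler_norm T))// (ltW (archi_boundP _)).
pose l := fine (count n w).
have lE : count n w = l%:E.
  by rewrite fineK// ge0_fin_numE//; apply: window_sum_ge0 => x z; exact: mulr_ge0.
(* The first summand refutes 2^k < 4 l. The second gives (2 C + L) 4^k <= c1 8^k, so the jump beats
   C t, L f t and C times the adverse sum together, each bounded by its constant times 4^k F m. *)
pose A : R := 4 * `|l| + (2 * C + L) / c1.
pose k := maxn k0 (Num.Def.archi_bound `|A|).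
have kk0 : (k0 <= k)%N by exact: leq_maxl.
have A2 : A <= 2 ^+ k.
  have kA : A <= k%:R.
    rewrite (le_trans (ler_norm A))// (le_trans (ltW (archi_boundP _)))//.
    by rewrite ler_nat leq_maxr.
  by rewrite (le_trans kA)// -natrX ler_nat ltnW// ltn_expl.
have [_ _ _ /(_ w n l (hk0 k kk0) lE) hk] := hW k.
apply: contrapT => nex.
suff : 2 ^+ k < 4 * l.
  rewrite ltNge => /negP; apply; apply: le_trans A2; rewrite /A.
  have CL0 : 0 <= 2 * C + L by rewrite addr_ge0// mulr_ge0// ltW.
  by rewrite -[leLHS]addr0 lerD ?divr_ge0 ?(ltW c10)// ler_pM2l// ler_norm.
apply: hk => i [m [/andP[ms sm] /andP[v0 vb] az]] ns.
set q := p i w in ms sm v0 vb az ns *; set t := time_of q.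
have sp : 0 < (q.1.1 : R) by apply: le_lt_trans ms.
have n0 : 0 < supnormRd q.1.2.
  rewrite lt_neqAle supnormRd_ge0 andbT; apply/eqP => h.
  by move: v0; rewrite /volRd -h expr0n gtn_eqF// ltxx.
have st : (q.1.1 : R) < t by rewrite ltrDl exprn_gt0.
have t0 : 0 < t := lt_trans sp st.
have tm : t <= m.+2%:R := time_le sm vb.
have tF : t <= F m := le_trans tm (F2 m).
have ftF : f t <= F m by rewrite le_max fle.
have jF : 8 ^+ k * F m <= jump_majorant t q by apply: jump_ge; rewrite ?v0.
rewrite leNgt; apply/negP => Xm; apply: nex; exists t; split => //.
  by rewrite (le_trans Tn)// ltW// (lt_trans ns).
exists i; split=> //; first by rewrite (lt_trans a0).
apply: (@le_trans _ _ (C * t + L * f t + C * (4 ^+ k * t))%:E).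
  by rewrite [leRHS]EFinD leeD2l// EFinM; apply: lee_wpmul2l; [rewrite lee_fin ltW|exact: ltW].
rewrite lee_fin; apply: (@le_trans _ _ (c1 * (8 ^+ k * F m))); last by rewrite ler_pM2l.
have k4 : 1 <= 4 ^+ k :> R by rewrite exprn_ege1// ler1n.
have k8 : (2 * C + L) * 4 ^+ k <= c1 * 8 ^+ k.
  rewrite (_ : 8 = 2 * 4 :> R); last by rewrite -natrM.
  rewrite exprMn mulrA; apply: ler_wpM2r; first exact: exprn_ge0.
  by rewrite -ler_pdivrMl// [leLHS]mulrC (le_trans _ A2)// /A lerDr mulr_ge0.
apply: (@le_trans _ _ ((2 * C + L) * 4 ^+ k * F m)); last first.
  by rewrite mulrA ler_wpM2r// ltW.
have Fm := F0 m.
have F4 : F m <= 4 ^+ k * F m by rewrite ler_peMl// ltW.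
have h1 : C * t <= C * (4 ^+ k * F m) by rewrite ler_pM2l// (le_trans tF).
have h2 : L * f t <= L * (4 ^+ k * F m) by rewrite ler_wpM2l// (le_trans ftF).
have h3 : C * (4 ^+ k * t) <= C * (4 ^+ k * F m).
  by rewrite ler_pM2l// ler_wpM2l// exprn_ge0.
rewrite (_ : (2 * C + L) * _ * _ =
  C * (4 ^+ k * F m) + L * (4 ^+ k * F m) + C * (4 ^+ k * F m)); last by ring.
by rewrite !lerD.
Qed.

End level.
Theorem big_jumps : {ae P, forall w, forall c1 C L T : R, 0 < c1 -> 0 < C -> 0 <= L ->
  exists t, [/\ T <= t, 0 < t & exists i, [/\ (p i w).1.1 < t, 0 < sg * (p i w).2 &
    ((C * t + L * f t)%:E + C%:E * adverse_sum w t <=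
     (c1 * jump_majorant t (p i w))%:E)%E]]}.
Proof. by have [a a0 la] := mark_level; exact: big_jumps_level a0 la. Qed.

End big_jumps.

(** * Paths of the mild solution *)

Section signed_series.
Context {R : realType} (Q : pred nat) (u : nat -> R).

Let S (n : nat) : R := \sum_(0 <= i < n | Q i) u i.

Lemma summable_is_cvg : summable [set i | Q i] (EFin \o u) -> cvgn S.
Proof.
move=> Qu; pose v i := if Q i then u i else 0.
have -> : S = series v by apply/funext => n; rewrite /S big_mkcond.
apply: normed_cvg.
have Qu' : summable Q (fun i => `|(EFin \o u) i|)%E.
  apply: le_lt_trans Qu; apply: le_esum => i _.
  by rewrite abse_id.
have := summable_cvg (fun i _ => abse_ge0 _) Qu'.
rewrite (_ : (fun n => _) = [normed series v])//.
apply/funext => n; rewrite /= big_mkcond/=.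
by apply: eq_bigr => i _; rewrite /v; case: ifP => _; rewrite ?normr0.
Qed.

(** Adding [v] makes every term nonnegative, so the partial sums eventually dominate 0 and any
    single term. If the sum of [v] is infinite there is nothing to prove. *)
Lemma lim_series_ge (s c : R) (v : nat -> R) : cvgn S -> (forall i, 0 <= v i) ->
  (forall i, Q i -> 0 <= s * u i + v i) ->
  c <= 0 \/ (exists2 i, Q i & c <= s * u i + v i) ->
  (c%:E <= (s * limn S)%:E + \sum_(i <oo) (v i)%:E)%E.
Proof.
move=> cS v0 uv hc.
have V0 : (0 <= \sum_(i <oo) (v i)%:E)%E by apply: nneseries_ge0 => i _ _; rewrite lee_fin.
have [Voo|Vfin] := eqVneq (\sum_(i <oo) (v i)%:E)%E +oo%E.
  by rewrite Voo addey// leey.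
have {}Vfin : (\sum_(i <oo) (v i)%:E)%E \is a fin_num by rewrite ge0_fin_numE// ltey.
rewrite -(fineK Vfin); set V := fine _; rewrite -EFinD lee_fin -lerBlDr.
have -> : s * limn S = limn (fun n => s * S n).
  by apply/esym/cvg_lim => //; apply: cvgMr.
have SV n : \sum_(0 <= i < n | Q i) (s * u i + v i) <= s * S n + V.
  rewrite big_split/= mulr_sumr lerD2l -lee_fin /V (fineK Vfin) -sumEFin.
  apply: (@le_trans _ _ (\sum_(0 <= i < n) (v i)%:E)%E).
    rewrite [leLHS]big_mkcond/=; apply: lee_sum => i _.
    by case: ifP => _; rewrite lee_fin.
  by apply: nneseries_lim_ge => i _ _; rewrite lee_fin.
apply: limr_ge; first by apply: is_cvgMr.
case: hc => [c0|[k Qk ck]].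
  apply: nearW => n; rewrite lerBlDr (le_trans _ (SV n))// (le_trans c0)//.
  by apply: sumr_ge0 => i; exact: uv.
exists k.+1 => // n /= kn; rewrite lerBlDr (le_trans _ (SV n))//.
rewrite big_mkord (bigD1 (Ordinal kn))//= (le_trans ck)// lerDl.
by apply: sumr_ge0 => i /andP[/uv].
Qed.

End signed_series.

Section limits_superior.
Context {R : realType} (g : R -> R).

Lemma limf_esup_pinfty : (forall L T : R, exists2 t, T <= t & L <= g t) ->
  limf_esup (fun t => (g t)%:E) (pinfty_nbhs R) = +oo%E.
Proof.
move=> h; apply/eqP; rewrite -leye_eq; apply: le_ereal_inf_tmp => _ [V [M [_ MV]] <-].
rewrite leye_eq; apply/eqP/eq_infty => L; have [t Mt Lt] := h L (M + 1).
apply: (@le_trans _ _ (g t)%:E); first by rewrite lee_fin.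
by apply: ereal_sup_ubound; exists t => //; apply: MV; apply: lt_le_trans Mt; rewrite ltrDl.
Qed.

Lemma limf_esup_le (B T : R) : (forall t, T < t -> g t <= B) ->
  (limf_esup (fun t => (g t)%:E) (pinfty_nbhs R) < +oo)%E.
Proof.
move=> h; apply: (@le_lt_trans _ _ B%:E); last exact: ltry.
apply: (@le_trans _ _ (ereal_sup ((fun t => (g t)%:E) @` [set t | T < t]))).
  apply: ereal_inf_lbound; exists [set t | T < t] => //.
  by exists T; split => //; exact: num_real.
by apply: ge_ereal_sup => _ [t /= Tt <-]; rewrite lee_fin h.
Qed.

End limits_superior.

Section absent_jumps.
Context {R : realType} {d : nat}.
Context {disp : measure_display} {Omega : measurableType disp}.
Context (P : probability Omega R).
Notation MS := (marked_spacetime R d).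
Context (p : nat -> {mfun Omega >-> MS}).
Context (lambda : {measure set (measurableTypeR R) -> \bar R}).
Hypothesis lambda0 : lambda [set 0] = 0%E.
Hypothesis lambda1 : (\int[lambda]_z (`|z : R|)%:E < +oo)%E.
Hypothesis hN : poisson_random_measure P (noise_intensity lambda)
  (fun w => counting_measure_of_points (p^~ w)).

Let nu : {sigma_finite_measure set MS -> \bar R} :=
  with_sigma_finite (noise_intensity_sigma_finite (d := d) (levy_sigma_finite lambda0 lambda1)).
Let hnu : poisson_random_measure P nu
  (fun w => counting_measure_of_points (p^~ w)) := hN.

Lemma ae_no_mark (A : set (measurableTypeR R)) : measurable A -> lambda A = 0%E ->
  {ae P, forall w, forall i, ~ A (p i w).2}.
Proof.
move=> mA A0.
(* With an infinite weight the mean is still +oo * 0 = 0, while a single point with mark in A would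
   make the sum infinite. *)
pose Phi (q : MS) : \bar R := (+oo * (\1_A q.2)%:E)%E.
have m1A : measurable_fun setT (fun z : measurableTypeR R => (\1_A z : R)%:E).
  exact/measurable_EFinP.
have Phi0 q : (0 <= Phi q)%E by rewrite mule_ge0// lee_fin.
have mPhi : measurable_fun setT Phi.
  by apply: measurable_funeM; apply: (measurableT_comp m1A).
have intPhi : (\int[nu]_q Phi q = 0)%E.
  rewrite (integral_noise_intensity (levy_sigma_finite lambda0 lambda1))//.
  apply/eqP; rewrite eq_le; apply/andP; split; last first.
    by do 3 apply: integral_ge0 => ? _; rewrite mule_ge0 ?lee_fin.
  apply: (@le_trans _ _ (\int[lambda]_z (+oo * (\1_A z)%:E))%E).
    apply: le_integral_ge0 => z.
      by do 2 apply: integral_ge0 => ? _; rewrite mule_ge0 ?lee_fin.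
    rewrite /Phi /= indicE; case: (z \in A); first by rewrite mule1 leey.
    rewrite mule0 integral0_eq// => s _; rewrite integral0_eq// => x _.
    by rewrite mule0.
  by rewrite ge0_integralZl// integral_indic// setIT A0 mule0.
have : {ae P, forall w, (\sum_(i <oo) Phi (p i w) < +oo)%E}.
  apply: ae_lt_pinfty; first exact: measurable_point_sum mPhi Phi0.
    by move=> w; exact: nneseries_ge0.
  by rewrite (campbell hnu mPhi Phi0) intPhi.
apply: filterS => w + i Ai; rewrite (nneseriesD1 (n := i))//.
rewrite /Phi indicE mem_set// mule1 addye ?ltxx//.
by rewrite -ltNye (lt_le_trans ltNy0)// nneseries_ge0.
Qed.

End absent_jumps.

Section noise_points.
Context {R : realType} {d : nat} {disp : measure_display} {Omega : measurableType disp}.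
Context (tau : Omega -> measurableTypeR R) (eta : Omega -> Rd R d)
  (zeta : Omega -> measurableTypeR R).

(** The measurability proofs are arguments so that the structure of measurable function can be
    inferred from the term. *)
Definition noise_point of measurable_fun setT tau & measurable_fun setT eta
    & measurable_fun setT zeta : Omega -> marked_spacetime R d :=
  fun w => (tau w, eta w, zeta w).

Context (mtau : measurable_fun setT tau) (meta : measurable_fun setT eta)
  (mzeta : measurable_fun setT zeta).

Let measurable_noise_point : measurable_fun setT (noise_point mtau meta mzeta).
Proof. by apply: measurable_fun_pair => //; exact: measurable_fun_pair. Qed.

HB.instance Definition _ := isMeasurableFun.Build _ _ _ _
  (noise_point mtau meta mzeta) measurable_noise_point.

End noise_points.

(** * Pathwise comparison of the solution with sums over points *)

Section mild_paths.
Context {R : realType} {d : nat} {disp : measure_display} {Omega : measurableType disp}.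
Context (m0 : R) (sigma : R -> R) (k1 k2 : R).
Context (tau : nat -> Omega -> R) (eta : nat -> Omega -> Rd R d).
Context (zeta : nat -> Omega -> R) (Y : Omega -> R -> Rd R d -> R).
Hypothesis d0 : (0 < d)%N.
Hypotheses (k10 : 0 < k1) (k20 : 0 < k2).
Hypothesis sigmaB : forall x, k1 < sigma x /\ sigma x < k2.

Definition drift_rate : R := `|m0| * (k2 * @heat_mass R d).

Lemma drift_rate_ge0 : 0 <= drift_rate.
Proof. by apply: mulr_ge0 => //; apply: mulr_ge0; [exact: ltW|exact: heat_mass_ge0]. Qed.

Context (w : Omega) (t : R).
Hypothesis t0 : 0 <= t.
Hypothesis mild : mild_identity m0 sigma tau eta zeta Y w t Rd0.

Let sigma0 x : 0 < sigma x.
Proof. by apply: lt_trans k10 _; case: (sigmaB x). Qed.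

(** The common source of the three path estimates: [v] majorizes all jumps and c = 0 for (1b), [v]
    majorizes the adverse jumps and c is a single jump for (1a), [v] = 0 and c = 0 for (2). *)
Lemma mild_lower (s c : R) (v : nat -> R) : `|s| = 1 -> (forall i, 0 <= v i) ->
  (forall i, tau i w <= t -> 0 <= s * jump_term sigma tau eta zeta Y w t Rd0 i + v i) ->
  c <= 0 \/ (exists2 i, tau i w <= t & c <= s * jump_term sigma tau eta zeta Y w t Rd0 i + v i) ->
  (c%:E <= (s * Y w t Rd0 + drift_rate * t)%:E + \sum_(i <oo) (v i)%:E)%E.
Proof.
move=> s1 v0 uv hc; have [idr sj ->] := mild.
have := lim_series_ge (summable_is_cvg sj) v0 uv hc.
move=> /le_trans; apply; apply: leeD => //; rewrite lee_fin mulrDr.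
set I := (X in s * (m0 * X)); set J := limn _.
have hI : `|I| <= k2 * @heat_mass R d * t.
  apply: (Rintegral_heat_kernel_le d0 t0 (ltW k20) idr) => q.
  rewrite /drift_integrand normrM ger0_norm ?heat_kernel_ge0// mulrC.
  rewrite ler_wpM2r ?heat_kernel_ge0// gtr0_norm//.
  by case: (sigmaB (Y w q.1 q.2)) => _ /ltW.
rewrite addrAC lerDr -lerBlDr sub0r lerNl.
rewrite (le_trans (ler_norm _))// normrN !normrM s1 mul1r /drift_rate -mulrA.
by rewrite ler_wpM2l.
Qed.

Let q i : marked_spacetime R d := (tau i w, eta i w, zeta i w).

Let jump_le (s : R) i : `|s| = 1 ->
  - (k2 * jump_majorant t (q i)) <= s * jump_term sigma tau eta zeta Y w t Rd0 i.
Proof.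
move=> s1; rewrite /jump_term lerNl -mulrN.
rewrite (le_trans (ler_norm _))// normrM s1 mul1r normrN !normrM.
rewrite (ger0_norm (heat_kernel_ge0 _ _)) (gtr0_norm (sigma0 _)).
rewrite /jump_majorant [leRHS]mulrA ler_wpM2r// [leLHS]mulrC ler_wpM2r ?heat_kernel_ge0//.
by case: (sigmaB (Y w (tau i w) (eta i w))) => _ /ltW.
Qed.

Let jump_sign (s : R) i : `|s| = 1 -> 0 <= s * zeta i w ->
  k1 * jump_majorant t (q i) <= s * jump_term sigma tau eta zeta Y w t Rd0 i.
Proof.
move=> s1 sz; have sE : s * zeta i w = `|zeta i w|.
  by rewrite -(ger0_norm sz) normrM s1 mul1r.
rewrite /jump_term [leRHS]mulrCA sE [leRHS]mulrAC [leRHS]mulrC.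
apply: ler_wpM2r; first exact: (jump_majorant_ge0 t (q i)).
by case: (sigmaB (Y w (tau i w) (eta i w))) => /ltW.
Qed.

Lemma mild_norm_le (b : R) : (\sum_(i <oo) (jump_majorant t (q i))%:E <= b%:E)%E ->
  `|Y w t Rd0| <= drift_rate * t + k2 * b.
Proof.
move=> hb.
have v0 i : 0 <= k2 * jump_majorant t (q i).
  by apply: mulr_ge0; [exact: ltW|exact: jump_majorant_ge0].
have h s : `|s| = 1 -> 0 <= s * Y w t Rd0 + drift_rate * t + k2 * b.
  move=> s1; have := @mild_lower s 0 _ s1 v0.
  have h0 i : tau i w <= t -> 0 <= s * jump_term sigma tau eta zeta Y w t Rd0 i + k2 * jump_majorant t (q i).
    by move=> _; rewrite -lerBlDr sub0r; exact: jump_le.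
  move=> /(_ h0 (or_introl (lexx 0))) h1; rewrite -lee_fin.
  apply: (le_trans h1); rewrite [leRHS]EFinD leeD2l//.
  under eq_eseriesr do rewrite EFinM.
  rewrite nneseriesZl ?lee_fin ?(ltW k20)//; last by move=> i _; rewrite lee_fin jump_majorant_ge0.
  by rewrite EFinM lee_wpmul2l// lee_fin ltW.
have := h 1 (normr1 _); have := h (-1) (normrN1 _).
by rewrite mul1r mulN1r ler_norml => h1 h2; apply/andP; split; lra.
Qed.

(** As sigma is positive, jumps whose mark has the sign s only help; they may be dropped, except the
    chosen one, and only adverse jumps need compensation. *)
Lemma mild_ge_jump (s : R) (i : nat) : `|s| = 1 -> tau i w <= t -> 0 < s * zeta i w ->
  ((k1 * jump_majorant t (q i))%:E <= (s * Y w t Rd0 + drift_rate * t)%:E +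
    k2%:E * \sum_(j <oo) (adverse s t (q j))%:E)%E.
Proof.
move=> s1 it sz.
have a0 j : 0 <= adverse s t (q j).
  by apply: mulr_ge0 => //; exact: jump_majorant_ge0.
have v0 j : 0 <= k2 * adverse s t (q j) by apply: mulr_ge0 => //; exact: ltW.
rewrite -nneseriesZl ?lee_fin ?(ltW k20)//; last by move=> j _; rewrite lee_fin.
under eq_eseriesr do rewrite -EFinM.
apply: mild_lower => //.
  move=> j _; rewrite /adverse; case: ltP => sj.
    by rewrite mul1r -lerBlDr sub0r; exact: jump_le.
  rewrite mul0r mulr0 addr0 (le_trans _ (jump_sign s1 sj))//.
  by apply: mulr_ge0; [exact: ltW|exact: jump_majorant_ge0].
right; exists i => //; apply: ler_wpDr => //.
by apply: jump_sign => //; exact: ltW.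
Qed.

Lemma mild_le_drift (s : R) : `|s| = 1 -> (forall i, s * zeta i w <= 0) ->
  s * Y w t Rd0 <= drift_rate * t.
Proof.
move=> s1 sz.
have h0 i : tau i w <= t -> 0 <= - s * jump_term sigma tau eta zeta Y w t Rd0 i + 0.
  move=> _; rewrite addr0.
  apply: le_trans (jump_sign (s := - s) (i := i) _ _); rewrite ?normrN//.
    by apply: mulr_ge0; [exact: ltW|exact: jump_majorant_ge0].
  by rewrite mulNr oppr_ge0.
have s1' : `|- s| = 1 by rewrite normrN.
have := mild_lower (c := 0) s1' (fun _ : nat => lexx 0) h0 (or_introl (lexx 0)).
by rewrite eseries0// adde0 lee_fin mulNr; lra.
Qed.

End mild_paths.

Lemma integrable_inv_superlinear {R : realType} (f : R -> R) :
  (forall t, 0 < t -> 0 < f t) ->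
  (forall s t, 0 < s -> s <= t -> f s <= f t) ->
  (\int[lebesgue_measure]_(t in `[1%R, +oo[) (1 / f t)%:E < +oo)%E ->
  forall e : R, 0 < e -> exists T, forall t, T <= t -> t <= e * f t.
Proof.
move=> f0 fle /(le_lt_trans (integral_inv_ge f0 fle)) sf e e0.
have F0 n : 0 < f n.+2%:R by exact: f0.
have Fle a b : (a <= b)%N -> f a.+2%:R <= f b.+2%:R.
  by move=> ab; apply: fle => //; rewrite ler_nat !ltnS.
(* The factor 4 absorbs rounding: with t < n + 3 and n >= 1 one has t < 4 n. *)
have e4 : 0 < e / 4 by rewrite divr_gt0.
have [n0 h] := summable_inv_superlinear F0 Fle sf e4.
exists n0.+3%:R => t n0t.
have t0 : 0 <= t by rewrite (le_trans _ n0t).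
have /andP[nt tn] := truncn_itv t0.
have : (n0.+3 <= Num.truncn t)%N by rewrite -ltnS -(ltr_nat R) (le_lt_trans n0t).
move: nt tn; case: (Num.truncn t) => [|[|n]]// nt tn; rewrite !ltnS => n0n.
have n1 : 1 <= n%:R :> R by rewrite ler1n (leq_trans _ n0n).
have nn0 : (n0 <= n)%N by exact: ltnW.
have fn : f n.+2%:R <= f t by rewrite fle.
have t3 : t < n%:R + 3 by rewrite -natrD addn3.
have hn := h n nn0.
have : e / 4 * f n.+2%:R <= e / 4 * f t by rewrite ler_pM2l.
lra.
Qed.

Unset Implicit Arguments.

Theorem theorem2p10 (R : realType) (d : nat) (disp : measure_display)
    (Omega : measurableType disp) (P : probability Omega R)
    (F : R -> set (set Omega))
    (lambda : {measure set (measurableTypeR R) -> \bar R}) (m : R)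
    (tau : nat -> Omega -> R) (eta : nat -> Omega -> Rd R d)
    (zeta : nat -> Omega -> R)
    (f : R -> R) (sigma : R -> R) (k1 k2 : R)
    (Y : Omega -> R -> Rd R d -> R) :
  let m0 := m - \int[lambda]_z (z : R) in
  let Y0 := fun w t => Y w t Rd0 in
  (1 <= d)%N ->
  levy_measure lambda ->
  lambda setT <> 0%E ->
  (\int[lambda]_z (`|z : R|)%:E < +oo)%E ->
  filtration F ->
  (forall i, [/\ measurable_fun setT (tau i), measurable_fun setT (eta i) &
                 measurable_fun setT (zeta i)]) ->
  (forall i w, 0 < tau i w) ->
  poisson_random_measure P (noise_intensity lambda)
    (noise_measure tau eta zeta) ->
  noise_compatible P F (noise_measure tau eta zeta) ->
  (forall t, 0 < t -> 0 < f t) ->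
  (forall s t, 0 < s -> s <= t -> f s <= f t) ->
  lipschitz sigma ->
  0 < k1 -> 0 < k2 ->
  (forall x, k1 < sigma x /\ sigma x < k2) ->
  mild_solution m0 sigma tau eta zeta Y P F ->
  mild_version_at m0 sigma tau eta zeta Y P Rd0 ->
  (exists eps : R, 0 < eps /\
     (\int[lambda]_z (`|(z : R)| `^ (1 + eps))%:E < +oo)%E) ->
  (\int[lambda]_(z in `[(-1)%R, 1%R]) (`|(z : R) * ln `|(z : R)| |)%:E
     < +oo)%E ->
  ((((\int[lebesgue_measure]_(t in `[1%R, +oo[) (1 / f t)%:E)%E = +oo%E ->
      ((0 < lambda `]0%R, +oo[%classic)%E ->
         {ae P, forall w,
            limf_esup (fun t => (Y0 w t / f t)%:E) (pinfty_nbhs R) = +oo%E}) /\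
      ((0 < lambda `]-oo, 0%R[%classic)%E ->
         {ae P, forall w,
            limf_einf (fun t => (Y0 w t / f t)%:E) (pinfty_nbhs R) = -oo%E}))
    /\
    ((\int[lebesgue_measure]_(t in `[1%R, +oo[) (1 / f t)%:E < +oo)%E ->
      {ae P, forall w, Y0 w t / f t @[t --> +oo] --> (0 : R)}))
   /\
   ((lambda `]0%R, +oo[%classic = 0%E ->
      {ae P, forall w,
         (limf_esup (fun t => (Y0 w t / t)%:E) (pinfty_nbhs R) < +oo)%E}) /\
    (lambda `]-oo, 0%R[%classic = 0%E ->
      {ae P, forall w,
         (-oo < limf_einf (fun t => (Y0 w t / t)%:E) (pinfty_nbhs R))%E}))).
Proof.
move=> m0 Y0 d0 [lambda0 _] _ lambda1 _ mtez tau0 hN _ f0 fle _ k10 k20 sigB _ mild.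
move=> [eps [eps0 leps]] llog.
have mtau i : measurable_fun setT (tau i) by have [] := mtez i.
have meta i : measurable_fun setT (eta i) by have [] := mtez i.
have mzeta i : measurable_fun setT (zeta i) by have [] := mtez i.
pose p i : {mfun Omega >-> marked_spacetime R d} := noise_point (mtau i) (meta i) (mzeta i).
(* Holds by conversion, since [p i w] reduces to the triple in [noise_measure]. *)
have hNp : poisson_random_measure P (noise_intensity lambda)
  (fun w => counting_measure_of_points (p^~ w)) := hN.
have p0 i w : 0 < (p i w).1.1 := tau0 i w.
pose r := @drift_rate R d m0 k2.
have r0 : 0 <= r by exact: drift_rate_ge0.
have unbounded s : `|s| = 1 -> (0 < lambda [set z | (0 < s * (z : R))%R])%E ->
    (\int[lebesgue_measure]_(t in `[1%R, +oo[) (1 / f t)%:E = +oo)%E ->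
    {ae P, forall w, forall L T : R, exists2 t, T <= t & L <= s * (Y0 w t / f t)}.
  move=> s1 ls foo; move: mild (big_jumps d0 lambda0 lambda1 hNp f0 fle foo s1 ls).
  apply: filterS2 => w hm hb L T.
  (* The single constant r + k2 covers both the drift r t and the adverse jumps, which are weighted
     by k2. *)
  have C0 : 0 < r + k2 by rewrite ltr_wpDl.
  have [t [Tt t0 [i [it sz]]]] := hb k1 (r + k2) `|L| T k10 C0 (normr_ge0 L).
  have := mild_ge_jump d0 k10 k20 sigB (ltW t0) (hm t (ltW t0)) s1 (ltW it) sz.
  rewrite -/(adverse_sum p s w t) -/r => hj1 hj2.
  exists t => //; rewrite mulrA ler_pdivlMr ?f0//.
  apply: (@le_trans _ _ (`|L| * f t)); first by rewrite ler_wpM2r ?ler_norm// ltW// f0.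
  have X0 : (0 <= adverse_sum p s w t)%E.
    by apply: nneseries_ge0 => j _ _; rewrite lee_fin; apply: mulr_ge0 => //; exact: jump_majorant_ge0.
  (* An infinite adverse sum would force the finite jump in [hj2] to be infinite. *)
  move: hj2 hj1 X0; case: (adverse_sum p s w t) => [x||//]; last first.
    by rewrite gt0_muley ?lte_fin// addey// leye_eq.
  rewrite -!EFinM -!EFinD !lee_fin => /le_trans hj /hj {}hj x0.
  have : 0 <= k2 * t by rewrite mulr_ge0 ?ltW.
  have : 0 <= r * x by exact: mulr_ge0.
  by move: hj; rewrite !mulrDl /Y0; lra.
have ltmark : (0 < lambda `]0%R, +oo[%classic)%E -> (0 < lambda [set z | (0 < 1 * (z : R))%R])%E.
  congr (_ < lambda _)%E; apply/seteqP; split => z; rewrite /= in_itv/= andbT mul1r//.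
have gtmark : (0 < lambda `]-oo, 0%R[%classic)%E -> (0 < lambda [set z | (0 < -1 * (z : R))%R])%E.
  congr (_ < lambda _)%E; apply/seteqP; split => z; rewrite /= in_itv/= mulN1r oppr_gt0//.
split; last split.
- split; last first.
    move=> fint; move: mild.
    apply: filterS2 (jump_sum_small d0 lambda0 lambda1 hNp llog eps0 leps p0 f0 fle fint) => w hj hm.
    apply/cvgrPdist_le => e e0.
    (* Half of e goes to the drift and half to the jumps; r + 1 instead of r because the drift rate
       may be 0. *)
    have e1 : 0 < e / (2 * (r + 1)) by rewrite divr_gt0// mulr_gt0// ltr_wpDl.
    have e2 : 0 < e / (2 * k2) by rewrite divr_gt0// mulr_gt0.
    have [T1 h1] := integrable_inv_superlinear f0 fle fint e1.
    have [T2 h2] := hj _ e2.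
    near=> t.
    have t0 : 0 < t by near: t; exact: nbhs_pinfty_gt.
    rewrite sub0r normrN normrM normfV (gtr0_norm (f0 _ t0)) ler_pdivrMr ?f0//.
    have T2t : T2 <= t by near: t; apply: nbhs_pinfty_ge; exact: num_real.
    have T1t : T1 <= t by near: t; apply: nbhs_pinfty_ge; exact: num_real.
    apply: (le_trans (mild_norm_le d0 k10 k20 sigB (ltW t0) (hm t (ltW t0)) (h2 t T2t))).
    have := ler_wpM2l r0 (h1 t T1t); rewrite -/r.
    rewrite (_ : k2 * _ = e / 2 * f t); last by field; rewrite gt_eqF.
    have : r * (e / (2 * (r + 1)) * f t) <= e / 2 * f t.
      rewrite mulrA ler_wpM2r ?(ltW (f0 _ t0))//.
      rewrite mulrA ler_pdivrMr ?mulr_gt0// ?ltr_wpDl//.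
      rewrite (_ : e / 2 * (2 * (r + 1)) = e * (r + 1)); last by field.
      by move: e0; nra.
    lra.
  move=> foo; split => [/ltmark l0|/gtmark l0].
    move: (unbounded 1 (normr1 _) l0 foo); apply: filterS => w h.
    apply: limf_esup_pinfty => L T; have [t Tt Lt] := h L T.
    by exists t => //; rewrite -[leRHS]mul1r.
  move: (unbounded (-1) (normrN1 _) l0 foo); apply: filterS => w h.
  (* The lower limit is by definition the negative of the upper limit of the opposite function. *)
  apply: (congr1 oppe (y := +oo%E)).
  apply: (limf_esup_pinfty (g := fun t => - (Y0 w t / f t))) => L T; have [t Tt Lt] := h L T.
  by exists t => //; rewrite -mulN1r.
- move=> l0.
  have := ae_no_mark lambda0 lambda1 hNp _ l0.
  move=> /(_ (measurable_itv _)) nomark; move: mild nomark; apply: filterS2 => w hm nm.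
  apply: (@limf_esup_le _ _ r 0) => t t0; rewrite ler_pdivrMr//.
  have := mild_le_drift d0 k10 k20 sigB (ltW t0) (hm t (ltW t0)) (s := 1) (normr1 _).
  rewrite mul1r; apply => i; rewrite mul1r leNgt; apply/negP => z0.
  by apply: (nm i); rewrite /= in_itv/= andbT.
- move=> l0.
  have := ae_no_mark lambda0 lambda1 hNp _ l0.
  move=> /(_ (measurable_itv _)) nomark; move: mild nomark; apply: filterS2 => w hm nm.
  rewrite /limf_einf lteNr.
  apply: (@limf_esup_le _ (fun t => - (Y0 w t / t)) r 0) => t t0; rewrite -mulNr ler_pdivrMr//.
  have := mild_le_drift d0 k10 k20 sigB (ltW t0) (hm t (ltW t0)) (s := -1) (normrN1 _).
  rewrite mulN1r; apply => i; rewrite mulN1r oppr_le0 leNgt; apply/negP => z0.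
  by apply: (nm i); rewrite /= in_itv.
Unshelve. all: by end_near.
Qed.
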